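(* Let the standing assumptions of the context hold (in particular (A1)–(A3)), let $\rho>0$ satisfy $\gamma_1-\rho>K$, and let the scale parameter $\varepsilon$ satisfy $$0<\varepsilon<\frac{\rho}{\gamma_2+\dfrac{1}{\frac1K-\frac1{\gamma_1-\rho}}}\qquad\text{and}\qquad\kappa_*(K,\gamma_1,\gamma_2,\rho,\varepsilon)<1,$$ where $$\kappa_*(K,\gamma_1,\gamma_2,\rho,\varepsilon)=\frac{K}{\gamma_1-\rho}+\frac{\varepsilon K}{\rho-\varepsilon\gamma_2}+\frac{K^2}{(\gamma_1-\rho)\left(\frac\rho\varepsilon-\gamma_2\right)\left[1-K\left(\frac1{\gamma_1-\rho}+\frac\varepsilon{\rho-\varepsilon\gamma_2}\right)\right]}.$$ Then, as $\mu$ tends to zero, for each initial state $\zeta\in\mathbb H$ of the original system there is a corresponding initial state $\bar\zeta$ on the Wong-Zakai random slow manifold $\mathcal M^{\mu,\varepsilon}(\omega)$ such that $$\|w^\varepsilon(t,\omega,\zeta)-z^{\mu,\varepsilon}(t,\omega,\bar\zeta)\|_{\mathbb H}\le C_1e^{-C_2t}\|\zeta-\bar\zeta\|_{\mathbb H}+o(\mu^\alpha),\quad\text{a.s. for every }t\ge0,$$ with $C_1=\dfrac{1}{1-K\left(\frac1{\gamma_1-\rho}+\frac\varepsilon{\rho-\varepsilon\gamma_2}\right)}$, $C_2=\dfrac\rho\varepsilon$, and $\alpha\in(0,\tfrac12)$.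
   Context: Spaces: $\mathbb H_1,\mathbb H_2$ are separable Hilbert spaces, $\mathbb H=\mathbb H_1\times\mathbb H_2$ with norm $\|\cdot\|_{\mathbb H}=\|\cdot\|_{\mathbb H_1}+\|\cdot\|_{\mathbb H_2}$. Standing assumptions: (A1) $A$ generates a $C_0$-semigroup $e^{At}$ on $\mathbb H_1$ with $\|e^{At}x\|_{\mathbb H_1}\le e^{-\gamma_1t}\|x\|_{\mathbb H_1}$ for $t\ge0$, $x\in\mathbb H_1$, and $B$ generates a $C_0$-group $e^{Bt}$ on $\mathbb H_2$ with $\|e^{Bt}y\|_{\mathbb H_2}\le e^{-\gamma_2t}\|y\|_{\mathbb H_2}$ for $t\le0$, $y\in\mathbb H_2$, for some positive constants $\gamma_1,\gamma_2$. (A2) $f:\mathbb H\to\mathbb H_1$ and $g:\mathbb H\to\mathbb H_2$ are continuous with $f(0,0)=0$, $g(0,0)=0$, and there is $K>0$ such that $\|f(x_1,y_1)-f(x_2,y_2)\|_{\mathbb H_1}$ and $\|g(x_1,y_1)-g(x_2,y_2)\|_{\mathbb H_2}$ are both at most $K(\|x_1-x_2\|_{\mathbb H_1}+\|y_1-y_2\|_{\mathbb H_2})$ for all $(x_i,y_i)\in\mathbb H$. (A3) $K<\gamma_1$. The noise intensity $\sigma$ is an element of the domain $D(A)\subset\mathbb H_1$, with $\|A\sigma\|_{\mathbb H_1}<\infty$. Noise: $B_t(\omega)=\omega(t)$ is a one-dimensional two-sided Brownian motion (not to be confused with the operator $B$) on the canonical space $C_0(\mathbb R,\mathbb R)$ of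 continuous functions vanishing at $0$, with Borel $\sigma$-algebra and Wiener measure $\mathbb P$. The Wiener shift is $\theta_t\omega(s)=\omega(t+s)-\omega(t)$. The space is restricted to a measurable, $(\theta_t)$-invariant subset $\Omega$ of full measure on which the usual sublinear growth properties $B_t(\omega)/t\to0$ and, for each $\mu>0$, $z^\mu(\theta_t\omega)/t\to0$ as $t\to\pm\infty$ hold. For $\mu>0$ the stationary Ornstein–Uhlenbeck process is $z^\mu(\theta_t\omega)=z^\mu_t(\omega)=\frac1\mu\int_{-\infty}^te^{-(t-s)/\mu}\,\mathrm dB_s(\omega)$, and the integrated O-U process is $\Phi^\mu_t(\omega)=\int_0^tz^\mu(\theta_s\omega)\,\mathrm ds$, so $\dot\Phi^\mu_t(\omega)=z^\mu_t(\omega)$. Systems: the original system is $$\dot u^\varepsilon=\tfrac1\varepsilon Au^\varepsilon+\tfrac1\varepsilon f(u^\varepsilon,v^\varepsilon)+\tfrac\sigma{\sqrt\varepsilon}\dot B_t(\omega)\ \text{in }\mathbb H_1,\qquad\dot v^\varepsilon=Bv^\varepsilon+g(u^\varepsilon,v^\varepsilon)\ \text{in }\mathbb H_2,$$ and the Wong-Zakai system is $$\dot x^{\mu,\varepsilon}=\tfrac1\varepsilon Ax^{\mu,\varepsilon}+\tfrac1\varepsilon f(x^{\mu,\varepsilon},y^{\mu,\varepsilon})+\tfrac\sigma{\sqrt\varepsilon}\dot\Phi^\mu_t(\omega)\ \text{in }\mathbb H_1,\qquad\dot y^{\mu,\varepsilon}=By^{\mu,\varepsilon}+g(x^{\mu,\varepsilon},y^{\mu,\varepsilon})\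 \text{in }\mathbb H_2.$$ Their mild solutions (variation of constants) with value $\zeta\in\mathbb H$ at $t=0$ are denoted $w^\varepsilon(t,\omega,\zeta)=(u^\varepsilon(t),v^\varepsilon(t))$ and $z^{\mu,\varepsilon}(t,\omega,\zeta)=(x^{\mu,\varepsilon}(t),y^{\mu,\varepsilon}(t))$. Function space: $C^{-}_{-\rho/\varepsilon}$ is the Banach space of pairs $(x,y)$ of continuous functions $x:(-\infty,0]\to\mathbb H_1$, $y:(-\infty,0]\to\mathbb H_2$ with finite norm $\sup_{t\le0}e^{\frac\rho\varepsilon t}\|x(t)\|_{\mathbb H_1}+\sup_{t\le0}e^{\frac\rho\varepsilon t}\|y(t)\|_{\mathbb H_2}$. Wong-Zakai random slow manifold: $\mathcal M^{\mu,\varepsilon}(\omega)=\{\zeta\in\mathbb H:z^{\mu,\varepsilon}(\cdot,\omega,\zeta)\in C^-_{-\rho/\varepsilon}\}$, where membership means that there is a mild solution on $(-\infty,0]$ with value $\zeta$ at time $0$ lying in $C^-_{-\rho/\varepsilon}$. Under the stated conditions on $\varepsilon$ it is the graph $\{(h^{\mu,\varepsilon}(\omega,\xi),\xi):\xi\in\mathbb H_2\}$ of a function $h^{\mu,\varepsilon}(\omega,\cdot):\mathbb H_2\to\mathbb H_1$, Lipschitz in $\xi$. The state $\bar\zeta$ may depend on $\omega$ and $\mu$; $o(\mu^\alpha)$ is understood as $\mu\to0$, for each fixed $t\ge0$. *)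

(* Defs.v *)
From HB Require Import structures.
From mathcomp Require Import all_boot all_order all_algebra.
From mathcomp Require Import all_classical all_reals all_analysis.

Set Implicit Arguments.
Unset Strict Implicit.
Unset Printing Implicit Defensive.

Import Order.TTheory GRing.Theory Num.Theory.
Import numFieldNormedType.Exports.

Local Open Scope classical_set_scope.
Local Open Scope ring_scope.

(** * Separable Hilbert spaces, semigroups and their generators *)

Section Spaces.
Context {R : realType}.

Definition inner_product_of_norm (V : normedModType R) (ip : V -> V -> R) :=
  [/\ forall x y, ip x y = ip y x,
      forall (a : R) x y z, ip (a *: x + y) z = a * ip x z + ip y z
    & forall x, ip x x = `|x| ^+ 2].

(* Completeness is carried by the type. *)
Definition separable_hilbert (V : completeNormedModType R) :=
  (exists ip, @inner_product_of_norm V ip) /\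
  (exists D : set V, countable D /\ dense D).

(* The values S t for t < 0 are irrelevant. *)
Definition C0_semigroup (V : normedModType R) (S : R -> V -> V) :=
  [/\ forall t, 0 <= t -> linear (S t) /\ continuous (S t),
      forall x, S 0 x = x,
      forall s t x, 0 <= s -> 0 <= t -> S (s + t) x = S s (S t x)
    & forall x, S t x @[t --> 0^'+] --> x].

Definition C0_group (V : normedModType R) (S : R -> V -> V) :=
  [/\ forall t, linear (S t) /\ continuous (S t),
      forall x, S 0 x = x,
      forall s t x, S (s + t) x = S s (S t x)
    & forall x, S t x @[t --> 0] --> x].

(* The operator with domain D and values A (irrelevant outside D) is the
   infinitesimal generator of S, the difference quotient being taken along F:
   0^'+ for semigroups, 0^' for groups. *)
Definition is_generator (F : set_system R) (V : normedModType R)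
    (D : set V) (A : V -> V) (S : R -> V -> V) :=
  forall x y, (D x /\ A x = y) <-> t^-1 *: (S t x - x) @[t --> F] --> y.

Definition generates_C0_semigroup (V : normedModType R)
    (D : set V) (A : V -> V) (S : R -> V -> V) :=
  C0_semigroup S /\ is_generator 0^'+ D A S.

Definition generates_C0_group (V : normedModType R)
    (D : set V) (A : V -> V) (S : R -> V -> V) :=
  C0_group S /\ is_generator 0^' D A S.

End Spaces.

(** * Riemann-Stieltjes integrals of vector-valued functions *)

Section RiemannStieltjes.
Context {R : realType} {V : normedModType R}.

(* I is the integral of phi dw over [a, b] (a <= b), as the limit of tagged
   Riemann-Stieltjes sums when the mesh goes to 0. For phi of bounded variation
   and w a Brownian path this is the pathwise version of the Wiener integral;
   for w = id it is the Riemann integral, which is the Bochner integral when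
   phi is continuous. *)
Definition is_RSint (phi : R -> V) (w : R -> R) (a b : R) (I : V) :=
  forall e : R, 0 < e -> exists2 d : R, 0 < d &
    forall (n : nat) (p tag : nat -> R),
      p 0%N = a -> p n = b ->
      (forall i, (i < n)%N ->
        [/\ p i <= tag i, tag i <= p i.+1 & p i.+1 - p i < d]) ->
      `|\sum_(i < n) (w (p i.+1) - w (p i)) *: phi (tag i) - I| < e.

Definition RSint (phi : R -> V) (w : R -> R) (a b : R) : V :=
  xget 0 [set I | is_RSint phi w a b I].

End RiemannStieltjes.

(** * The canonical space of the two-sided Brownian motion *)

Section Wiener.
Context {R : realType}.

Record wpath := WPath {
  wpath_fun :> R -> R;
  wpath_continuous : continuous wpath_fun;
  wpath0 : wpath_fun 0 = 0 }.

Lemma zero_path_continuous : continuous (fun _ : R => 0 : R).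
Proof. by move=> x; exact: cvg_cst. Qed.

Definition zero_path : wpath := @WPath (fun=> 0) zero_path_continuous erefl.

HB.instance Definition _ := gen_eqMixin wpath.
HB.instance Definition _ := gen_choiceMixin wpath.
HB.instance Definition _ := isPointed.Build wpath zero_path.

(* Open sets for the topology of locally uniform convergence, seen as the
   subspace topology of the compact-open one. *)
Definition wpath_open : set (set wpath) :=
  [set (fun w : wpath => wpath_fun w : {compact-open, R -> R}) @^-1` U
     | U in [set U : set {compact-open, R -> R} | open U]].

Definition wiener_space := g_sigma_algebraType wpath_open.

(* The paths vanish at 0 by construction; the increments are independent and
   centred Gaussian (normal_prob takes the standard deviation). *)
Definition is_wiener_measure (P : probability wiener_space R) :=
  forall (n : nat) (t : nat -> R) (A : nat -> set R),
    (forall i, (i < n)%N -> t i < t i.+1) ->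
    (forall i, (i < n)%N -> measurable (A i)) ->
    P [set w : wpath | forall i, (i < n)%N -> A i (w (t i.+1) - w (t i))] =
    (\prod_(i < n) normal_prob 0 (Num.sqrt (t i.+1 - t i)) (A i))%E.

Lemma wiener_shift_continuous (t : R) (w : wpath) :
  continuous (fun s => w (t + s) - w t).
Proof.
move=> s; apply: cvgB; last exact: cvg_cst.
apply: (@continuous_comp _ _ _ (fun s => t + s) w); last exact: wpath_continuous.
by apply: cvgD; [exact: cvg_cst | exact: cvg_id].
Qed.

Lemma wiener_shift0 (t : R) (w : wpath) : w (t + 0) - w t = 0.
Proof. by rewrite addr0 subrr. Qed.

Definition wiener_shift (t : R) (w : wpath) : wpath :=
  @WPath _ (@wiener_shift_continuous t w) (wiener_shift0 t w).

(* z^mu_t (w), the stationary Ornstein-Uhlenbeck process z^mu (theta_t w). *)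
Definition OU (mu : R) (w : wpath) (t : R) : R :=
  mu^-1 *
  lim (RSint (fun s => expR (- (t - s) / mu) : R^o) w a t @[a --> -oo]).

Definition admissible_paths (P : probability wiener_space R)
    (Om : set wiener_space) :=
  [/\ measurable Om, P Om = 1%E,
      forall t, wiener_shift t @^-1` Om = Om,
      forall w : wpath, Om w ->
        w t / t @[t --> +oo] --> (0 : R) /\ w t / t @[t --> -oo] --> (0 : R)
    & forall (w : wpath) (mu : R), Om w -> 0 < mu ->
        OU mu w t / t @[t --> +oo] --> (0 : R) /\
        OU mu w t / t @[t --> -oo] --> (0 : R)].

End Wiener.
Arguments wpath : clear implicits.
Arguments wiener_space : clear implicits.

(** * The slow-fast systems *)

Section Systems.
Context {R : realType} {H1 H2 : completeNormedModType R}.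
Context (SA : R -> H1 -> H1) (SB : R -> H2 -> H2).
Context (f : H1 * H2 -> H1) (g : H1 * H2 -> H2) (sigma : H1) (eps : R).

(* The library norm on a product is the maximum. *)
Definition normH (z : H1 * H2) : R := `|z.1| + `|z.2|.

(* Variation of constants on the interval J; noise s t N says that N is the
   integral over [s, t] of e^{A (t - r) / eps} sigma against the driving noise. *)
Definition mild_solution (noise : R -> R -> H1 -> Prop) (J : set R)
    (z : R -> H1 * H2) :=
  {within J, continuous z} /\
  forall s t, J s -> J t -> s <= t -> exists F N G,
    [/\ is_RSint (fun r => SA ((t - r) / eps) (f (z r))) id s t F,
        noise s t N,
        is_RSint (fun r => SB (t - r) (g (z r))) id s t G,
        (z t).1 = SA ((t - s) / eps) (z s).1
                  + eps^-1 *: F + (Num.sqrt eps)^-1 *: N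
      & (z t).2 = SB (t - s) (z s).2 + G].

(* Integration against dB_r (w). *)
Definition brownian_noise (w : wpath R) (s t : R) (N : H1) :=
  is_RSint (fun r => SA ((t - r) / eps) sigma) w s t N.

(* Integration against dPhi^mu_r (w) = z^mu_r (w) dr. *)
Definition OU_noise (mu : R) (w : wpath R) (s t : R) (N : H1) :=
  is_RSint (fun r => OU mu w r *: SA ((t - r) / eps) sigma) id s t N.

(* w^eps (., w, zeta): the mild solution on [0, +oo[ of the original system. *)
Definition original_sol (w : wpath R) (zeta : H1 * H2) : R -> H1 * H2 :=
  xget (cst 0) [set z | mild_solution (brownian_noise w) `[0, +oo[ z /\
                        z 0 = zeta].

(* z^{mu,eps} (., w, zeta): the same for the Wong-Zakai system. *)
Definition WZ_sol (mu : R) (w : wpath R) (zeta : H1 * H2) : R -> H1 * H2 :=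
  xget (cst 0) [set z | mild_solution (OU_noise mu w) `[0, +oo[ z /\
                        z 0 = zeta].

(* Norm of C^-_{-rho/eps}, with value +oo outside that space. *)
Definition Cminus_norm (rho : R) (z : R -> H1 * H2) : \bar R :=
  (ereal_sup [set (expR (rho / eps * t) * `|(z t).1|)%:E | t in `]-oo, 0%R]] +
   ereal_sup [set (expR (rho / eps * t) * `|(z t).2|)%:E | t in `]-oo, 0%R]])%E.

Definition Cminus (rho : R) (z : R -> H1 * H2) :=
  {within `]-oo, 0], continuous z} /\ (Cminus_norm rho z < +oo)%E.

Definition WZ_slow_manifold (rho mu : R) (w : wpath R) : set (H1 * H2) :=
  [set zeta | exists z, [/\ mild_solution (OU_noise mu w) `]-oo, 0] z,
                            z 0 = zeta & Cminus rho z]].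

End Systems.

Section Constants.
Context {R : realType}.

Definition kappa_star (K gamma1 gamma2 rho eps : R) : R :=
  K / (gamma1 - rho) + eps * K / (rho - eps * gamma2) +
  K ^+ 2 / ((gamma1 - rho) * (rho / eps - gamma2) *
            (1 - K * (1 / (gamma1 - rho) + eps / (rho - eps * gamma2)))).

Definition tracking_C1 (K gamma1 gamma2 rho eps : R) : R :=
  1 / (1 - K * (1 / (gamma1 - rho) + eps / (rho - eps * gamma2))).

Definition tracking_C2 (rho eps : R) : R := rho / eps.

End Constants.

(* Main.v *)
(* The tracking trajectory is produced directly by a Lyapunov-Perron fixed point
   on the whole line, so the graph h of the slow manifold never enters.  Let Z be
   the Wong-Zakai solution from zeta, kept equal to zeta for t < 0.  In the class of
   trajectories z whose distance to Z is O(e^{-rho t/eps}) on R, solve for the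
   x-component by integrating from -oo and for the difference of the y-components
   by integrating from +oo; the map is Lipschitz with constant
   K/(gamma1 - rho) + K/(rho/eps - gamma2), which is < 1 exactly under the bound
   imposed on eps.  The fixed point stays in the weighted space at -oo, hence
   starts on the manifold, and on t >= 0 its distance to Z is at most C1 e^{-C2 t}
   times the initial distance.

   It remains to compare Z with the original solution from zeta.  Since sigma is
   in D(A), integration by parts turns both noise terms into Riemann integrals of
   the paths B and Phi^mu, so the two solutions differ on [0, T] by at most a
   constant times sup |B - Phi^mu| = sup mu |z^mu - z^mu_0|.  Brownian paths are
   almost surely locally Hoelder of every order beta < 1/2 (Gaussian tails,
   Borel-Cantelli, dyadic chaining), which makes this O(mu^beta), and one takes
   alpha < beta < 1/2. *)

(* The hypotheses give [gamma2 < rho / eps < gamma1 / eps]. The weight [expR (rho / eps * t)] thus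
   lies between the two rates: against it the integral from -oo converges for the fast component and
   the one from +oo for the slow component. At +oo only the difference of the slow components is
   small, so that equation is solved relative to Z. On [t >= 0] this difference then carries no term
   from time 0, and the initial distance enters only through the fast component, with coefficient 1;
   this gives C1 = 1 / (1 - kappa).

   Solutions are picked by [xget], so nothing is known of them before existence and uniqueness on
   [[0, oo[]. Both come from one weighted estimate, which also measures how a solution depends on
   its noise.

   The state zetabar is chosen for every path of [Om] and every mu > 0, before alpha. The o-term is
   the distance of two solutions with the same initial state zeta, so zetabar does not occur in it,
   and null sets enter only through [Om] and the Hoelder bound. *)
Require Import Defs.
From mathcomp Require Import all_boot all_order all_algebra.
From mathcomp Require Import all_classical all_reals all_analysis.
From mathcomp Require Import measurable_realfun ring lra.

Set Implicit Arguments.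
Unset Strict Implicit.
Unset Printing Implicit Defensive.

Import Order.TTheory GRing.Theory Num.Theory.
Import numFieldNormedType.Exports.

Local Open Scope classical_set_scope.
Local Open Scope ring_scope.

(* [lmod] decides identities in a module over a commutative ring by comparing
   the coefficients of the atoms with [ring]. *)
Inductive lexp (R : Type) :=
  | LVar of nat | LZero | LAdd of lexp R & lexp R | LOpp of lexp R
  | LScale of R & lexp R.
Arguments LVar {R}.
Arguments LZero {R}.

Section LmodReflection.
Context {R : comNzRingType} {V : lmodType R}.

Fixpoint leval (env : seq V) (e : lexp R) : V :=
  match e with
  | LVar n => nth 0 env n
  | LZero => 0
  | LAdd e1 e2 => leval env e1 + leval env e2
  | LOpp e1 => - leval env e1
  | LScale c e1 => c *: leval env e1
  end.

Fixpoint lcoef (e : lexp R) (i : nat) : R :=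
  match e with
  | LVar n => if eqn n i then 1 else 0
  | LZero => 0
  | LAdd e1 e2 => lcoef e1 i + lcoef e2 i
  | LOpp e1 => - lcoef e1 i
  | LScale c e1 => c * lcoef e1 i
  end.

(** A conjunction built by recursion instead of a quantification over indices, so that [cbn] leaves
    one closed goal for [ring] per atom. For the same reason [lcoef] tests indices with [eqn]. *)
Fixpoint lcoef_eq (e1 e2 : lexp R) (n : nat) : Prop :=
  if n is n'.+1 then lcoef e1 n' = lcoef e2 n' /\ lcoef_eq e1 e2 n' else True.

Lemma leval_lcoef env e :
  leval env e = \sum_(i < size env) lcoef e i *: nth 0 env i.
Proof.
elim: e => [n||e1 IH1 e2 IH2|e1 IH1|c e1 IH1] /=.
- have [ns|sn] := ltnP n (size env).
    rewrite (bigD1 (Ordinal ns)) //= -[eqn n n]/(n == n) eqxx scale1r big1 ?addr0 // => i.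
    by rewrite -val_eqE eq_sym -[eqn n i]/(n == i) /= => /negPf ->; rewrite scale0r.
  rewrite nth_default // big1 // => i _; rewrite -[eqn n i]/(n == i).
  by rewrite gtn_eqF ?scale0r // (leq_trans (ltn_ord i)).
- by rewrite big1 // => i _; rewrite scale0r.
- by rewrite IH1 IH2 -big_split; apply: eq_bigr => i _; rewrite scalerDl.
- by rewrite IH1 -sumrN; apply: eq_bigr => i _; rewrite scaleNr.
- by rewrite IH1 scaler_sumr; apply: eq_bigr => i _; rewrite scalerA.
Qed.

Lemma lmod_eq env e1 e2 :
  lcoef_eq e1 e2 (size env) -> leval env e1 = leval env e2.
Proof.
rewrite !leval_lcoef => h; apply: eq_bigr => i _; congr (_ *: _).
elim: (size env) h (i : nat) (ltn_ord i) => //= n IH [h1 /IH h2] j.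
by rewrite ltnS leq_eqVlt => /predU1P[->|/h2].
Qed.

End LmodReflection.

Ltac lmod_mem x l :=
  lazymatch l with
  | nil => constr:(false)
  | cons ?y ?t => lazymatch y with x => constr:(true) | _ => lmod_mem x t end
  end.

Ltac lmod_index x l :=
  lazymatch l with
  | cons ?y ?t =>
    lazymatch y with x => constr:(O) | _ => let n := lmod_index x t in constr:(S n) end
  end.

Ltac lmod_atoms e l :=
  lazymatch e with
  | @GRing.add _ ?a ?b => let l := lmod_atoms a l in lmod_atoms b l
  | @GRing.opp _ ?a => lmod_atoms a l
  | @GRing.scale _ _ _ ?a => lmod_atoms a l
  | @GRing.zero _ => l
  | _ => let b := lmod_mem e l in
         lazymatch b with true => l | false => constr:(cons e l) end
  end.

Ltac lmod_quote R e l :=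
  lazymatch e with
  | @GRing.add _ ?a ?b =>
    let a := lmod_quote R a l in let b := lmod_quote R b l in constr:(@LAdd R a b)
  | @GRing.opp _ ?a => let a := lmod_quote R a l in constr:(@LOpp R a)
  | @GRing.scale _ _ ?c ?a => let a := lmod_quote R a l in constr:(@LScale R c a)
  | @GRing.zero _ => constr:(@LZero R)
  | _ => let n := lmod_index e l in constr:(@LVar R n)
  end.

Ltac lmod R V :=
  lazymatch goal with |- @eq _ ?a ?b =>
    let l := lmod_atoms a (@nil V) in
    let l := lmod_atoms b l in
    let ea := lmod_quote R a l in
    let eb := lmod_quote R b l in
    change (@leval _ _ l ea = @leval _ _ l eb);
    apply: lmod_eq; cbn [size lcoef_eq lcoef eqn]; do ! split; try ring
  end.

(** * Riemann-Stieltjes integrals *)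

Lemma subr_mid {V : zmodType} (z x y : V) : x - y = (z - y) - (z - x).
Proof. by rewrite opprB [RHS]addrC subrKA. Qed.

Lemma continuous_epsdelta {R : realType} {U V : normedModType R} (f : U -> V) (x : U) :
  {for x, continuous f} <->
  forall e : R, 0 < e -> exists2 d : R, 0 < d &
    forall y, `|x - y| < d -> `|f x - f y| < e.
Proof.
split=> [/cvgrPdist_lt fx e e0|fx].
  have /nbhs_ballP[d /= d0 dP] := fx _ e0.
  by exists d => // y xy; apply: dP; rewrite -ball_normE.
apply/cvgrPdist_lt => e /fx[d d0 dP].
apply/nbhs_ballP; exists d => //= y; rewrite -ball_normE; exact: dP.
Qed.

Section RiemannStieltjesTheory.
Context {R : realType}.

Lemma partition_mono (n : nat) (p tag : nat -> R) (d : R) :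
  (forall i, (i < n)%N -> [/\ p i <= tag i, tag i <= p i.+1 & p i.+1 - p i < d]) ->
  forall i j, (i <= j)%N -> (j <= n)%N -> p i <= p j.
Proof.
move=> h i j; elim: j => [|j IH]; first by rewrite leqn0 => /eqP ->.
rewrite leq_eqVlt => /predU1P[-> //|]; rewrite ltnS => ij jn.
have [h1 h2 _] := h j jn.
exact: (le_trans (IH ij (ltnW jn)) (le_trans h1 h2)).
Qed.

Lemma partition_bounds {n : nat} {p tag : nat -> R} {a b d : R} :
  p 0%N = a -> p n = b ->
  (forall i, (i < n)%N -> [/\ p i <= tag i, tag i <= p i.+1 & p i.+1 - p i < d]) ->
  forall i, (i < n)%N ->
    [/\ a <= p i, p i <= tag i, tag i <= p i.+1, p i.+1 <= b & p i.+1 - p i < d].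
Proof.
move=> p0 pn h i ni; have [h1 h2 h3] := h i ni.
by split => //; rewrite -?p0 -?pn (partition_mono h) // ltnW.
Qed.

(** The trivial inequality [p i <= p i] gives the conclusion the shape demanded by [is_RSint] when
    [p] serves as its own sequence of tags. *)
Lemma fine_partition (a b d : R) : a <= b -> 0 < d ->
  exists n (p : nat -> R), [/\ p 0%N = a, p n = b &
    forall i, (i < n)%N -> [/\ p i <= p i, p i <= p i.+1 & p i.+1 - p i < d]].
Proof.
move=> ab d0.
pose n := (Num.truncn ((b - a) / d)).+1.
have n0 : (0 : R) < n%:R by rewrite ltr0n.
exists n, (fun i => a + i%:R * ((b - a) / n%:R)); split.
- by rewrite mul0r addr0.
- by rewrite mulrC divfK ?gt_eqF // addrC subrK.
- move=> i _; rewrite lexx.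
  have -> : a + i.+1%:R * ((b - a) / n%:R) =
      a + i%:R * ((b - a) / n%:R) + (b - a) / n%:R.
    by rewrite -natr1 mulrDl mul1r addrA.
  split => //; first by rewrite lerDl divr_ge0 ?subr_ge0 // ltW.
  rewrite addrAC subrr add0r ltr_pdivrMr // mulrC -ltr_pdivrMr //.
  exact: truncnS_gt.
Qed.

Lemma partition_width {n : nat} {p : nat -> R} {a b : R} :
  p 0%N = a -> p n = b -> \sum_(i < n) (p i.+1 - p i) = b - a.
Proof.
by move=> <- <-; rewrite -(big_mkord xpredT (fun i => p i.+1 - p i)) telescope_sumr.
Qed.

Section Basic.
Context {V : normedModType R}.
Implicit Types (phi psi : R -> V) (w : R -> R).

(** For [b < a] there is no tagged partition and every vector is an integral; hence the hypothesis
    [a <= b], which recurs below. *)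
Lemma is_RSint_unique {phi w} {a b : R} {I J : V} :
  a <= b -> is_RSint phi w a b I -> is_RSint phi w a b J -> I = J.
Proof.
move=> ab hI hJ; apply/eqP; rewrite -subr_eq0 -normr_eq0; apply/eqP.
apply/le_anti; rewrite normr_ge0 andbT; apply/ler_addgt0Pl => e e0; rewrite addr0.
have e2 : 0 < e / 2 by rewrite divr_gt0.
have [d1 d10 h1] := hI _ e2; have [d2 d20 h2] := hJ _ e2.
have d0 : 0 < Num.min d1 d2 by rewrite lt_min d10.
have [n [p [p0 pn h]]] := fine_partition ab d0.
have {}h1 := h1 n p p p0 pn _; have {}h2 := h2 n p p p0 pn _.
set S := \sum_(_ < _) _ in h1 h2.
rewrite (subr_mid S) (le_trans (ler_normB _ _)) // [leRHS]splitr lerD // ltW //.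
  by apply: h2 => i /h[? ?]; rewrite lt_min => /andP[].
by apply: h1 => i /h[? ?]; rewrite lt_min => /andP[].
Qed.

Lemma eq_is_RSint phi psi w (a b : R) (I : V) :
  (forall s, a <= s -> s <= b -> phi s = psi s) ->
  is_RSint phi w a b I -> is_RSint psi w a b I.
Proof.
move=> e h eps /h[d d0 {}h]; exists d => // n p tag p0 pn hp.
rewrite (eq_bigr (fun i : 'I_n => (w (p i.+1) - w (p i)) *: phi (tag i))).
  exact: h.
move=> i _; have [h1 h2 h3 h4 _] := partition_bounds p0 pn hp (ltn_ord i).
by rewrite e // ?(le_trans h1) // ?(le_trans h3).
Qed.

Lemma is_RSintD {phi psi w} {a b : R} {I J : V} :
  is_RSint phi w a b I -> is_RSint psi w a b J ->
  is_RSint (fun s => phi s + psi s) w a b (I + J).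
Proof.
move=> hI hJ e e0; have e2 : 0 < e / 2 by rewrite divr_gt0.
have [d1 d10 h1] := hI _ e2; have [d2 d20 h2] := hJ _ e2.
exists (Num.min d1 d2); first by rewrite lt_min d10.
move=> n p tag p0 pn h.
have {}h1 := h1 n p tag p0 pn _; have {}h2 := h2 n p tag p0 pn _.
rewrite (eq_bigr (fun i : 'I_n => (w (p i.+1) - w (p i)) *: phi (tag i)
   + (w (p i.+1) - w (p i)) *: psi (tag i))); last first.
  by move=> i _; rewrite scalerDr.
rewrite big_split /= opprD addrACA (le_lt_trans (ler_normD _ _)) //.
rewrite [ltRHS]splitr ltrD //.
  by apply: h1 => i /h[? ?]; rewrite lt_min => /andP[].
by apply: h2 => i /h[? ?]; rewrite lt_min => /andP[].
Qed.

Lemma is_RSint_refl phi w (a : R) : is_RSint phi w a a 0.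
Proof.
move=> e e0; exists 1 => // n p tag p0 pn h; rewrite big1 ?subrr ?normr0 // => i _.
have [h1 h2 h3 h4 _] := partition_bounds p0 pn h (ltn_ord i).
have -> : p i.+1 = p i.
  apply/le_anti; rewrite (le_trans h4 h1) /=; exact: le_trans h2 h3.
by rewrite subrr scale0r.
Qed.

(** Compare the two Riemann sums on one common fine partition. All exponential estimates below are
    instances with an exponential [m]. *)
Lemma le_norm_is_RSint {phi} {m : R -> R} {a b : R} {I : V} {J : R} :
  a <= b -> (forall s, a <= s -> s <= b -> `|phi s| <= m s) ->
  is_RSint phi id a b I -> is_RSint (m : R -> R^o) id a b J -> `|I| <= J.
Proof.
move=> ab hm hI hJ; apply/ler_addgt0Pr => e e0.
have e2 : 0 < e / 2 by rewrite divr_gt0.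
have [d1 d10 h1] := hI _ e2; have [d2 d20 h2] := hJ _ e2.
have d0 : 0 < Num.min d1 d2 by rewrite lt_min d10.
have [n [p [p0 pn h]]] := fine_partition ab d0.
have {}h1 := h1 n p p p0 pn _; have {}h2 := h2 n p p p0 pn _.
set S := \sum_(_ < _) _ in h1; set S' := \sum_(_ < _) _ in h2.
have SS' : `|S| <= S'.
  rewrite (le_trans (ler_norm_sum _ _ _)) // ler_sum // => i _.
  have [g1 g2 g3 g4 _] := partition_bounds p0 pn h (ltn_ord i).
  rewrite normrZ ger0_norm ?subr_ge0 // ler_wpM2l ?subr_ge0 //.
  by apply: hm => //; exact: le_trans g3 g4.
have {}h1 : `|S - I| <= e / 2.
  by apply/ltW/h1 => i /h[? ?]; rewrite lt_min => /andP[].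
have {}h2 : `|S' - J| <= e / 2.
  by apply/ltW/h2 => i /h[? ?]; rewrite lt_min => /andP[].
have -> : I = S - (S - I) by rewrite opprB addrC subrK.
rewrite (le_trans (ler_normB _ _)) // [e]splitr addrA lerD //.
rewrite (le_trans SS') // -lerBlDl.
exact: le_trans (ler_norm _) h2.
Qed.

End Basic.

Lemma is_RSint_lin {V W : normedModType R} (L : V -> W) (C : R) (phi : R -> V) w
    (a b : R) (I : V) :
  linear L -> (forall x, `|L x| <= C * `|x|) ->
  is_RSint phi w a b I -> is_RSint (fun s => L (phi s)) w a b (L I).
Proof.
move=> linL hL hI e e0.
have L0 : L 0 = 0.
  by apply/normr0_eq0/le_anti; rewrite normr_ge0 andbT (le_trans (hL 0)) ?normr0 ?mulr0.
have LD x y : L (x + y) = L x + L y by rewrite -[x]scale1r linL !scale1r.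
have LZ k x : L (k *: x) = k *: L x by rewrite -[k *: x]addr0 linL L0 !addr0.
have C1 : 0 < `|C| + 1 by rewrite ltr_wpDl.
have [d d0 {}hI] := hI _ (divr_gt0 e0 C1); exists d => // n p tag p0 pn h.
rewrite (eq_bigr (fun i : 'I_n => L ((w (p i.+1) - w (p i)) *: phi (tag i)))); last first.
  by move=> i _; rewrite LZ.
rewrite -(big_morph L LD L0) -[- L I]scaleN1r -LZ scaleN1r -LD.
apply: (le_lt_trans (hL _)).
apply: (@le_lt_trans _ _ ((`|C| + 1) * `|\sum_(i < n) (w (p i.+1) - w (p i)) *: phi (tag i) - I|)).
  rewrite ler_wpM2r // (le_trans (ler_norm _)) // lerDl //.
by rewrite mulrC -ltr_pdivlMr // hI.
Qed.

Lemma is_RSintZ {V : normedModType R} (k : R) (phi : R -> V) w (a b : R) (I : V) :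
  is_RSint phi w a b I -> is_RSint (fun s => k *: phi s) w a b (k *: I).
Proof.
apply: (@is_RSint_lin _ _ (fun x => k *: x) `|k|) => [c x y|x].
  by rewrite scalerDr !scalerA mulrC.
by rewrite normrZ.
Qed.

Lemma is_RSintB {V : normedModType R} {phi psi : R -> V} {w} {a b : R} {I J : V} :
  is_RSint phi w a b I -> is_RSint psi w a b J ->
  is_RSint (fun s => phi s - psi s) w a b (I - J).
Proof.
move=> hI hJ; rewrite -scaleN1r.
apply: (@eq_is_RSint _ (fun s => phi s + (-1) *: psi s)).
  by move=> s _ _; rewrite scaleN1r.
by apply: is_RSintD => //; exact: is_RSintZ.
Qed.

Lemma unif_cont_segment {V : normedModType R} (phi : R -> V) (a b : R) :
  continuous phi -> forall e, 0 < e -> exists2 d, 0 < d & forall x y,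
    a <= x -> x <= b -> `|x - y| < d -> `|phi x - phi y| < e.
Proof.
move=> cphi e e0; have e2 : 0 < e / 2 by rewrite divr_gt0.
have /compact_near_coveringP cab := @segment_compact R a b.
(* Compactness in near-covering form, with the modulus [d] itself as the parameter tending to
   [0^'+]; [y] need not lie in the segment. *)
have := cab R (0^'+) (fun d x => forall y, `|x - y| < d -> `|phi x - phi y| < e) _.
case.
- move=> x _; have /continuous_epsdelta/(_ _ e2)[d d0 hd] := cphi x.
  have d2 : 0 < d / 2 by rewrite divr_gt0.
  near=> x' d' => y xy /=.
  have xx' : `|x - x'| < d / 2.
    near: x'; apply/nbhs_ballP; exists (d / 2) => //= z; by rewrite -ball_normE.
  have dd' : d' < d / 2 by near: d'; exact: nbhs_right_lt.
  rewrite (subr_mid (phi x)) (le_lt_trans (ler_normB _ _)) // [ltRHS]splitr ltrD // hd //.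
    have -> : x - y = (x - x') + (x' - y) by rewrite addrA subrK.
    rewrite (le_lt_trans (ler_normD _ _)) // [ltRHS]splitr ltrD //.
    exact: lt_trans xy dd'.
- move=> d /= d0 h; exists (d / 2); first by rewrite divr_gt0.
  move=> x y ax xb xy; apply: (h (d / 2)) => //=.
  + by rewrite sub0r normrN gtr0_norm ?divr_gt0 // ltr_pdivrMr // ltr_pMr // ltr1n.
  + by rewrite divr_gt0.
  + by rewrite in_itv /= ax.
Unshelve. all: by end_near. Qed.

Lemma bounded_segment {V : normedModType R} (phi : R -> V) (a b : R) :
  continuous phi -> exists2 M, 0 < M & forall x, a <= x -> x <= b -> `|phi x| <= M.
Proof.
move=> cphi; have [ab|ba] := leP a b; last first.
  by exists 1 => // x ax xb; have := le_lt_trans (le_trans ax xb) ba; rewrite ltxx.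
have [|c _ hc] := @EVT_max R (fun x => `|phi x|) a b ab _.
  apply: continuous_subspaceT => x; apply: continuous_comp; [exact: cphi|exact: norm_continuous].
exists (`|phi c| + 1); first by rewrite ltr_wpDl.
move=> x ax xb; rewrite (le_trans (hc x _)) ?in_itv /= ?ax // lerDl //.
Qed.

End RiemannStieltjesTheory.

Lemma cauchy_seq_cvg {R : realType} {V : completeNormedModType R} (u : nat -> V) :
  (forall e : R, 0 < e -> exists N, forall n, (N <= n)%N -> `|u n - u N| <= e) ->
  cvgn u.
Proof.
move=> h; apply/cauchy_cvgP/cauchy_exP => e e0.
have [N hN] := h _ (divr_gt0 e0 (ltr0n R 2)).
exists (u N); exists N => // n /= Nn; rewrite -ball_normE /= distrC.
by rewrite (le_lt_trans (hN _ Nn)) // ltr_pdivrMr // ltr_pMr // ltr1n.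
Qed.

Lemma limn_norm_le {R : realType} {V : normedModType R} {u : nat -> V} {l : V} {e : R}
    (N : nat) :
  u @ \oo --> l -> (forall n, (N <= n)%N -> `|u n| <= e) -> `|l| <= e.
Proof.
move=> /cvg_norm ul h; have /= <- := cvg_lim (@Rhausdorff R) ul.
apply: limr_le; first by apply/cvg_ex; exists `|l|.
by exists N => // n; exact: h.
Qed.

(** * Primitives of continuous functions, integration by parts, change of integrator *)

Section Primitive.
Context {R : realType}.

(** A uniform version of F' = phi: the first-order expansion of [F] over short cells, with the tag
    anywhere in the cell. Summed over a partition it compares Riemann sums with the increment of
    [F], and it survives pointwise limits of [F]. *)
Definition cell_estimate {V : normedModType R} (F phi : R -> V) (a b d e : R) :=
  forall s r t, a <= s -> s <= r -> r <= t -> t <= b -> t - s < d ->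
    `|F t - F s - (t - s) *: phi r| <= e * (t - s).

Lemma cell_estimate_sum {V : normedModType R} {F phi : R -> V} {a b d e : R}
    {n : nat} {p tag : nat -> R} :
  cell_estimate F phi a b d e -> p 0%N = a -> p n = b ->
  (forall i, (i < n)%N -> [/\ p i <= tag i, tag i <= p i.+1 & p i.+1 - p i < d]) ->
  `|\sum_(i < n) (p i.+1 - p i) *: phi (tag i) - (F b - F a)| <= e * (b - a).
Proof.
move=> hF p0 pn h.
have -> : F b - F a = \sum_(i < n) (F (p i.+1) - F (p i)).
  by rewrite -p0 -pn -(big_mkord xpredT (fun i => F (p i.+1) - F (p i))) telescope_sumr.
rewrite -sumrB (le_trans (ler_norm_sum _ _ _)) //.
rewrite -(partition_width p0 pn) mulr_sumr ler_sum // => i _.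
have [h1 h2 h3 h4 h5] := partition_bounds p0 pn h (ltn_ord i).
by rewrite distrC hF.
Qed.

Lemma cell_estimate_RSint {V : normedModType R} {F phi : R -> V} {a b : R} :
  a <= b -> (forall e, 0 < e -> exists2 d, 0 < d & cell_estimate F phi a b d e) ->
  is_RSint phi id a b (F b - F a).
Proof.
move=> ab hF e e0; have c0 : 0 < b - a + 1 by rewrite ltr_wpDl // subr_ge0.
have [d d0 hd] := hF _ (divr_gt0 e0 c0); exists d => // n p tag p0 pn h.
rewrite (le_lt_trans (cell_estimate_sum hd p0 pn h)) //.
by rewrite mulrAC ltr_pdivrMr // ltr_pM2l // ltrDl.
Qed.

Section StepPrimitive.
Context {V : normedModType R}.
Variables (phi : R -> V) (a b : R) (ab : a <= b).

Let node (n k : nat) := a + k%:R * ((b - a) / n.+1%:R).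
(** The length of the part of the k-th cell to the left of [t]. Hence [step_primitive n] integrates
    from [a] the step function that equals [phi (node n k)] on the k-th cell. *)
Let coef n k t := Num.min t (node n k.+1) - Num.min t (node n k).

Definition step_primitive n t := \sum_(k < n.+1) coef n k t *: phi (node n k).

Let nodeS n k : node n k.+1 = node n k + (b - a) / n.+1%:R.
Proof. by rewrite /node -natr1 mulrDl mul1r addrA. Qed.

Let mesh_ge0 n : 0 <= (b - a) / n.+1%:R.
Proof. by rewrite divr_ge0 // subr_ge0. Qed.

Let node_ge n k : a <= node n k.
Proof. by rewrite lerDl mulr_ge0. Qed.

Let node_last n : node n n.+1 = b.
Proof. by rewrite /node mulrC divfK ?pnatr_eq0 // addrC subrK. Qed.

Let node_le n k : (k <= n.+1)%N -> node n k <= b.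
Proof.
move=> kn; rewrite -(node_last n) lerD2l ler_wpM2r //.
by rewrite ler_nat.
Qed.

Let coef_sum n t : a <= t -> t <= b -> \sum_(k < n.+1) coef n k t = t - a.
Proof.
move=> at_ tb; rewrite -(big_mkord xpredT (coef n ^~ t)) telescope_sumr //.
by rewrite node_last /node mul0r addr0 (min_idPl tb) (min_idPr at_).
Qed.

Let coef_incr n k s t : s <= t ->
  [/\ 0 <= coef n k t - coef n k s,
      t <= node n k -> coef n k t - coef n k s = 0
    & node n k.+1 <= s -> coef n k t - coef n k s = 0].
Proof.
move=> st; rewrite /coef nodeS; have := mesh_ge0 n.
set h := _ / _; set x := node n k => h0.
by case: (leP t (x + h)); case: (leP t x); case: (leP s (x + h)); case: (leP s x);
  move=> *; split; move=> *; lra.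
Qed.

Lemma step_primitive_start n : step_primitive n a = 0.
Proof.
rewrite /step_primitive big1 // => k _.
by rewrite /coef !(min_idPl _) // subrr scale0r.
Qed.

(** Only cells meeting [[s, t]] receive weight; their left nodes lie between [s] minus the mesh and
    [t], and the weights add up to [t - s]. *)
Lemma step_primitive_estimate n s t v e : a <= s -> s <= t -> t <= b ->
  (forall r, a <= r -> r <= b -> s - (b - a) / n.+1%:R < r -> r < t ->
     `|phi r - v| <= e) ->
  `|step_primitive n t - step_primitive n s - (t - s) *: v| <= e * (t - s).
Proof.
move=> as_ st tb hv.
have at_ := le_trans as_ st; have sb := le_trans st tb.
have ts : t - s = \sum_(k < n.+1) (coef n k t - coef n k s).
  rewrite sumrB !coef_sum //; ring.
rewrite -sumrB [in X in `|X|]ts scaler_suml -sumrB ts mulr_sumr.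
rewrite (le_trans (ler_norm_sum _ _ _)) // ler_sum // => k _.
have [h0 h1 h2] := coef_incr n k st.
rewrite -scalerBl -scalerBr normrZ ger0_norm // mulrC.
have [/h1 ->|xt] := leP t (node n k); first by rewrite !mulr0.
have [/h2 ->|sx] := leP (node n k.+1) s; first by rewrite !mulr0.
rewrite ler_wpM2r // hv //; first by rewrite node_le // ltnW.
by rewrite ltrBlDr -nodeS.
Qed.

End StepPrimitive.

(** Uniform continuity of [phi] gives the step primitives a common cell estimate, with one [d] for
    all large [n]. Two of them are then close to one and the same Riemann sum of [phi], so they form
    a Cauchy sequence, and the estimate passes to the limit. *)
Lemma primitive_segment {V : completeNormedModType R} (phi : R -> V) (a b : R) :
  a <= b -> continuous phi ->
  exists F : R -> V, forall e, 0 < e -> exists2 d, 0 < d & cell_estimate F phi a b d e.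
Proof.
move=> ab cphi; pose Fn := step_primitive phi a b.
have near_est e : 0 < e -> exists2 d, 0 < d &
    exists N : nat, forall n, (N <= n)%N -> cell_estimate (Fn n) phi a b d e.
  move=> e0; have [d d0 hd] := unif_cont_segment a b cphi e0.
  have d2 : 0 < d / 2 by rewrite divr_gt0.
  exists (d / 2) => //; exists (Num.truncn ((b - a) / (d / 2))) => n Nn s r t as_ sr rt tb ts.
  apply: step_primitive_estimate => // [|x ax xb sx xt].
    exact: le_trans rt.
  rewrite distrC ltW // hd //; [exact: le_trans sr|exact: le_trans tb|].
  have hn : (b - a) / n.+1%:R < d / 2.
    rewrite ltr_pdivrMr ?ltr0n // mulrC -ltr_pdivrMr //.
    by rewrite (lt_le_trans (truncnS_gt _)) // ler_nat ltnS.
  move: hn sx; set h := _ / _ => hn sx.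
  by rewrite ltr_norml; apply/andP; split; lra.
have cvgF t : a <= t -> t <= b -> cvgn (fun n => Fn n t).
  move=> at_ tb; apply: cauchy_seq_cvg => e e0.
  have c0 : 0 < 2 * (b - a + 1) by rewrite mulr_gt0 // ltr_wpDl // subr_ge0.
  have [d d0 [N hN]] := near_est _ (divr_gt0 e0 c0); exists N => n Nn.
  have [k [p [p0 pk h]]] := fine_partition at_ d0.
  have est m : (N <= m)%N -> `|\sum_(i < k) (p i.+1 - p i) *: phi (p i) - Fn m t| <= e / 2.
    move=> Nm; have -> : Fn m t = Fn m t - Fn m a by rewrite /Fn step_primitive_start ?subr0.
    have /cell_estimate_sum/(_ p0 pk h) : cell_estimate (Fn m) phi a t d (e / (2 * (b - a + 1))).
      by move=> s r u as_ sr ru ut us; apply: hN => //; exact: le_trans tb.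
    move=> /le_trans; apply; rewrite invfM [e * _]mulrA -mulrA ler_piMr //.
      by rewrite divr_ge0 // ltW.
    by rewrite mulrC ler_pdivrMr ?mul1r ?ltr_wpDl ?subr_ge0 //; lra.
  rewrite distrC (subr_mid (\sum_(i < k) (p i.+1 - p i) *: phi (p i))).
  by rewrite (le_trans (ler_normB _ _)) // [leRHS]splitr lerD // est.
exists (fun t => limn (fun n => Fn n t)) => e e0.
have [d d0 [N hN]] := near_est _ e0; exists d => // s r t as_ sr rt tb ts.
have ct : cvgn (fun n => Fn n t) by apply: cvgF => //; lra.
have cs : cvgn (fun n => Fn n s) by apply: cvgF => //; lra.
apply: (@limn_norm_le _ _ (fun n => Fn n t - Fn n s - (t - s) *: phi r) _ _ N).
  exact: (cvgB (cvgB ct cs) (cvg_cst _)).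
by move=> n Nn; exact: hN.
Qed.

Lemma RSintP {V : normedModType R} (phi : R -> V) w (a b : R) (I : V) :
  is_RSint phi w a b I -> is_RSint phi w a b (RSint phi w a b).
Proof. by move=> h; exact: (xgetPex (0 : V) (ex_intro [set J | is_RSint phi w a b J] I h)). Qed.

Lemma RSint_eq {V : normedModType R} {phi : R -> V} {w} {a b : R} {I : V} :
  a <= b -> is_RSint phi w a b I -> RSint phi w a b = I.
Proof. by move=> ab h; apply: (is_RSint_unique ab _ h); exact: RSintP h. Qed.

(** The oriented integral from 0; the case split is there because [RSint] is meaningful only for
    ordered endpoints. *)
Definition prim {V : normedModType R} (phi : R -> V) (t : R) : V :=
  if 0 <= t then RSint phi id 0 t else - RSint phi id t 0.

Lemma prim0 {V : normedModType R} (phi : R -> V) : prim phi 0 = 0.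
Proof. by rewrite /prim lexx (RSint_eq _ (is_RSint_refl _ _ _)). Qed.

Lemma primP {V : completeNormedModType R} {phi : R -> V} {a b : R} :
  continuous phi -> a <= b -> is_RSint phi id a b (prim phi b - prim phi a).
Proof.
(* The segment is enlarged to contain 0, the base point of [prim]. *)
move=> cphi ab; pose a' := Num.min a 0; pose b' := Num.max b 0.
have a'0 : a' <= 0 by rewrite ge_min lexx orbT.
have a'a : a' <= a by rewrite ge_min lexx.
have b'0 : 0 <= b' by rewrite le_max lexx orbT.
have bb' : b <= b' by rewrite le_max lexx.
have [F hF] := primitive_segment (le_trans a'0 b'0) cphi.
have FI s t : a' <= s -> s <= t -> t <= b' -> is_RSint phi id s t (F t - F s).
  move=> as_ st tb; apply: cell_estimate_RSint => // e /hF[d d0 hd].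
  exists d => // s1 r t1 h1 h2 h3 h4 h5.
  by apply: hd => //; [exact: le_trans h1|exact: le_trans tb].
have FE t : a' <= t -> t <= b' -> prim phi t = F t - F 0.
  move=> at_ tb; rewrite /prim; have [t0|t0] := leP 0 t.
    by apply: RSint_eq => //; apply: FI.
  by rewrite (RSint_eq (ltW t0) (FI _ _ _ _ _)) ?opprB // ltW.
rewrite !FE //; [|exact: le_trans bb'|exact: le_trans ab].
by rewrite opprB subrKA; apply: FI.
Qed.

Lemma is_RSint_cst {V : normedModType R} (v : V) (w : R -> R) (a b : R) :
  is_RSint (fun=> v) w a b ((w b - w a) *: v).
Proof.
move=> e e0; exists 1 => // n p tag p0 pn _.
rewrite -scaler_suml -(big_mkord xpredT (fun i => w (p i.+1) - w (p i))).
by rewrite telescope_sumr // p0 pn subrr normr0.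
Qed.

Lemma is_RSint_near_cst {V : normedModType R} {phi : R -> V} {a b : R} {I v : V} {e : R} :
  a <= b -> is_RSint phi id a b I -> (forall s, a <= s -> s <= b -> `|phi s - v| <= e) ->
  `|I - (b - a) *: v| <= (b - a) * e.
Proof.
move=> ab hI h; apply: (le_norm_is_RSint ab h).
  by apply: is_RSintB => //; exact: (is_RSint_cst v id).
exact: (@is_RSint_cst R^o e id a b).
Qed.

Lemma is_RSint_bound {V : normedModType R} {phi : R -> V} {a b : R} {I : V} {e : R} :
  a <= b -> is_RSint phi id a b I -> (forall s, a <= s -> s <= b -> `|phi s| <= e) ->
  `|I| <= (b - a) * e.
Proof.
move=> ab hI h; rewrite -[I]subr0 -(scaler0 _ (b - a)).
apply: (is_RSint_near_cst ab hI) => s as_ sb. by rewrite subr0 h.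
Qed.

Lemma prim_continuous {V : completeNormedModType R} (phi : R -> V) :
  continuous phi -> continuous (prim phi).
Proof.
move=> cphi x; apply/continuous_epsdelta => e e0.
have [M M0 hM] := bounded_segment (x - 1) (x + 1) cphi.
exists (Num.min 1 (e / M)); first by rewrite lt_min ltr01 divr_gt0.
move=> y; rewrite lt_min => /andP[xy1 xye].
have le_est s t : x - 1 <= s -> s <= t -> t <= x + 1 -> `|prim phi t - prim phi s| <= (t - s) * M.
  move=> h1 st h2; apply: (is_RSint_bound st (primP cphi st)) => u su ut.
  by apply: hM; lra.
move: xy1; rewrite ltr_norml => /andP[xy1 xy2].
rewrite ltr_pdivlMr // in xye; apply: le_lt_trans xye.
have [xy|yx] := leP x y.
  rewrite distrC [`|x - y|]distrC; apply: le_trans (le_est x y _ xy _) _; [lra|lra|].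
  by rewrite ler_wpM2r ?ler_norm // ltW.
apply: le_trans (le_est y x _ (ltW yx) _) _; [lra|lra|].
by rewrite ler_wpM2r ?ler_norm // ltW.
Qed.

(** The mean value theorem and the uniform continuity of [f] give the cell estimate; this argument
    is confined to real values. *)
Lemma derivative_RSint (F f : R -> R) (a b : R) : a <= b ->
  (forall x : R, is_derive x 1 F (f x)) -> continuous f ->
  is_RSint (f : R -> R^o) id a b (F b - F a).
Proof.
move=> ab dF cf; apply: cell_estimate_RSint => // e e0.
have [d d0 hd] := unif_cont_segment a b (V := R^o) cf e0.
exists d => // s r t as_ sr rt tb ts.
have [st|st] := ltP s t; last first.
  have -> : s = t by apply/le_anti; rewrite st (le_trans sr).
  by rewrite !subrr scale0r subrr normr0 mulr0.
have [|c cst ->] := MVT st (fun x _ => dF x).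
  by apply: continuous_subspaceT => x; apply: differentiable_continuous; apply/derivable1_diffP; case: (dF x).
move: cst; rewrite in_itv /= => /andP[sc ct].
have ts0 : 0 <= t - s by rewrite subr_ge0 ltW.
rewrite [_ *: _]mulrC -mulrBl normrM [X in _ * X]ger0_norm //.
rewrite ler_wpM2r // ltW //.
by apply: hd; rewrite ?ltr_norml; try (apply/andP; split); lra.
Qed.

Lemma expR_RSint (c a b : R) : a <= b -> c != 0 ->
  is_RSint (fun s => expR (c * s) : R^o) id a b ((expR (c * b) - expR (c * a)) / c).
Proof.
move=> ab c0; rewrite mulrBl.
apply: (@derivative_RSint (fun s => expR (c * s) / c) (fun s => expR (c * s)) a b ab) => x.
  have h : is_derive x (1 : R) (fun s : R => c * s) c.
    by apply: is_derive_eq; rewrite /GRing.scale /=; ring.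
  have h2 : is_derive x (1 : R) (fun s : R => expR (c * s)) (expR (c * x) * c).
    exact: (is_derive1_comp (is_derive_expR (c * x)) h).
  rewrite (_ : (fun s => _) = c^-1 \*: (fun s => expR (c * s))); last first.
    by apply/funext => s; rewrite mulrC.
  by apply: is_derive_eq; rewrite /GRing.scale /= mulrCA mulVf // mulr1.
apply: continuous_comp; last exact: continuous_expR.
by apply: continuousM; [exact: cvg_cst|exact: cvg_id].
Qed.

(** The integrator [w] is merely continuous; all regularity sits in [phi]. Each cell is split at its
    tag, [w] being frozen at [p i] on the left piece and at [p i.+1] on the right one. The error is
    the oscillation of [w] over a cell times a bound [M] of [dphi]. *)
Lemma is_RSint_by_parts {V : completeNormedModType R} (w : R -> R) (phi dphi : R -> V)
    (a b : R) : a <= b -> continuous w -> continuous dphi ->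
  (forall s t, a <= s -> s <= t -> t <= b -> is_RSint dphi id s t (phi t - phi s)) ->
  is_RSint phi w a b (w b *: phi b - w a *: phi a -
    (prim (fun s => w s *: dphi s) b - prim (fun s => w s *: dphi s) a)).
Proof.
move=> ab cw cd hphi e e0; set Psi := prim _.
have cwd : continuous (fun s => w s *: dphi s).
  by move=> x; apply: cvgZ; [exact: cw|exact: cd].
have [M M0 hM] := bounded_segment a b cd.
have c0 : 0 < b - a + 1 by rewrite ltr_wpDl // subr_ge0.
set e1 := e / (b - a + 1) / M.
have e10 : 0 < e1 by rewrite !divr_gt0.
have [d d0 hd] := unif_cont_segment a b (V := R^o) cw e10.
exists d => // n p tag p0 pn h.
have est v s t x : a <= s -> s <= t -> t <= b -> x = w v ->
    (forall u, s <= u -> u <= t -> `|w u - w v| <= e1) ->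
    `|Psi t - Psi s - x *: (phi t - phi s)| <= (t - s) * (e1 * M).
  move=> as_ st tb -> hv.
  apply: (is_RSint_bound st (is_RSintB (primP cwd st) (is_RSintZ (w v) (hphi s t as_ st tb)))).
  move=> u su ut; rewrite -scalerBl normrZ ler_pM // ?hv // hM //.
    exact: le_trans su.
  exact: le_trans tb.
rewrite -p0 -pn.
rewrite -[in X in _ - X](telescope_sumr (fun i => w (p i) *: phi (p i))) //.
rewrite -[in X in _ - X](telescope_sumr (fun i => Psi (p i))) //.
rewrite !big_mkord -!sumrB (le_lt_trans (ler_norm_sum _ _ _)) //.
apply: (@le_lt_trans _ _ (\sum_(i < n) (p i.+1 - p i) * (e1 * M))).
  apply: ler_sum => i _.
  have [h1 h2 h3 h4 h5] := partition_bounds p0 pn h (ltn_ord i).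
  have -> : (p i.+1 - p i) * (e1 * M) =
      (tag i - p i) * (e1 * M) + (p i.+1 - tag i) * (e1 * M) by ring.
  have -> : (w (p i.+1) - w (p i)) *: phi (tag i) -
      (w (p i.+1) *: phi (p i.+1) - w (p i) *: phi (p i) - (Psi (p i.+1) - Psi (p i))) =
      (Psi (tag i) - Psi (p i) - w (p i) *: (phi (tag i) - phi (p i))) +
      (Psi (p i.+1) - Psi (tag i) - w (p i.+1) *: (phi (p i.+1) - phi (tag i))).
    lmod R V.
  rewrite (le_trans (ler_normD _ _)) // lerD //.
    apply: (est (p i)) => //; first exact: le_trans h4.
    move=> u pu ut; rewrite distrC ltW // hd //.
      by rewrite (le_trans h2) // (le_trans h3).
    by rewrite ltr_norml; apply/andP; split; lra.
  apply: (est (p i.+1)) => //; first exact: le_trans h2.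
  move=> u pu ut; rewrite distrC ltW // hd //.
    by rewrite (le_trans h1) // (le_trans h2).
  by rewrite ltr_norml; apply/andP; split; lra.
rewrite -mulr_suml (partition_width p0 pn) /e1 divfK ?gt_eqF //.
by rewrite mulrA ltr_pdivrMr // mulrC ltr_pM2l // ltrDl.
Qed.

(** On a short cell the increment of [W] is the length times [om] at the tag, up to the modulus of
    continuity of [om]. This turns integrals against Phi^mu into Riemann integrals with density
    z^mu. *)
Lemma is_RSint_density {V : normedModType R} (W om : R -> R) (phi : R -> V)
    (a b : R) (I : V) : a <= b -> continuous om -> continuous phi ->
  (forall s t, a <= s -> s <= t -> t <= b ->
     is_RSint (om : R -> R^o) id s t (W t - W s)) ->
  is_RSint phi W a b I -> is_RSint (fun s => om s *: phi s) id a b I.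
Proof.
move=> ab com cphi hW hI e e0; have e2 : 0 < e / 2 by rewrite divr_gt0.
have [M M0 hM] := bounded_segment a b cphi.
have c0 : 0 < b - a + 1 by rewrite ltr_wpDl // subr_ge0.
set e1 := e / 2 / (b - a + 1) / M.
have e10 : 0 < e1 by rewrite !divr_gt0.
have [d d0 hd] := unif_cont_segment a b (V := R^o) com e10.
have [d' d'0 {}hI] := hI _ e2; exists (Num.min d d'); first by rewrite lt_min d0.
move=> n p tag p0 pn h.
have {}hI := hI n p tag p0 pn _.
set S := \sum_(_ < _) _ in hI.
set S' := \sum_(_ < _) _.
have -> : S' - I = (S' - S) + (S - I) by rewrite addrA subrK.
rewrite (le_lt_trans (ler_normD _ _)) // [ltRHS]splitr ler_ltD //; last first.
  by apply: hI => i /h[? ?]; rewrite lt_min => /andP[].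
rewrite -sumrB (le_trans (ler_norm_sum _ _ _)) //.
apply: (@le_trans _ _ (\sum_(i < n) (p i.+1 - p i) * (e1 * M))).
  apply: ler_sum => i _.
  have [h1 h2 h3 h4] := partition_bounds p0 pn h (ltn_ord i).
  rewrite lt_min => /andP[h5 _].
  rewrite scalerA -scalerBl normrZ mulrA ler_pM //; last first.
    by apply: hM; [exact: le_trans h2|exact: le_trans h4].
  have pp : p i <= p i.+1 by exact: le_trans h3.
  rewrite distrC -[_ * om _]/(_ *: (om (tag i) : R^o)).
  apply: (is_RSint_near_cst (V := R^o) pp (hW _ _ h1 pp h4)) => s ps sp.
  rewrite ltW // hd //; [exact: le_trans ps|exact: le_trans h4|].
  by rewrite ltr_norml; apply/andP; split; lra.
rewrite -mulr_suml (partition_width p0 pn) /e1 divfK ?gt_eqF //.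
rewrite mulrA ler_pdivrMr // mulrC ler_wpM2l ?lerDl // ltW //.
Qed.

End Primitive.

(** * Convolutions with a contraction semigroup *)

Lemma dist_max {R : realDomainType} (c x y : R) :
  `|Num.max x c - Num.max y c| <= `|x - y|.
Proof.
have := ler_norm (x - y); have := ler_norm (y - x); rewrite distrC => h1 h2.
rewrite ler_norml; case: (leP x c); case: (leP y c) => *; apply/andP; split; lra.
Qed.

(** The base point [p] precedes both truncated times and is close to each, which is what
    [mild_continuous] needs. *)
Lemma max_window {R : realDomainType} (a b t0 s : R) :
  let p := Num.max a (t0 - b) in 0 < b -> `|t0 - s| < b ->
  [/\ p <= Num.max a t0, p <= Num.max a s, Num.max a t0 - p <= b
    & Num.max a s - p <= 2 * b].
Proof.
move=> p b0; rewrite /p ltr_norml => /andP[? ?].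
by split; case: (leP a t0); case: (leP a s); case: (leP a (t0 - b)) => *; lra.
Qed.

Section Convolution.
Context {R : realType} {V : completeNormedModType R} (S : R -> V -> V) (eps gam : R).
Hypotheses (hS : C0_semigroup S) (eps0 : 0 < eps) (gam0 : 0 <= gam).
Hypothesis Sdecay : forall t x, 0 <= t -> `|S t x| <= expR (- gam * t) * `|x|.
Implicit Types (F G x : R -> V).

Lemma semigroupP t (k : R) u v : 0 <= t -> S t (k *: u + v) = k *: S t u + S t v.
Proof. by move=> t0; have [/(_ t t0)[l _] _ _ _] := hS; exact: l. Qed.

Lemma semigroupD t u v : 0 <= t -> S t (u + v) = S t u + S t v.
Proof. by move=> t0; rewrite -[u]scale1r semigroupP // !scale1r. Qed.

Lemma semigroup_contract t u : 0 <= t -> `|S t u| <= `|u|.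
Proof.
move=> t0; rewrite (le_trans (Sdecay _ t0)) // ler_piMl //.
by rewrite -expR0 ler_expR mulNr oppr_le0 mulr_ge0.
Qed.

Lemma semigroup0 t : 0 <= t -> S t 0 = 0.
Proof.
move=> t0; apply/normr0_eq0/le_anti; rewrite normr_ge0 andbT.
by rewrite -[leRHS](@normr0 R V) semigroup_contract.
Qed.

Lemma semigroupB t u v : 0 <= t -> S t (u - v) = S t u - S t v.
Proof.
move=> t0; rewrite addrC -[- v]scaleN1r semigroupP // scaleN1r addrC //.
Qed.

Lemma semigroupZ t (k : R) u : 0 <= t -> S t (k *: u) = k *: S t u.
Proof. by move=> t0; rewrite -[k *: u]addr0 semigroupP // semigroup0 // addr0. Qed.

Lemma semigroup_compose s t u : 0 <= s -> 0 <= t -> S (s + t) u = S s (S t u).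
Proof. by move=> s0 t0; have [_ _ h _] := hS; exact: h. Qed.

Lemma semigroup_at0 u : S 0 u = u.
Proof. by have [_ h _ _] := hS. Qed.

Lemma semigroup_near0 u e : 0 < e ->
  exists2 d, 0 < d & forall h, 0 <= h -> h < d -> `|S h u - u| < e.
Proof.
move=> e0; have [_ _ _ /(_ u)/cvgrPdist_lt/(_ _ e0)] := hS.
case=> d /= d0 hd; exists d => // h; rewrite le_eqVlt => /predU1P[<- _|h0 hd'].
  by rewrite semigroup_at0 subrr normr0.
by rewrite distrC; apply: hd => //=; rewrite sub0r normrN gtr0_norm.
Qed.

Lemma semigroup_dist s t u : 0 <= s -> 0 <= t -> `|S t u - S s u| <= `|S `|t - s| u - u|.
Proof.
wlog st : s t / s <= t => [W|s0 t0].
  by have [st|/ltW ts] := leP s t; [exact: W|rewrite distrC [`|t - s|]distrC => *; exact: W].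
have ts0 : 0 <= t - s by rewrite subr_ge0.
have -> : S t u = S s (S (t - s) u) by rewrite -semigroup_compose // addrC subrK.
by rewrite (ger0_norm ts0) -semigroupB // semigroup_contract.
Qed.

(** Nothing is known of [S t] for [t < 0]. Freezing the semigroup at time 0 makes the convolution
    integrands continuous on the whole line, so that [prim] applies to them. *)
Definition semigroup_ext t u := S (Num.max t 0) u.

Lemma semigroup_ext_continuous (tau : R -> R) F :
  continuous tau -> continuous F -> continuous (fun r => semigroup_ext (tau r) (F r)).
Proof.
move=> ct cF r; apply/continuous_epsdelta => e e0.
have e2 : 0 < e / 2 by rewrite divr_gt0.
have [d d0 hd] := semigroup_near0 (F r) e2.
have /continuous_epsdelta/(_ _ d0)[d1 d10 hd1] := ct r.
have /continuous_epsdelta/(_ _ e2)[d2 d20 hd2] := cF r.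
exists (Num.min d1 d2); first by rewrite lt_min d10.
move=> y; rewrite lt_min => /andP[/hd1 h1 /hd2 h2].
have m0 t : 0 <= Num.max t 0 :> R by rewrite le_max lexx orbT.
rewrite /semigroup_ext (subr_mid (S (Num.max (tau y) 0) (F r))) -semigroupB //.
rewrite (le_lt_trans (ler_normB _ _)) // [ltRHS]splitr ler_ltD //.
  by rewrite (le_trans (semigroup_contract _ _)) // ltW.
rewrite (le_lt_trans (semigroup_dist _ _ _)) // hd // (le_lt_trans _ h1) //.
by rewrite distrC dist_max.
Qed.

Definition convA F (a t : R) : V := RSint (fun r => S ((t - r) / eps) (F r)) id a t.

Let kernel F t r := semigroup_ext ((t - r) / eps) (F r).

Let kernelE F t r : r <= t -> kernel F t r = S ((t - r) / eps) (F r).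
Proof.
by move=> rt; rewrite /kernel /semigroup_ext (max_idPl _) // divr_ge0 ?subr_ge0 // ltW.
Qed.

Let kernel_continuous F t : continuous F -> continuous (kernel F t).
Proof.
move=> cF; apply: semigroup_ext_continuous => // r.
by apply: cvgM; [apply: cvgB; [exact: cvg_cst|exact: cvg_id]|exact: cvg_cst].
Qed.

(** The time [t] of the kernel and the upper limit [s] are kept apart for the sake of
    [convA_chasles]. *)
Lemma convA_is F a s t : continuous F -> a <= s -> s <= t ->
  is_RSint (fun r => S ((t - r) / eps) (F r)) id a s
    (prim (kernel F t) s - prim (kernel F t) a).
Proof.
move=> cF as_ st; apply: (eq_is_RSint (phi := kernel F t)) => [r ar rs|].
  by rewrite kernelE // (le_trans rs).
by apply: primP => //; exact: kernel_continuous.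
Qed.

Lemma convAP F a t : continuous F -> a <= t ->
  is_RSint (fun r => S ((t - r) / eps) (F r)) id a t (convA F a t).
Proof. by move=> cF at_; apply: RSintP; exact: convA_is. Qed.

Lemma convA_refl F a : convA F a a = 0.
Proof. by rewrite /convA (RSint_eq _ (is_RSint_refl _ _ _)). Qed.

Lemma convA_chasles F a s t : continuous F -> a <= s -> s <= t ->
  convA F a t = S ((t - s) / eps) (convA F a s) + convA F s t.
Proof.
move=> cF as_ st; have ts0 : 0 <= (t - s) / eps by rewrite divr_ge0 ?subr_ge0 // ltW.
have at_ := le_trans as_ st.
rewrite [convA F a t](RSint_eq at_ (convA_is cF at_ (lexx t))).
rewrite [convA F s t](RSint_eq st (convA_is cF st (lexx t))).
have -> : S ((t - s) / eps) (convA F a s) = prim (kernel F t) s - prim (kernel F t) a.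
  apply: (is_RSint_unique as_ _ (convA_is cF as_ st)).
  apply: (eq_is_RSint (phi := fun r => S ((t - s) / eps) (S ((s - r) / eps) (F r)))).
    move=> r ar rs; rewrite -semigroup_compose ?divr_ge0 ?subr_ge0 // 1?ltW //.
    by rewrite -mulrDl addrA subrK.
  apply: (is_RSint_lin (C := 1)) (convAP cF as_) => [k u v|u].
    exact: semigroupP.
  by rewrite mul1r semigroup_contract.
by rewrite [RHS]addrC subrKA.
Qed.

Lemma convA_bound F a t m : continuous F -> a <= t ->
  (forall r, a <= r -> r <= t -> `|F r| <= m) -> `|convA F a t| <= (t - a) * m.
Proof.
move=> cF at_ h; apply: (is_RSint_bound at_ (convAP cF at_)) => r ar rt.
by rewrite (le_trans (semigroup_contract _ _)) ?h // divr_ge0 ?subr_ge0 // ltW.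
Qed.

Lemma convA_lin F G (k : R) a t : continuous F -> continuous G -> a <= t ->
  convA (fun r => k *: F r + G r) a t = k *: convA F a t + convA G a t.
Proof.
move=> cF cG at_; apply: RSint_eq => //.
apply: (eq_is_RSint (phi := fun r => k *: S ((t - r) / eps) (F r) + S ((t - r) / eps) (G r))).
  by move=> r ar rt; rewrite semigroupP // divr_ge0 ?subr_ge0 // ltW.
by apply: is_RSintD; [apply: is_RSintZ|]; exact: convAP.
Qed.

Lemma convAZ F (k : R) a t : continuous F -> a <= t ->
  convA (fun r => k *: F r) a t = k *: convA F a t.
Proof.
move=> cF at_; apply: RSint_eq => //.
apply: (eq_is_RSint (phi := fun r => k *: S ((t - r) / eps) (F r))).
  by move=> r ar rt; rewrite semigroupZ // divr_ge0 ?subr_ge0 // ltW.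
by apply: is_RSintZ; exact: convAP.
Qed.

Lemma convAB F G a t : continuous F -> continuous G -> a <= t ->
  convA (fun r => F r - G r) a t = convA F a t - convA G a t.
Proof.
move=> cF cG at_; rewrite -[- convA G a t]scaleN1r addrC -convA_lin //.
by congr (convA _ a t); apply/funext => r; rewrite scaleN1r addrC.
Qed.

(** The kernel decays in [t - r] at rate [gam / eps] while [F] is measured against
    [expR (- lam * r)], so the integral costs the inverse of the gap. The bound is free of [a],
    which can therefore go to -oo, and [lam] may be negative, as in [forward_estimate]. *)
Lemma convA_expbound F lam C a t : lam < gam / eps -> continuous F -> a <= t ->
  (forall r, a <= r -> r <= t -> `|F r| <= C * expR (- lam * r)) ->
  `|convA F a t| <= C / (gam / eps - lam) * expR (- lam * t).
Proof.
move=> lg cF at_ h; set dl := gam / eps - lam.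
have dl0 : 0 < dl by rewrite subr_gt0.
have C0 : 0 <= C.
  by have := le_trans (normr_ge0 _) (h a (lexx a) at_); rewrite pmulr_lge0 ?expR_gt0.
pose c := C * expR (- (gam / eps) * t).
have h1 : is_RSint (fun r => c * expR (dl * r) : R^o) id a t
    (c * ((expR (dl * t) - expR (dl * a)) / dl)).
  by apply: (@is_RSintZ R R^o c); apply: expR_RSint => //; rewrite gt_eqF.
apply: le_trans (le_norm_is_RSint at_ _ (convAP cF at_) h1) _.
  move=> r ar rt; have q0 : 0 <= (t - r) / eps by rewrite divr_ge0 ?subr_ge0 // ltW.
  apply: le_trans (Sdecay _ q0) _; apply: le_trans (ler_wpM2l (expR_ge0 _) (h r ar rt)) _.
  rewrite /c mulrCA -!mulrA ler_wpM2l // -!expRD ler_expR /dl.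
  by rewrite le_eqVlt; apply/orP; left; apply/eqP; field; rewrite gt_eqF.
set X := expR (dl * t); set Y := expR (dl * a).
have -> : c * ((X - Y) / dl) = C / dl * (expR (- (gam / eps) * t) * (X - Y)).
  by rewrite /c; set k := dl^-1; ring.
have Cd0 : 0 <= C / dl by rewrite divr_ge0 // ltW.
rewrite ler_wpM2l // mulrBr /X -expRD.
rewrite (_ : - (gam / eps) * t + dl * t = - lam * t); last by rewrite /dl; ring.
by rewrite gerBl mulr_ge0 ?expR_ge0.
Qed.

(** Left continuity is the difficulty: the semigroup cannot be inverted and is only known to be
    continuous at [0^'+]. Both [x] at the limit time and [x] at the nearby time are compared with
    the orbit of [x p], for a base point [p] slightly earlier than both. *)
Lemma mild_continuous F x a : continuous F ->
  (forall s t, a <= s -> s <= t -> x t = S ((t - s) / eps) (x s) + convA F s t) ->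
  continuous (fun t => x (Num.max a t)).
Proof.
move=> cF hx t0; apply/continuous_epsdelta => e e0; set T0 := Num.max a t0.
have [M M0 hM] := bounded_segment (T0 - 1) (T0 + 1) cF.
(* Each of the two convolutions runs over a window of length at most [2 * b] with integrand at most
   [M], hence costs at most [e / 4]. *)
pose b := Num.min 1 (e / (8 * M)).
have b0 : 0 < b by rewrite lt_min ltr01 divr_gt0 // mulr_gt0.
have b1 : b <= 1 by rewrite ge_min lexx.
have bM : b * (8 * M) <= e by rewrite -ler_pdivlMr ?mulr_gt0 // ge_min lexx orbT.
pose p := Num.max a (t0 - b).
have e2 : 0 < e / 2 by rewrite divr_gt0.
have [d d0 hd] := semigroup_near0 (x p) e2.
have ap : a <= p by rewrite le_max lexx.
have near_p s : p <= s -> s <= T0 + 1 -> s - p <= 2 * b -> T0 - p <= b ->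
    `|x s - S ((s - p) / eps) (x p)| <= e / 4.
  move=> ps sT sp Tp; rewrite (hx p s) // addrC addKr.
  apply: le_trans (convA_bound (m := M) cF ps _) _.
    by move=> r pr rs; apply: hM; lra.
  by have := ler_wpM2r (ltW M0) sp; lra.
exists (Num.min b (d * eps)); first by rewrite lt_min b0 mulr_gt0.
move=> s; rewrite lt_min => /andP[tsb tsd]; set S0 := Num.max a s.
have h5 : `|T0 - S0| <= `|t0 - s| by rewrite /T0 /S0 ![Num.max a _]maxC dist_max.
have := max_window a b0 tsb; rewrite /= -/p -/T0 -/S0 => -[h1 h2 h3 h4].
have h6 : S0 <= T0 + 1.
  by move: (le_lt_trans h5 tsb); rewrite distrC => /(le_lt_trans (ler_norm _)); lra.
have -> : x T0 - x S0 = (x T0 - S ((T0 - p) / eps) (x p)) - (x S0 - S ((S0 - p) / eps) (x p))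
    + (S ((T0 - p) / eps) (x p) - S ((S0 - p) / eps) (x p)) by lmod R V.
rewrite (le_lt_trans (ler_normD _ _)) // [ltRHS]splitr ler_ltD //.
  rewrite (le_trans (ler_normB _ _)) // (_ : e / 2 = e / 4 + e / 4); last by field.
  by rewrite lerD // near_p //; clear -h3 b0 h6; lra.
have q0 r : p <= r -> 0 <= (r - p) / eps.
  by move=> pr; rewrite divr_ge0 ?subr_ge0 // ltW.
rewrite (le_lt_trans (semigroup_dist _ (q0 _ h2) (q0 _ h1))) // hd // -mulrBl.
rewrite normrM [`|eps^-1|]gtr0_norm ?invr_gt0 // ltr_pdivrMr //.
by rewrite (le_lt_trans _ tsd) // opprB addrA subrK.
Qed.

Lemma convA_continuous F a : continuous F ->
  continuous (fun t => convA F a (Num.max a t)).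
Proof. by move=> cF; apply: mild_continuous (cF) _ => s t *; exact: convA_chasles. Qed.

Section Tail.
Variables (lam : R) (lamg : lam < gam / eps).

Definition tail_bounded F :=
  forall T, exists C, forall r, r <= T -> `|F r| <= C * expR (- lam * r).

(** The integral from -oo, taken along integers so that the Cauchy criterion for sequences applies;
    [convinf_cvg_noo] recovers the limit along real [a]. *)
Definition convinf F (t : R) : V := limn (fun n => convA F (- n%:R) t).

(** By [convA_chasles] the difference is [S ((t - a) / eps)] applied to the convolution over
    [[a', a]], and the product of the two bounds is a constant times [expR (dl * a)], whatever [a']
    is. *)
Lemma convA_tail F t e : continuous F -> tail_bounded F -> 0 < e ->
  exists2 A, A <= t & forall a' a, a' <= a -> a <= A ->
    `|convA F a' t - convA F a t| <= e.
Proof.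
move=> cF /(_ t)[C hC] e0; set dl := gam / eps - lam.
have dl0 : 0 < dl by rewrite subr_gt0.
have C0 : 0 <= C.
  by have := le_trans (normr_ge0 _) (hC t (lexx t)); rewrite pmulr_lge0 ?expR_gt0.
pose D := C / dl * expR (- gam * t / eps) + 1.
have D0 : 0 < D by rewrite ltr_wpDl // mulr_ge0 ?expR_ge0 // divr_ge0 // ltW.
(* The second argument solves [D * expR (dl * A) = e]. *)
exists (Num.min t (ln (e / D) / dl)); first by rewrite ge_min lexx.
move=> a' a a'a; rewrite le_min => /andP[at_].
rewrite ler_pdivlMr // -ler_expR lnK ?posrE ?divr_gt0 // ler_pdivlMr // => hD.
have q0 : 0 <= (t - a) / eps by rewrite divr_ge0 ?subr_ge0 // ltW.
rewrite (convA_chasles cF a'a at_) addrK (le_trans (Sdecay _ q0)) //.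
apply: le_trans (ler_wpM2l (expR_ge0 _) (convA_expbound lamg cF a'a _)) _.
  by move=> r _ ra; apply: hC; exact: le_trans at_.
rewrite mulrCA -expRD -/dl; apply: le_trans hD.
rewrite (_ : _ + _ = - gam * t / eps + a * dl); last by rewrite /dl; field; rewrite gt_eqF.
by rewrite expRD mulrA mulrC ler_wpM2l ?expR_ge0 // lerDl.
Qed.

Let near_noo (A : R) : exists N : nat, forall n, (N <= n)%N -> - n%:R <= A.
Proof.
exists (Num.truncn (- A)).+1 => n Nn; rewrite lerNl ltW //.
by rewrite (lt_le_trans (truncnS_gt _)) // ler_nat.
Qed.

Lemma convinf_cvg F t : continuous F -> tail_bounded F ->
  (fun n => convA F (- n%:R) t) @ \oo --> convinf F t.
Proof.
move=> cF tF; apply: cauchy_seq_cvg => e e0.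
have [A At hA] := convA_tail t cF tF e0.
have [N hN] := near_noo A; exists N => n Nn.
by apply: hA; [rewrite lerN2 ler_nat|exact: hN].
Qed.

Lemma convinf_lim F t l : continuous F -> tail_bounded F ->
  (fun n => convA F (- n%:R) t) @ \oo --> l -> convinf F t = l.
Proof. by move=> cF tF; apply: cvg_lim; exact: norm_hausdorff. Qed.

Lemma convinf_cocycle F s t : continuous F -> tail_bounded F -> s <= t ->
  convinf F t = S ((t - s) / eps) (convinf F s) + convA F s t.
Proof.
move=> cF tF st; apply: convinf_lim => //.
have q0 : 0 <= (t - s) / eps by rewrite divr_ge0 ?subr_ge0 // ltW.
have [N hN] := near_noo s.
apply: (@cvg_trans _ ((fun n => S ((t - s) / eps) (convA F (- n%:R) s) + convA F s t) @ \oo)).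
  by apply: near_eq_cvg; exists N => // n /hN ns; rewrite -convA_chasles.
apply: cvgD; last exact: cvg_cst.
have [/(_ _ q0)[_ cS] _ _ _] := hS.
by apply: continuous_cvg; [exact: cS|exact: convinf_cvg].
Qed.

Lemma convinf_bound F t C : continuous F -> tail_bounded F ->
  (forall r, r <= t -> `|F r| <= C * expR (- lam * r)) ->
  `|convinf F t| <= C / (gam / eps - lam) * expR (- lam * t).
Proof.
move=> cF tF h; have [N hN] := near_noo t.
apply: (limn_norm_le (N := N) (convinf_cvg cF tF)) => n /hN nt.
by apply: convA_expbound => // r _ rt; exact: h.
Qed.

Lemma tail_boundedD F G : tail_bounded F -> tail_bounded G ->
  tail_bounded (fun r => F r + G r).
Proof.
move=> tF tG T; have [C hC] := tF T; have [D hD] := tG T; exists (C + D) => r rT.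
by rewrite (le_trans (ler_normD _ _)) // mulrDl lerD ?hC ?hD.
Qed.

Lemma tail_boundedZ k F : tail_bounded F -> tail_bounded (fun r => k *: F r).
Proof.
move=> tF T; have [C hC] := tF T; exists (`|k| * C) => r rT.
by rewrite normrZ -mulrA ler_wpM2l // hC.
Qed.

Lemma convinfB F G t : continuous F -> tail_bounded F -> continuous G -> tail_bounded G ->
  convinf F t - convinf G t = convinf (fun r => F r - G r) t.
Proof.
move=> cF tF cG tG; apply/esym/convinf_lim.
- by move=> r; apply: cvgB; [exact: cF|exact: cG].
- have := tail_boundedD tF (tail_boundedZ (-1) tG).
  by congr tail_bounded; apply/funext => r; rewrite scaleN1r.
have [N hN] := near_noo t.
apply: (@cvg_trans _ ((fun n => convA F (- n%:R) t - convA G (- n%:R) t) @ \oo)).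
  by apply: near_eq_cvg; exists N => // n /hN nt; rewrite -convAB.
by apply: cvgB; exact: convinf_cvg.
Qed.

Lemma convinf_cvg_noo F t : continuous F -> tail_bounded F ->
  convA F a t @[a --> -oo] --> convinf F t.
Proof.
move=> cF tF; apply/cvgrPdist_le => e e0.
have [A At hA] := convA_tail t cF tF e0.
exists A; split; first exact: num_real.
move=> a aA; have [N hN] := near_noo a.
apply: (limn_norm_le (N := N) (cvgB (convinf_cvg cF tF) (cvg_cst _))) => n /hN na.
by apply: hA => //; exact: ltW.
Qed.

Lemma convinf_continuous F : continuous F -> tail_bounded F -> continuous (convinf F).
Proof.
move=> cF tF t0.
(* The truncation at [t0 - 1] is invisible at distance less than 1 from [t0]. *)
have /(_ t0)/continuous_epsdelta h := mild_continuous (x := convinf F) (a := t0 - 1) cF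
  (fun s t _ => convinf_cocycle cF tF).
apply/continuous_epsdelta => e /h[d d0 {}h].
exists (Num.min 1 d); first by rewrite lt_min ltr01.
move=> y; rewrite lt_min => /andP[y1 yd]; have := h _ yd.
move: y1; rewrite ltr_norml => /andP[? ?].
by rewrite !(max_idPr _) //; lra.
Qed.

End Tail.

End Convolution.

(** * Groups and integrals from +oo *)

Section Group.
Context {R : realType} {V : completeNormedModType R} (S : R -> V -> V) (gam : R).
Hypotheses (hS : C0_group S).
Hypothesis Sdecay : forall t x, t <= 0 -> `|S t x| <= expR (- gam * t) * `|x|.

Lemma groupP t (k : R) u v : S t (k *: u + v) = k *: S t u + S t v.
Proof. by have [/(_ t)[l _] _ _ _] := hS; exact: l. Qed.

Lemma groupD t u v : S t (u + v) = S t u + S t v.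
Proof. by rewrite -[u]scale1r groupP !scale1r. Qed.

Lemma group0 t : S t 0 = 0.
Proof. by apply: (@addrI _ (S t 0)); rewrite -groupD !addr0. Qed.

Lemma groupZ t (k : R) u : S t (k *: u) = k *: S t u.
Proof. by rewrite -[k *: u]addr0 groupP group0 addr0. Qed.

Lemma groupB t u v : S t (u - v) = S t u - S t v.
Proof. by rewrite groupD -[- v]scaleN1r groupZ scaleN1r. Qed.

Lemma group_compose s t u : S s (S t u) = S (s + t) u.
Proof. by have [_ _ h _] := hS; rewrite h. Qed.

Lemma group_at0 u : S 0 u = u.
Proof. by have [_ h _ _] := hS. Qed.

Lemma group_orbit_continuous u : continuous (fun t => S t u).
Proof.
move=> t; have [/(_ t)[_ cS] _ _ /(_ u) S0] := hS.
have h : S t (S s u) @[s --> 0] --> S t u by apply: continuous_cvg; [exact: cS|exact: S0].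
apply/continuous_epsdelta => e e0.
move/cvgrPdist_lt : h => /(_ e e0)/nbhs_ballP[d /= d0 hd].
exists d => // y ty; have /= := hd (y - t).
rewrite group_compose (_ : t + (y - t) = y); last by ring.
apply.
by rewrite -ball_normE /= sub0r opprB.
Qed.

(** The decay assumption speaks of [t <= 0] only. A bound forward in time comes from
    Banach-Steinhaus: each orbit is continuous, hence bounded on the segment. *)
Lemma group_bounded T : exists2 M, 0 < M & forall t x, - T <= t -> t <= T -> `|S t x| <= M * `|x|.
Proof.
pose F : set (V -> V) := [set S t | t in `[- T, T]].
have [] // := @Banach_Steinhauss R V V F _ _ 1.
- move=> _ [t _ <-]; split; last by have [/(_ t)[l _] _ _ _] := hS; exact: l.
  have [/(_ t)[_ /(_ 0)/continuous_epsdelta/(_ _ ltr01)[d d0 hd]] _ _ _] := hS.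
  (* Scaling by [c^-1] brings the ball of radius [r] into the ball of radius [d], on which [S t] has
     norm less than 1. *)
  move=> r; pose c := 2 * (`|r| + 1) / d.
  have c0 : 0 < c by rewrite divr_gt0 // mulr_gt0 // ltr_wpDl.
  exists c => x xr; have := hd (c^-1 *: x).
  rewrite group0 !sub0r !normrN groupZ !normrZ gtr0_norm ?invr_gt0 //.
  rewrite -ltr_pdivlMl ?invr_gt0 // invrK -ltr_pdivlMl ?invr_gt0 // invrK mulr1.
  move=> h; apply/ltW/h; rewrite /c divfK ?gt_eqF //.
  have := ler_norm r; have := normr_ge0 r; lra.
- move=> x; have [M _ hM] := bounded_segment (- T) T (group_orbit_continuous (u := x)).
  by exists M => _ [t + <-]; rewrite /= in_itv /= => /andP[]; exact: hM.
move=> M hM; exists (Num.max M 1); first by rewrite lt_max ltr01 orbT.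
move=> t x Tt tT; have [->|x0] := eqVneq x 0; first by rewrite group0 normr0 mulr0.
have nx : 0 < `|x| by rewrite normr_gt0.
rewrite -ler_pdivrMr // mulrC -[`|x|^-1]ger0_norm ?invr_ge0 // -normrZ -groupZ.
rewrite le_max hM //; first by exists t => //=; rewrite in_itv /= Tt.
by rewrite normrZ ger0_norm ?invr_ge0 // mulVf // gt_eqF.
Qed.

Lemma group_continuous (tau : R -> R) (F : R -> V) :
  continuous tau -> continuous F -> continuous (fun r => S (tau r) (F r)).
Proof.
move=> ct cF r; apply/continuous_epsdelta => e e0.
have e2 : 0 < e / 2 by rewrite divr_gt0.
have [M M0 hM] := group_bounded (`|tau r| + 1).
have /continuous_epsdelta/(_ _ e2)[d d0 hd] := @group_orbit_continuous (F r) (tau r).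
have d1 : 0 < Num.min 1 d by rewrite lt_min ltr01.
have /continuous_epsdelta/(_ _ d1)[d' d'0 hd'] := ct r.
have /continuous_epsdelta/(_ _ (divr_gt0 e2 M0))[d2 d20 hd2] := cF r.
exists (Num.min d' d2); first by rewrite lt_min d'0.
move=> y; rewrite lt_min => /andP[/hd' h1 /hd2 h2].
move: h1; rewrite lt_min => /andP[h1 h3].
have -> : S (tau r) (F r) - S (tau y) (F y) =
    (S (tau r) (F r) - S (tau y) (F r)) + S (tau y) (F r - F y).
  by rewrite groupB addrA subrK.
rewrite (le_lt_trans (ler_normD _ _)) // [ltRHS]splitr ltr_leD ?hd //.
have ty : `|tau y| <= `|tau r| + 1.
  by have := ler_distD (tau r) 0 (tau y); rewrite !sub0r !normrN; lra.
move: ty; rewrite ler_norml => /andP[ty1 ty2].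
rewrite (le_trans (hM _ _ ty1 ty2)) // mulrC -ler_pdivlMr // ltW //.
Qed.

(** By the group law [S (t - s) (D s) = S t (pull D s)], so every integral against the group reduces
    to the single primitive [prim (pull D)]. *)
Definition pull (D : R -> V) s := S (- s) (D s).

Section Tail.
Variables (lam : R) (lamg : gam < lam).
Implicit Types D E : R -> V.

Definition decay_bounded D := exists C, forall r, `|D r| <= C * expR (- lam * r).

(* S t (tailB D t) is the integral of S (t - s) (D s) over s in [t, +oo[. *)
Definition tailB D (t : R) : V := limn (fun n => prim (pull D) n%:R) - prim (pull D) t.

Lemma pull_continuous D : continuous D -> continuous (pull D).
Proof. by move=> cD; apply: group_continuous => // r; apply: cvgN; exact: cvg_id. Qed.

Lemma pull_int D s t : continuous D -> forall u, s <= t ->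
  is_RSint (fun r => S (u - r) (D r)) id s t (S u (prim (pull D) t - prim (pull D) s)).
Proof.
move=> cD u st; have [M M0 hM] := group_bounded `|u|.
apply: (eq_is_RSint (phi := fun r => S u (pull D r))).
  by move=> r _ _; rewrite group_compose.
apply: (is_RSint_lin (C := M)) (primP (pull_continuous cD) st) => [k x y|x].
  exact: groupP.
by apply: hM; [rewrite lerNl -normrN ler_norm|exact: ler_norm].
Qed.

(** For [r >= u] the operator [S (u - r)] runs backwards, where [Sdecay] applies; what remains
    decays at rate [lam - gam]. The time [u] is free: [u = 0] serves convergence at +oo, and [u]
    equal to the current time serves the weighted estimates. *)
Lemma pull_bound D C u s t : continuous D -> u <= s -> s <= t ->
  (forall r, u <= r -> r <= t -> `|D r| <= C * expR (- lam * r)) ->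
  `|S u (prim (pull D) t - prim (pull D) s)| <=
    C / (lam - gam) * (expR (- gam * u) * expR (- (lam - gam) * s)).
Proof.
move=> cD us st hC; set dl := lam - gam.
have dl0 : 0 < dl by rewrite subr_gt0.
have C0 : 0 <= C.
  by have := le_trans (normr_ge0 _) (hC u (lexx u) (le_trans us st)); rewrite pmulr_lge0 ?expR_gt0.
pose c := C * expR (- gam * u).
have ndl0 : - dl != 0 by rewrite oppr_eq0 gt_eqF.
have h1 : is_RSint (fun r => c * expR (- dl * r) : R^o) id s t
    (c * ((expR (- dl * t) - expR (- dl * s)) / - dl)).
  by apply: (@is_RSintZ R R^o c); apply: expR_RSint.
apply: le_trans (le_norm_is_RSint st _ (pull_int cD u st) h1) _.
  move=> r sr rt; have q0 : u - r <= 0 by rewrite subr_le0 (le_trans us).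
  apply: le_trans (Sdecay _ q0) _.
  apply: le_trans (ler_wpM2l (expR_ge0 _) (hC r (le_trans us sr) rt)) _.
  rewrite /c mulrCA -!mulrA ler_wpM2l // -!expRD ler_expR /dl.
  by rewrite le_eqVlt; apply/orP; left; apply/eqP; ring.
rewrite /c invrN; set X := expR (- dl * t); set Y := expR (- dl * s).
have -> : C * expR (- gam * u) * ((X - Y) * - dl^-1) = C / dl * (expR (- gam * u) * (Y - X)).
  by set k := dl^-1; ring.
have Cd0 : 0 <= C / dl by rewrite divr_ge0 // ltW.
by rewrite ler_wpM2l // ler_wpM2l ?expR_ge0 // gerBl expR_ge0.
Qed.

(** Counterpart of [pull_bound] in the expanding direction: there is no decay to exploit, so the
    factor [1 / L] must come from the growing weight. *)
Lemma pull_bound_forward D C L M t : continuous D -> 0 <= t -> 0 < L ->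
  (forall s x, 0 <= s -> s <= t -> `|S s x| <= M * `|x|) -> 0 <= M ->
  (forall r, 0 <= r -> r <= t -> `|D r| <= C * expR (L * r)) ->
  `|S t (prim (pull D) t)| <= M * C / L * expR (L * t).
Proof.
move=> cD t0 L0 hM M0 hC.
have C0 : 0 <= C.
  by have := le_trans (normr_ge0 _) (hC 0 (lexx 0) t0); rewrite pmulr_lge0 ?expR_gt0.
have h1 : is_RSint (fun r => (M * C) * expR (L * r) : R^o) id 0 t
    (M * C * ((expR (L * t) - expR (L * 0)) / L)).
  by apply: (@is_RSintZ R R^o (M * C)); apply: expR_RSint => //; rewrite gt_eqF.
rewrite -[prim _ _]subr0 -[X in _ - X](prim0 (pull D)).
apply: le_trans (le_norm_is_RSint t0 _ (pull_int cD t t0) h1) _.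
  move=> r r0 rt; rewrite -mulrA; apply: le_trans (hM _ _ _ _) _; [|lra|].
    by rewrite subr_ge0.
  by rewrite ler_wpM2l // hC.
rewrite mulrA mulrAC ler_wpM2l //; first by rewrite divr_ge0 ?mulr_ge0 // ltW.
by rewrite gerBl expR_ge0.
Qed.

Lemma pull_cvg D : continuous D -> decay_bounded D ->
  cvgn (fun n => prim (pull D) n%:R).
Proof.
move=> cD [C hC]; apply: cauchy_seq_cvg => e e0; set dl := lam - gam.
have dl0 : 0 < dl by rewrite subr_gt0.
have C0 : 0 <= C.
  by have := le_trans (normr_ge0 _) (hC 0); rewrite pmulr_lge0 ?expR_gt0.
pose K := C / dl + 1.
have K0 : 0 < K by rewrite ltr_wpDl // divr_ge0 // ltW.
exists (Num.truncn (ln (K / e) / dl)).+1 => n Nn; set N := _.+1 in Nn *.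
have NR : ln (K / e) / dl <= N%:R by rewrite ltW // truncnS_gt.
have nN : (N%:R : R) <= n%:R by rewrite ler_nat.
rewrite -[X in `|X|]group_at0; apply: le_trans (pull_bound (C := C) cD _ nN _) _ => //.
rewrite mulr0 expR0 mul1r -/dl.
move: NR; rewrite ler_pdivrMr // -ler_expR lnK ?posrE ?divr_gt0 // ler_pdivrMr // => NR.
rewrite mulNr expRN ler_pdivrMr ?expR_gt0 // [leRHS]mulrC [dl * _]mulrC.
by rewrite (le_trans _ NR) // lerDl.
Qed.

Lemma tailB_bound D C t : continuous D -> decay_bounded D ->
  (forall r, t <= r -> `|D r| <= C * expR (- lam * r)) ->
  `|S t (tailB D t)| <= C / (lam - gam) * expR (- lam * t).
Proof.
move=> cD dD hC; have h := pull_cvg cD dD.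
have [_ cS] : linear (S t) /\ continuous (S t) by have [/(_ t)] := hS.
have hl : (fun n => S t (prim (pull D) n%:R - prim (pull D) t)) @ \oo --> S t (tailB D t).
  by apply: continuous_cvg; [exact: cS|exact: cvgB h (cvg_cst _)].
apply: (limn_norm_le (N := (Num.truncn `|t|).+1) hl) => n Nn.
have tn : t <= n%:R.
  rewrite (le_trans (ler_norm t)) // ltW // (lt_le_trans (truncnS_gt _)) //.
  by rewrite ler_nat.
apply: le_trans (pull_bound cD (lexx t) tn (fun r tr _ => hC r tr)) _.
by rewrite -expRD (_ : - gam * t + - (lam - gam) * t = - lam * t) //; ring.
Qed.

Lemma pullB D E t : continuous D -> continuous E ->
  prim (pull (fun r => D r - E r)) t = prim (pull D) t - prim (pull E) t.
Proof.
move=> cD cE; have cDE : continuous (fun r => D r - E r).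
  by move=> r; apply: cvgB; [exact: cD|exact: cE].
have e s u : s <= u -> prim (pull (fun r => D r - E r)) u - prim (pull (fun r => D r - E r)) s =
    (prim (pull D) u - prim (pull D) s) - (prim (pull E) u - prim (pull E) s).
  move=> su; apply: (is_RSint_unique su (primP (pull_continuous cDE) su)).
  apply: (eq_is_RSint (phi := fun r => pull D r - pull E r)).
    by move=> r _ _; rewrite /pull groupB.
  by apply: is_RSintB; apply: primP => //; exact: pull_continuous.
have [t0|t0] := leP 0 t; first by have := e _ _ t0; rewrite !prim0 !subr0.
by have /eqP := e _ _ (ltW t0); rewrite !prim0 !sub0r -opprD eqr_opp => /eqP.
Qed.

Lemma tailBB D E t : continuous D -> decay_bounded D -> continuous E -> decay_bounded E ->
  tailB D t - tailB E t = tailB (fun r => D r - E r) t.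
Proof.
move=> cD dD cE dE; rewrite /tailB pullB //.
have -> : (fun n : nat => prim (pull (fun r => D r - E r)) n%:R) =
    (fun n => prim (pull D) n%:R - prim (pull E) n%:R).
  by apply/funext => n; rewrite pullB.
rewrite (cvg_lim (@norm_hausdorff _ V) (cvgB (pull_cvg cD dD) (pull_cvg cE dE))).
lmod R V.
Qed.

Lemma tailB_continuous D : continuous D -> continuous (tailB D).
Proof.
move=> cD t; apply: cvgB; first exact: cvg_cst.
by apply: prim_continuous; exact: pull_continuous.
Qed.

Lemma tailB_diff D s t : tailB D s - tailB D t = prim (pull D) t - prim (pull D) s.
Proof. by rewrite /tailB; lmod R V. Qed.

End Tail.

End Group.

(** * Fixed points in weighted spaces *)

Section Contraction.
Context {R : realType}.

Lemma geometric_small (k d e : R) : 0 <= k -> k < 1 -> 0 < e ->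
  exists N, forall n, (N <= n)%N -> k ^+ n * d < e.
Proof.
move=> k0 k1 e0; have /cvgrPdist_lt/(_ _ e0)[N _ hN] : (fun n => d * k ^+ n) @ \oo --> (0 : R).
  by apply: cvg_geometric; rewrite ger0_norm.
exists N => n /hN /=; rewrite sub0r normrN mulrC.
exact: le_lt_trans (ler_norm _).
Qed.

(** Absorption of [k * sup om] into the left-hand side, without suprema: each use of the hypothesis
    shrinks the excess of the bound over [a / (1 - k)] by the factor [k]. *)
Lemma contraction_bound (T : Type) (J : set T) (om : T -> R) (a k : R) :
  0 <= k -> k < 1 -> (exists c, forall t, J t -> om t <= c) ->
  (forall c, (forall t, J t -> om t <= c) -> forall t, J t -> om t <= a + k * c) ->
  forall t, J t -> om t <= a / (1 - k).
Proof.
move=> k0 k1 [c hc] h.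
have k1' : 1 - k != 0 by rewrite subr_eq0 gt_eqF.
have hn n : forall t, J t -> om t <= a / (1 - k) + k ^+ n * (c - a / (1 - k)).
  elim: n => [|n IH] t Jt; first by rewrite expr0 mul1r addrC subrK hc.
  apply: le_trans (h _ IH t Jt) _; rewrite exprS.
  by rewrite le_eqVlt; apply/orP; left; apply/eqP; field.
move=> t Jt; apply/ler_addgt0Pr => e e0.
have [N hN] := geometric_small (c - a / (1 - k)) k0 k1 e0.
by rewrite (le_trans (hn N t Jt)) // lerD2l ltW // hN.
Qed.

End Contraction.

(** * A Picard fixed point in a family of weighted seminorms *)

Section Picard.
Context {R : realType} {H1 H2 : completeNormedModType R}.
Implicit Types z : R -> H1 * H2.

Lemma normH_ge0 (x : H1 * H2) : 0 <= normH x.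
Proof. by rewrite addr_ge0. Qed.

Lemma normHD (x y : H1 * H2) : normH (x + y) <= normH x + normH y.
Proof. by rewrite /normH addrACA lerD // ler_normD. Qed.

Lemma normHN (x : H1 * H2) : normH (- x) = normH x.
Proof. by rewrite /normH !normrN. Qed.

Lemma normHB (x y : H1 * H2) : normH (x - y) = normH (y - x).
Proof. by rewrite -normHN opprB. Qed.

Lemma le_norm_normH (x : H1 * H2) : `|x| <= normH x.
Proof. by rewrite prod_normE ge_max lerDl lerDr !normr_ge0. Qed.

Lemma normH_le_norm (x : H1 * H2) : normH x <= 2 * `|x|.
Proof. by rewrite prod_normE mulr_natl mulr2n lerD // le_max lexx ?orbT. Qed.

Variables (I : Type) (J : I -> set R) (wt : I -> R -> R) (k : I -> R).
Variables (T : (R -> H1 * H2) -> R -> H1 * H2) (z0 : R -> H1 * H2).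
Hypotheses (hJ : forall t : R, exists i, nbhs t (J i)).
Hypotheses (wt0 : forall i t, 0 < wt i t) (cwt : forall i, continuous (wt i)).
Hypotheses (k0 : forall i, 0 <= k i) (k1 : forall i, k i < 1).

(** The index set [I] serves two situations: the horizons [n : nat] with their own weights for the
    forward problem, and a single weight on the whole line for the Lyapunov-Perron map. Only the
    distance to [z0] has to be finite, not the size of [z] itself. *)
Definition picard_class z :=
  continuous z /\ forall i, exists c, forall t, J i t -> wt i t * normH (z t - z0 t) <= c.

Hypothesis cz0 : continuous z0.
Hypothesis cT : forall z, picard_class z -> continuous (T z).
Hypothesis kT : forall z z' i c, picard_class z -> picard_class z' ->
  (forall t, J i t -> wt i t * normH (z t - z' t) <= c) ->
  forall t, J i t -> wt i t * normH (T z t - T z' t) <= k i * c.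
Hypothesis bT : forall i, exists c, forall t, J i t -> wt i t * normH (T z0 t - z0 t) <= c.

Lemma picard : exists2 z, picard_class z & forall t, T z t = z t.
Proof.
pose zn n := iter n T z0.
have tri i t (a b c : H1 * H2) : wt i t * normH (a - c) <= wt i t * normH (a - b) + wt i t * normH (b - c).
  by rewrite -mulrDr ler_wpM2l ?(ltW (wt0 _ _)) //; have := normHD (a - b) (b - c); rewrite subrKA.
have z0C : picard_class z0.
  by split => // i; exists 0 => t _; rewrite subrr /normH !normr0 addr0 mulr0.
have bT' i : exists c, 0 <= c /\
    forall t, J i t -> wt i t * normH (T z0 t - z0 t) <= c.
  have [c hc] := bT i; exists (Num.max c 0); split; first by rewrite le_max lexx orbT.
  by move=> t Jt; rewrite (le_trans (hc t Jt)) // le_max lexx.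
pose c i := projT1 (cid (bT' i)).
have hc i : 0 <= c i /\ forall t, J i t -> wt i t * normH (T z0 t - z0 t) <= c i.
  exact: projT2 (cid (bT' i)).
(* The sum of the geometric series that majorizes the increments of the iterates;
   [C i - k i ^+ n * C i] is its n-th partial sum. *)
pose C i := c i / (1 - k i).
have C0 i : 0 <= C i by rewrite divr_ge0 ?(hc i).1 // subr_ge0 ltW.
have CE i : c i = C i - k i * C i.
  by rewrite /C; field; rewrite subr_eq0 gt_eqF.
have znC n : picard_class (zn n) /\
    forall i t, J i t -> wt i t * normH (zn n.+1 t - zn n t) <= k i ^+ n * c i.
  suff: [/\ picard_class (zn n),
    forall i t, J i t -> wt i t * normH (zn n.+1 t - zn n t) <= k i ^+ n * c i &
    forall i t, J i t -> wt i t * normH (zn n t - z0 t) <= C i - k i ^+ n * C i] by case.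
  elim: n => [|n [zC h1 h2]].
    split => // i t Jt; first by rewrite expr0 mul1r (hc i).2.
    by rewrite expr0 mul1r !subrr /normH !normr0 addr0 mulr0.
  have h3 i t : J i t -> wt i t * normH (zn n.+1 t - z0 t) <= C i - k i ^+ n.+1 * C i.
    move=> Jt; rewrite (le_trans (tri _ _ _ (zn n t) _)) //.
    apply: le_trans (lerD (h1 i t Jt) (h2 i t Jt)) _.
    by rewrite (CE i) exprS le_eqVlt; apply/orP; left; apply/eqP; ring.
  have zC' : picard_class (zn n.+1).
    split; first exact: cT.
    move=> i; exists (C i) => t Jt; rewrite (le_trans (h3 i t Jt)) // gerBl.
    by rewrite mulr_ge0 // exprn_ge0.
  split => // i t Jt; rewrite exprS -mulrA.
  by apply: kT => // s Js; exact: h1.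
have dist_zn i t n m : J i t -> wt i t * normH (zn (n + m)%N t - zn n t) <= k i ^+ n * C i.
  move=> Jt; suff : wt i t * normH (zn (n + m)%N t - zn n t) <= k i ^+ n * C i - k i ^+ (n + m) * C i.
    by move=> /le_trans; apply; rewrite gerBl mulr_ge0 // exprn_ge0.
  elim: m => [|m IH]; first by rewrite addn0 !subrr /normH !normr0 addr0 mulr0.
  rewrite addnS (le_trans (tri _ _ _ (zn (n + m)%N t) _)) //.
  apply: le_trans (lerD ((znC (n + m)%N).2 i t Jt) IH) _.
  by rewrite (CE i) exprS le_eqVlt; apply/orP; left; apply/eqP; ring.
have cauchy_zn t e : 0 < e -> exists N, forall n, (N <= n)%N ->
    normH (zn n t - zn N t) <= e.
  move=> e0; have [i /nbhs_singleton Jt] := hJ t.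
  have [N hN] := geometric_small (C i) (k0 i) (k1 i) (mulr_gt0 (wt0 i t) e0).
  exists N => n Nn; rewrite -(ler_pM2l (wt0 i t)) -(subnKC Nn).
  by rewrite (le_trans (dist_zn i t N _ Jt)) // ltW // hN.
have cvgz1 t : cvgn (fun n => (zn n t).1).
  apply: cauchy_seq_cvg => e /(cauchy_zn t)[N hN]; exists N => n /hN.
  by apply: le_trans; rewrite /normH lerDl.
have cvgz2 t : cvgn (fun n => (zn n t).2).
  apply: cauchy_seq_cvg => e /(cauchy_zn t)[N hN]; exists N => n /hN.
  by apply: le_trans; rewrite /normH lerDr.
pose z t : H1 * H2 := (limn (fun n => (zn n t).1), limn (fun n => (zn n t).2)).
(* The factor 2 is the price of passing to the limit in the two components separately. *)
have z_zn i t n : J i t -> wt i t * normH (z t - zn n t) <= k i ^+ n * (2 * C i).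
  move=> Jt; have bound m : (n <= m)%N -> normH (zn m t - zn n t) <= k i ^+ n * C i / wt i t.
    move=> nm; rewrite ler_pdivlMr // mulrC (le_trans _ (dist_zn i t n (m - n)%N Jt)) //.
    by rewrite subnKC.
  have h1 : `|(z t - zn n t).1| <= k i ^+ n * C i / wt i t.
    apply: (limn_norm_le (N := n) (cvgB (cvgz1 t) (cvg_cst _))) => m /bound.
    by apply: le_trans; rewrite /normH lerDl.
  have h2 : `|(z t - zn n t).2| <= k i ^+ n * C i / wt i t.
    apply: (limn_norm_le (N := n) (cvgB (cvgz2 t) (cvg_cst _))) => m /bound.
    by apply: le_trans; rewrite /normH lerDr.
  rewrite mulrC -ler_pdivlMr // (le_trans (lerD h1 h2)) //.
  by rewrite le_eqVlt; apply/orP; left; apply/eqP; set u := (wt i t)^-1; ring.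
have zC : picard_class z.
  split; last by move=> i; exists (k i ^+ 0 * (2 * C i)) => t Jt; exact: (z_zn i t 0%N).
  move=> t; have [i Ji] := hJ t; have Jt := nbhs_singleton Ji.
  apply/continuous_epsdelta => e e0.
  have /nbhs_ballP[d1 /= d10 hd1] := Ji.
  (* Near [t] the weight stays above half of its value at [t], so weighted convergence is locally
     uniform and continuity passes to the limit. *)
  have /continuous_epsdelta/(_ _ (divr_gt0 (wt0 i t) (ltr0n R 2)))[d2 d20 hd2] := @cwt i t.
  have we0 : 0 < wt i t / 2 * (e / 3) by rewrite mulr_gt0 ?divr_gt0 // ltr0n.
  have [N hN] := geometric_small (2 * C i) (k0 i) (k1 i) we0.
  have e3 : 0 < e / 3 by rewrite divr_gt0 // ltr0n.
  have /continuous_epsdelta/(_ _ e3)[d3 d30 hd3] := (znC N).1.1 t.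
  exists (Num.min d1 (Num.min d2 d3)); first by rewrite !lt_min d10 d20.
  move=> s; rewrite !lt_min => /and3P[s1 s2 s3].
  have est r : `|t - r| < d1 -> `|t - r| < d2 -> `|z r - zn N r| < e / 3.
    move=> r1 r2; have Jr : J i r by apply: hd1; rewrite -ball_normE.
    have wr : wt i t / 2 <= wt i r.
      have := ler_norm (wt i t - wt i r); have := hd2 _ r2; lra.
    rewrite (le_lt_trans (le_norm_normH _)) // -(ltr_pM2l (wt0 i r)).
    rewrite (le_lt_trans (z_zn i r N Jr)) // (lt_le_trans (hN N (leqnn _))) //.
    by rewrite ler_wpM2r // ltW.
  have -> : z t - z s = (z t - zn N t) + (zn N t - zn N s) - (z s - zn N s).
    by rewrite addrA subrK opprB addrA subrK.
  have -> : e = e / 3 + e / 3 + e / 3 by field.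
  rewrite (le_lt_trans (ler_normB _ _)) // ltrD //; last exact: est.
  rewrite (le_lt_trans (ler_normD _ _)) // ltrD //; last exact: hd3.
  by apply: est; rewrite subrr normr0.
exists z => // t; have [i /nbhs_singleton Jt] := hJ t.
apply/eqP; rewrite -subr_eq0 -normr_eq0; apply/eqP/le_anti; rewrite normr_ge0 andbT.
rewrite (le_trans (le_norm_normH _)) // -(ler_pM2l (wt0 i t)) mulr0.
apply/ler_addgt0Pr => e e0; rewrite add0r.
have [N hN] := geometric_small (2 * (2 * C i)) (k0 i) (k1 i) e0.
rewrite (le_trans (tri _ _ _ (zn N.+1 t) _)) //.
have h1 := kT zC (znC N).1 (fun s Js => z_zn i s N Js) Jt.
have h2 := z_zn i t N.+1 Jt; rewrite normHB in h2.
apply: le_trans (lerD h1 h2) _; apply: le_trans (ltW (hN N.+1 (leqnSn _))).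
by rewrite exprS le_eqVlt; apply/orP; left; apply/eqP; ring.
Qed.

End Picard.

(** * Slow-fast systems *)

Section SlowFast.
Context {R : realType} {H1 H2 : completeNormedModType R}.
Variables (SA : R -> H1 -> H1) (SB : R -> H2 -> H2) (gamma1 gamma2 : R).
Hypotheses (hSA : C0_semigroup SA) (hSB : C0_group SB).
Hypotheses (gamma10 : 0 <= gamma1).
Hypothesis SAdecay : forall t x, 0 <= t -> `|SA t x| <= expR (- gamma1 * t) * `|x|.
Hypothesis SBdecay : forall t y, t <= 0 -> `|SB t y| <= expR (- gamma2 * t) * `|y|.
Variables (f : H1 * H2 -> H1) (g : H1 * H2 -> H2).
Hypotheses (hfc : continuous f) (hgc : continuous g).
Variables (K eps : R) (K0 : 0 < K) (eps0 : 0 < eps).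
Hypothesis hfK : forall z z', `|f z - f z'| <= K * normH (z - z').
Hypothesis hgK : forall z z', `|g z - g z'| <= K * normH (z - z').
Implicit Types (z : R -> H1 * H2) (eta : R -> H1) (zeta : H1 * H2).

Let fz z r := f (z r).
Let gz z r := g (z r).

Lemma fz_continuous z : continuous z -> continuous (fz z).
Proof. by move=> cz r; apply: continuous_comp; [exact: cz|exact: hfc]. Qed.

Lemma gz_continuous z : continuous z -> continuous (gz z).
Proof. by move=> cz r; apply: continuous_comp; [exact: cz|exact: hgc]. Qed.

Lemma max0_continuous : continuous (Num.max (0 : R)).
Proof.
move=> t; apply/continuous_epsdelta => e e0; exists e => // s.
by apply: le_lt_trans; rewrite ![Num.max 0 _]maxC dist_max.
Qed.

Lemma pair_continuous (x : R -> H1) (y : R -> H2) :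
  continuous x -> continuous y -> continuous (fun t => (x t, y t)).
Proof. by move=> cx cy t; apply: cvg_pair; [exact: cx|exact: cy]. Qed.

(* The mild equation on [0, oo[, with [eta t] the integral of the noise over
   [0, t], extended to t < 0 by its value at 0. *)
Definition forward eta zeta z t : H1 * H2 :=
  let s := Num.max 0 t in
  (SA (s / eps) zeta.1 + eps^-1 *: convA SA eps (fz z) 0 s + (Num.sqrt eps)^-1 *: eta s,
   SB s (zeta.2 + prim (pull SB (gz z)) s)).

Lemma forward_continuous eta zeta z : continuous (fun t : R => eta (Num.max 0 t)) ->
  continuous z -> continuous (forward eta zeta z).
Proof.
move=> ceta cz; apply: pair_continuous => t.
  apply: cvgD; last by apply: cvgZ; [exact: cvg_cst|exact: ceta].
  apply: cvgD; last first.
    apply: cvgZ; first exact: cvg_cst.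
    exact: (convA_continuous hSA eps0 gamma10 SAdecay (fz_continuous cz) (a := 0)).
  have m0 s : 0 <= Num.max 0 s :> R by rewrite le_max lexx.
  have e s : SA (Num.max 0 s / eps) zeta.1 = semigroup_ext SA (Num.max 0 s / eps) zeta.1.
    have q0 : 0 <= Num.max 0 s / eps by rewrite divr_ge0 // ltW.
    by rewrite /semigroup_ext [X in _ = SA X _](max_idPl q0).
  rewrite e (_ : (fun s => _) = fun s => semigroup_ext SA (Num.max 0 s / eps) zeta.1).
    apply: (semigroup_ext_continuous hSA gamma10 SAdecay (F := fun=> zeta.1)
      (tau := fun s => Num.max 0 s / eps)).
      by move=> s; apply: cvgM; [exact: max0_continuous|exact: cvg_cst].
    by move=> s; exact: cvg_cst.
  by apply/funext => s; exact: e.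
apply: (group_continuous hSB) => s; first exact: max0_continuous.
apply: cvgD; first exact: cvg_cst.
apply: continuous_comp; first exact: max0_continuous.
apply: prim_continuous; exact: pull_continuous (gz_continuous cz).
Qed.

(** Two noises are allowed so that one estimate yields existence (equal noises), uniqueness, and
    dependence on the noise. [L] is fixed before everything else, in particular before the
    noises. *)
Lemma forward_estimate T : exists2 L, 0 < L &
  forall eta eta' zeta z z' a c, continuous z -> continuous z' ->
  (forall t, 0 <= t -> t <= T -> `|eta t - eta' t| <= a) ->
  (forall t, 0 <= t -> t <= T -> expR (- L * t) * normH (z t - z' t) <= c) ->
  forall t, 0 <= t -> t <= T ->
    expR (- L * t) * normH (forward eta zeta z t - forward eta' zeta z' t) <=
    (Num.sqrt eps)^-1 * a + 2^-1 * c.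
Proof.
have [M M0 hM] := group_bounded hSB T.
(* Makes the two Lipschitz contributions [eps^-1 * K / L] and [M * K / L] add up to 1/2. *)
pose L := 2 * K * (eps^-1 + M).
have ei0 : 0 < eps^-1 by rewrite invr_gt0.
have L0 : 0 < L by rewrite !mulr_gt0 // addr_gt0.
exists L => // eta eta' zeta z z' a c cz cz' ha hc t t0 tT.
have c0 : 0 <= c.
  by apply: le_trans (hc t t0 tT); rewrite mulr_ge0 ?expR_ge0 ?normH_ge0.
have hz r : 0 <= r -> r <= t -> normH (z r - z' r) <= c * expR (L * r).
  move=> r0 rt; rewrite -ler_pdivrMr ?expR_gt0 // -expRN -mulNr mulrC.
  by rewrite hc // (le_trans rt).
have cD : continuous (fun r => fz z r - fz z' r).
  by move=> r; apply: cvgB; exact: fz_continuous.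
have cE : continuous (fun r => gz z r - gz z' r).
  by move=> r; apply: cvgB; exact: gz_continuous.
rewrite /forward (max_idPr t0) /normH /= mulrDr.
have -> : SA (t / eps) zeta.1 + eps^-1 *: convA SA eps (fz z) 0 t +
      (Num.sqrt eps)^-1 *: eta t -
     (SA (t / eps) zeta.1 + eps^-1 *: convA SA eps (fz z') 0 t +
      (Num.sqrt eps)^-1 *: eta' t) =
   eps^-1 *: convA SA eps (fun r => fz z r - fz z' r) 0 t +
   (Num.sqrt eps)^-1 *: (eta t - eta' t).
  have -> : convA SA eps (fun r => fz z r - fz z' r) 0 t =
      convA SA eps (fz z) 0 t - convA SA eps (fz z') 0 t.
    exact: (convAB hSA eps0 gamma10 SAdecay (fz_continuous cz) (fz_continuous cz') t0).
  by lmod R H1.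
have -> : SB t (zeta.2 + prim (pull SB (gz z)) t) - SB t (zeta.2 + prim (pull SB (gz z')) t) =
    SB t (prim (pull SB (fun r => gz z r - gz z' r)) t).
  have -> : prim (pull SB (fun r => gz z r - gz z' r)) t =
      prim (pull SB (gz z)) t - prim (pull SB (gz z')) t.
    exact: (pullB hSB t (gz_continuous cz) (gz_continuous cz')).
  rewrite -(groupB hSB); by congr (SB t _); lmod R H2.
have h1 : `|convA SA eps (fun r => fz z r - fz z' r) 0 t| <=
    K * c / (gamma1 / eps - - L) * expR (- - L * t).
  apply: (convA_expbound hSA eps0 gamma10 SAdecay _ cD t0).
    by rewrite (lt_le_trans (y := 0)) ?oppr_lt0 // divr_ge0 // ltW.
  by move=> r r0 rt; rewrite opprK -mulrA (le_trans (hfK _ _)) // ler_pM2l // hz.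
have h2 : `|SB t (prim (pull SB (fun r => gz z r - gz z' r)) t)| <=
    M * (K * c) / L * expR (L * t).
  apply: (pull_bound_forward hSB cE t0 L0 _ (ltW M0)).
    by move=> s x s0 st; apply: hM; lra.
  by move=> r r0 rt; rewrite -mulrA (le_trans (hgK _ _)) // ler_pM2l // hz.
have E0 := expR_ge0 (- L * t).
have EE : expR (- L * t) * expR (L * t) = 1 by rewrite mulNr expRN mulVf // gt_eqF ?expR_gt0.
have E1 : expR (- L * t) <= 1 by rewrite -expR0 ler_expR mulNr oppr_le0 mulr_ge0 // ltW.
have {}h1 : expR (- L * t) * `|convA SA eps (fun r => fz z r - fz z' r) 0 t| <= K * c / L.
  apply: le_trans (ler_wpM2l E0 h1) _; rewrite opprK mulrCA EE mulr1.
  have KC0 : 0 <= K * c by rewrite mulr_ge0 // ltW.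
  rewrite ler_wpM2l // lef_pV2 ?posrE //.
    by rewrite lerDr divr_ge0 // ltW.
  by rewrite ltr_wpDl // divr_ge0 // ltW.
have {}h2 : expR (- L * t) * `|SB t (prim (pull SB (fun r => gz z r - gz z' r)) t)| <=
    M * (K * c) / L.
  by apply: le_trans (ler_wpM2l E0 h2) _; rewrite mulrCA EE mulr1.
have h3 : expR (- L * t) * `|(Num.sqrt eps)^-1 *: (eta t - eta' t)| <= (Num.sqrt eps)^-1 * a.
  rewrite normrZ ger0_norm ?invr_ge0 ?sqrtr_ge0 // mulrCA ler_wpM2l ?invr_ge0 ?sqrtr_ge0 //.
  by rewrite (le_trans _ (ha t t0 tT)) // ler_piMl.
have -> : 2^-1 * c = eps^-1 * (K * c / L) + M * (K * c) / L.
  rewrite /L; field.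
  by rewrite !gt_eqF // addr_gt0 ?mulr_gt0.
have h4 := ler_wpM2l E0 (ler_normD (eps^-1 *: convA SA eps (fun r => fz z r - fz z' r) 0 t)
   ((Num.sqrt eps)^-1 *: (eta t - eta' t))).
rewrite normrZ (ger0_norm (ltW ei0)) in h4.
have h5 := ler_wpM2l (ltW ei0) h1.
lra.
Qed.

Lemma forward_max0 eta zeta z t :
  forward eta zeta z (Num.max 0 t) = forward eta zeta z t.
Proof. by rewrite /forward maxA maxxx. Qed.

(** The forward bound of the group, hence the rate of the weight, depends on the horizon; one
    seminorm per integer horizon gives a global solution without gluing. *)
Lemma forward_fixpoint eta zeta : continuous (fun t : R => eta (Num.max 0 t)) ->
  exists2 z, continuous z & forall t, forward eta zeta z t = z t.
Proof.
move=> ceta.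
pose L n := s2val (cid2 (forward_estimate n%:R)).
have L0 n : 0 < L n by exact: s2valP (cid2 (forward_estimate n%:R)).
have hL n := s2valP' (cid2 (forward_estimate n%:R)); rewrite -/(L _) in hL.
have c0 : continuous (fun _ : R => zeta) by move=> t; exact: cvg_cst.
have max0 (t : R) : 0 <= Num.max 0 t by rewrite le_max lexx.
have maxn n (t : R) : t <= n%:R -> Num.max 0 t <= n%:R by move=> h; rewrite ge_max ler0n.
have [] := @picard R H1 H2 nat (fun n => [set t | t <= n%:R])
  (fun n t => expR (- L n * Num.max 0 t)) (fun=> 2^-1) (forward eta zeta) (fun=> zeta).
- move=> t; exists (Num.truncn `|t|).+1; apply/nbhs_ballP.
  have h : t < (Num.truncn `|t|).+1%:R by rewrite (le_lt_trans (ler_norm t)) // truncnS_gt.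
  exists ((Num.truncn `|t|).+1%:R - t); first by rewrite /= subr_gt0.
  move=> s /=; rewrite -ball_normE /= distrC => /(le_lt_trans (ler_norm _)) ts.
  by apply/ltW; lra.
- by move=> n t; exact: expR_gt0.
- move=> n t; apply: continuous_comp; last exact: continuous_expR.
  by apply: cvgM; [exact: cvg_cst|exact: max0_continuous].
- by move=> n; rewrite invr_ge0.
- by move=> n; rewrite invf_lt1 // ltr1n.
- exact: c0.
- by move=> z [cz _]; exact: forward_continuous.
- move=> z z' n c [cz _] [cz' _] h t /= tn.
  rewrite -(forward_max0 _ _ z) -(forward_max0 _ _ z').
  have -> : 2^-1 * c = (Num.sqrt eps)^-1 * 0 + 2^-1 * c by rewrite mulr0 add0r.
  apply: hL => //; last exact: maxn.
    by move=> s _ _; rewrite subrr normr0.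
  by move=> s s0 sn; have := h s sn; rewrite (max_idPr s0).
- move=> n; have cD : continuous (fun t => forward eta zeta (fun=> zeta) t - zeta).
    by move=> t; apply: cvgB; [exact: forward_continuous|exact: cvg_cst].
  have [M M0 hM] := bounded_segment 0 n%:R cD.
  exists (2 * M) => t /= tn; rewrite -(forward_max0 _ _ (fun=> zeta)).
  rewrite -[leRHS]mul1r ler_pM ?expR_ge0 ?normH_ge0 //.
    by rewrite -expR0 ler_expR mulNr oppr_le0 mulr_ge0 // ltW.
  rewrite (le_trans (normH_le_norm _)) // ler_wpM2l // hM //; exact: maxn.
by move=> z [cz _] hz; exists z.
Qed.

(** [B] depends on [T] but not on the noises, which makes the later comparison uniform in mu. With
    [a = 0] this is uniqueness. *)
Lemma forward_compare T : exists2 B, 0 <= B & forall eta eta' zeta z z' a,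
  continuous z -> continuous z' ->
  (forall t, forward eta zeta z t = z t) -> (forall t, forward eta' zeta z' t = z' t) ->
  (forall t, 0 <= t -> t <= T -> `|eta t - eta' t| <= a) ->
  forall t, 0 <= t -> t <= T -> normH (z t - z' t) <= B * a.
Proof.
have [L L0 hL] := forward_estimate T.
have s0 : 0 <= (Num.sqrt eps)^-1 by rewrite invr_ge0 sqrtr_ge0.
exists (expR (L * T) * ((Num.sqrt eps)^-1 / (1 - 2^-1))).
  by rewrite mulr_ge0 ?expR_ge0 // divr_ge0 // subr_ge0 invf_le1 // ler1n.
move=> eta eta' zeta z z' a cz cz' hz hz' ha t t0 tT.
have a0 : 0 <= a by apply: le_trans (ha t t0 tT).
have : expR (- L * t) * normH (z t - z' t) <= (Num.sqrt eps)^-1 * a / (1 - 2^-1).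
  apply: (@contraction_bound R R [set t | 0 <= t /\ t <= T]
    (fun t => expR (- L * t) * normH (z t - z' t))) => //.
  - by rewrite invf_lt1 // ltr1n.
  - have cD : continuous (fun t => z t - z' t).
      by move=> s; apply: cvgB; [exact: cz|exact: cz'].
    have [M M0 hM] := bounded_segment 0 T cD.
    exists (2 * M) => s [s0' sT].
    rewrite -[leRHS]mul1r ler_pM ?expR_ge0 ?normH_ge0 //.
      by rewrite -expR0 ler_expR mulNr oppr_le0 mulr_ge0 // ltW.
    by rewrite (le_trans (normH_le_norm _)) // ler_wpM2l // hM.
  - move=> c hc s [s0' sT]; rewrite -hz -hz'; apply: hL => // r r0 rT.
    exact: hc.
rewrite mulNr expRN ler_pdivrMl ?expR_gt0 // => /le_trans; apply.
rewrite [_ * a / _]mulrAC mulrA ler_wpM2r // ler_wpM2r ?ler_expR ?ler_pM2l //.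
by rewrite divr_ge0 // subr_ge0 invf_le1 // ler1n.
Qed.

(** * Mild solutions on [[0, oo[], for an abstract noise with primitive [eta] *)

Section Mild.
Variables (noise : R -> R -> H1 -> Prop) (eta : R -> H1).
Hypothesis eta0 : eta 0 = 0.
Hypothesis ceta : continuous (fun t : R => eta (Num.max 0 t)).
Hypothesis noise_unique : forall s t N N', 0 <= s -> s <= t ->
  noise s t N -> noise s t N' -> N = N'.
Hypothesis noise_eta : forall s t, 0 <= s -> s <= t ->
  noise s t (eta t - SA ((t - s) / eps) (eta s)).

Lemma forward_mild zeta z : continuous z -> (forall t, forward eta zeta z t = z t) ->
  mild_solution SA SB f g eps noise `[0, +oo[ z /\ z 0 = zeta.
Proof.
move=> cz hz; split; last first.
  rewrite -hz /forward maxxx mul0r (semigroup_at0 hSA) convA_refl eta0 !scaler0 !addr0.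
  by rewrite prim0 addr0 (group_at0 hSB); case: zeta {hz}.
split; first exact: continuous_subspaceT.
move=> s t; rewrite /= !in_itv /= !andbT => s0 t0 st.
have q0 : 0 <= (t - s) / eps by rewrite divr_ge0 ?subr_ge0 // ltW.
exists (convA SA eps (fz z) s t), (eta t - SA ((t - s) / eps) (eta s)),
  (SB t (prim (pull SB (gz z)) t - prim (pull SB (gz z)) s)); split.
- exact: (convAP hSA eps0 gamma10 SAdecay (fz_continuous cz) st).
- exact: noise_eta.
- exact: (pull_int hSB (gz_continuous cz) t st).
- rewrite -(hz t) -(hz s) /forward /= (max_idPr s0) (max_idPr t0).
  have -> : convA SA eps (fz z) 0 t =
      SA ((t - s) / eps) (convA SA eps (fz z) 0 s) + convA SA eps (fz z) s t.
    exact: (convA_chasles hSA eps0 gamma10 SAdecay (fz_continuous cz) s0 st).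
  rewrite !(semigroupD hSA _ _ q0) !(semigroupZ hSA gamma10 SAdecay _ _ q0).
  rewrite -(semigroup_compose hSA _ q0) ?divr_ge0 // 1?ltW //.
  rewrite -mulrDl subrK; set X := SA (t / eps) zeta.1.
  by lmod R H1.
- rewrite -(hz t) -(hz s) /forward /= (max_idPr s0) (max_idPr t0).
  rewrite (group_compose hSB) subrK -(groupD hSB).
  by congr (SB t _); lmod R H2.
Qed.

Lemma mild_forward zeta z :
  mild_solution SA SB f g eps noise `[0, +oo[ z -> z 0 = zeta ->
  let zp t := z (Num.max 0 t) in
  continuous zp /\ forall t, forward eta zeta zp t = zp t.
Proof.
move=> [cz hz] z0 zp.
have czp : continuous zp.
  move=> t; apply/continuous_epsdelta => e e0.
  have m0 : (`[0, +oo[%classic : set R) (Num.max 0 t).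
    by rewrite /= in_itv /= andbT le_max lexx.
  have /subspace_continuousP/(_ _ m0)/cvgrPdist_lt/(_ _ e0) := cz.
  move=> /nbhs_ballP[d /= d0 hd]; exists d => // s ts.
  apply: (hd (Num.max 0 s)); last by rewrite /= in_itv /= andbT le_max lexx.
  by rewrite -ball_normE /= (le_lt_trans _ ts) // ![Num.max 0 _]maxC dist_max.
split => // t; rewrite -forward_max0 /zp; set s := Num.max 0 t.
have s0 : 0 <= s by rewrite le_max lexx.
have zpE r : 0 <= r -> zp r = z r by move=> r0; rewrite /zp (max_idPr r0).
have [] := hz 0 s _ _ s0; rewrite /= ?in_itv /= ?andbT //.
rewrite subr0 => F [N [G [hF hN hG h1 h2]]].
have -> : forward eta zeta zp s = ((z s).1, (z s).2); last by case: (z s).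
rewrite h1 h2 /forward (max_idPr s0) z0; congr pair.
  have -> : F = convA SA eps (fz zp) 0 s.
    apply: (is_RSint_unique s0 hF).
    apply: (eq_is_RSint _ (convAP hSA eps0 gamma10 SAdecay (fz_continuous czp) s0)).
    by move=> r r0 rs; rewrite /fz zpE.
  congr (_ + _ *: _); apply: (noise_unique _ s0 _ hN) => //.
  have := noise_eta (lexx 0) s0; rewrite eta0 (semigroup0 gamma10 SAdecay) ?subr0 //.
  by rewrite divr_ge0 // ltW.
have -> : G = SB s (prim (pull SB (gz zp)) s); last by rewrite -(groupD hSB).
rewrite -[prim _ s]subr0 -[X in _ - X](prim0 (pull SB (gz zp))).
apply: (is_RSint_unique s0 hG).
apply: (eq_is_RSint _ (pull_int hSB (gz_continuous czp) s s0)).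
by move=> r r0 rs; rewrite /gz zpE.
Qed.

(** Existence makes the choice of [xget] a mild solution, and [forward_compare] with equal noises
    pins its values at all [t >= 0]. *)
Lemma mild_unique zeta z : continuous z -> (forall t, forward eta zeta z t = z t) ->
  forall t, 0 <= t ->
  xget (cst 0) [set z | mild_solution SA SB f g eps noise `[0, +oo[ z /\ z 0 = zeta] t
  = z t.
Proof.
move=> cz hz t t0; set Z := xget _ _.
have [mZ Z0] : mild_solution SA SB f g eps noise `[0, +oo[ Z /\ Z 0 = zeta.
  by apply: (@xgetPex _ (cst 0) [set z | mild_solution SA SB f g eps noise `[0, +oo[ z /\ z 0 = zeta]); exists z; exact: forward_mild.
have [cZ hZ] := mild_forward mZ Z0.
have [B _ hB] := forward_compare t.
have := hB eta eta zeta _ z 0 cZ cz hZ hz _ t t0 (lexx t).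
rewrite mulr0 (max_idPr t0) => h.
have h' : normH (Z t - z t) <= 0 by apply: h => s _ _; rewrite subrr normr0.
apply/eqP; rewrite -subr_eq0 -normr_eq0; apply/eqP/le_anti.
by rewrite normr_ge0 andbT (le_trans (le_norm_normH _)).
Qed.

End Mild.

(** * The Lyapunov-Perron fixed point on the whole line *)

Section FullLine.
Variables (sigma : H1) (rho : R) (u : R -> R) (zeta : H1 * H2) (Z : R -> H1 * H2).
Let lam := rho / eps.
Let kappa := K / (gamma1 - rho) + K / (lam - gamma2).
Hypotheses (rho0 : 0 < rho) (rhoK : K < gamma1 - rho) (lamg : gamma2 < lam).
Hypothesis kappa1 : kappa < 1.
Hypothesis cu : continuous u.
Hypothesis hu : forall T, exists C, forall r, r <= T -> `|u r| <= C * expR (- lam * r).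
Let us r := u r *: sigma.
Hypothesis cZ : continuous Z.
Hypothesis hZ : forall t, forward (convA SA eps us 0) zeta Z t = Z t.

Let forcing z r := eps^-1 *: fz z r + (Num.sqrt eps)^-1 *: us r.
Let gdiff z r := gz z r - gz Z r.

Let us_continuous : continuous us.
Proof. by move=> r; apply: cvgZr_tmp; exact: cu. Qed.

Let forcing_continuous z : continuous z -> continuous (forcing z).
Proof.
move=> cz r; apply: cvgD; (apply: cvgZ; first exact: cvg_cst).
  exact: fz_continuous.
exact: us_continuous.
Qed.

Let gdiff_continuous z : continuous z -> continuous (gdiff z).
Proof. by move=> cz r; apply: cvgB; exact: gz_continuous. Qed.

Let lam0 : 0 < lam. Proof. by rewrite divr_gt0. Qed.

Let lamA : lam < gamma1 / eps.
Proof. by rewrite /lam ltr_pM2r ?invr_gt0 //; move: K0 rhoK; lra. Qed.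

(** For [t >= 0] the vector [SB t (zeta.2 + prim (pull SB (gz Z)) t)] is the slow component of [Z].
    For [t < 0], where [Z] is frozen, it instead continues the linear slow equation with forcing
    [gz Z], so that a fixed point solves the slow equation on all of R. *)
Definition lyapunov_perron z t : H1 * H2 :=
  (convinf SA eps (forcing z) t,
   SB t (zeta.2 + prim (pull SB (gz Z)) t - tailB SB (gdiff z) t)).

Let near_Z z := exists c, forall t, normH (z t - Z t) <= c * expR (- lam * t).

(** [Z] is frozen on the negative half-line, so it is bounded on []-oo, T]]. *)
Let tail_Z T : exists C, forall r, r <= T -> normH (Z r) <= C * expR (- lam * r).
Proof.
have [M M0 hM] := bounded_segment 0 (Num.max 0 T) cZ.
exists (2 * M * expR (lam * T)) => r rT.
rewrite -hZ -forward_max0 hZ (le_trans (normH_le_norm _)) //.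
rewrite -2!(mulrA 2) ler_wpM2l // -mulrA -expRD -[leLHS]mulr1 ler_pM //.
  by apply: hM; [rewrite le_max lexx|rewrite ge_max !le_max lexx rT orbT].
by rewrite -expR0 ler_expR mulNr -mulrBr mulr_ge0 ?subr_ge0 // ltW.
Qed.

Let tail_forcing z : near_Z z -> tail_bounded lam (forcing z).
Proof.
move=> [c hc] T; have [C1 h1] := hu T; have [C2 h2] := tail_Z T.
have [C3 h3] : exists C, forall r, r <= T -> `|fz z r| <= C * expR (- lam * r).
  exists (`|f 0| * expR (lam * T) + K * (c + C2)) => r rT.
  have -> : fz z r = f 0 + (f (z r) - f 0) by rewrite addrC subrK.
  rewrite (le_trans (ler_normD _ _)) // mulrDl lerD //.
    rewrite -mulrA -expRD -[leLHS]mulr1 ler_wpM2l //.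
    by rewrite -expR0 ler_expR mulNr -mulrBr mulr_ge0 ?subr_ge0 // ltW.
  rewrite (le_trans (hfK _ _)) // -mulrA ler_wpM2l ?(ltW K0) // subr0.
  have -> : z r = (z r - Z r) + Z r by rewrite subrK.
  by rewrite (le_trans (normHD _ _)) // mulrDl lerD // h2.
exists (eps^-1 * C3 + (Num.sqrt eps)^-1 * (C1 * `|sigma|)) => r rT.
rewrite (le_trans (ler_normD _ _)) // mulrDl !normrZ lerD // -mulrA.
  by have ei0 : 0 < eps^-1 by [rewrite invr_gt0]; rewrite (gtr0_norm ei0) ler_pM2l // h3.
rewrite ger0_norm ?invr_ge0 ?sqrtr_ge0 // ler_wpM2l ?invr_ge0 ?sqrtr_ge0 //.
by rewrite mulrAC ler_wpM2r // h1.
Qed.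

Let decay_gdiff z : near_Z z -> decay_bounded lam (gdiff z).
Proof.
move=> [c hc]; exists (K * c) => r.
by rewrite (le_trans (hgK _ _)) // -mulrA ler_wpM2l ?hc // ltW.
Qed.

Let near_ZZ : near_Z Z.
Proof. by exists 0 => t; rewrite subrr /normH !normr0 addr0 mul0r. Qed.

Let forcing_diff z z' r :
  forcing z r - forcing z' r = eps^-1 *: (fz z r - fz z' r).
Proof. by rewrite /forcing; lmod R H1. Qed.

(** The factor [eps^-1] of the fast equation cancels against the gap between the rates, which is why
    the first term of [kappa] is free of [eps]. *)
Let rateA c : eps^-1 * (K * c) / (gamma1 / eps - lam) = K / (gamma1 - rho) * c.
Proof.
have g0 : 0 < gamma1 - rho by move: K0 rhoK; lra.
by rewrite /lam -mulrBl; field; rewrite !gt_eqF.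
Qed.

(** The interval [J] is arbitrary: the same [z] is the backward solution that puts [z 0] on the
    manifold and the forward solution that tracks [Z]. *)
Lemma lyapunov_perron_mild z J : continuous z -> near_Z z ->
  (forall t, lyapunov_perron z t = z t) ->
  mild_solution SA SB f g eps
    (fun s t N => is_RSint (fun r => u r *: SA ((t - r) / eps) sigma) id s t N) J z.
Proof.
move=> cz nz hz; split; first exact: continuous_subspaceT.
move=> s t _ _ st; have q0 : 0 <= (t - s) / eps by rewrite divr_ge0 ?subr_ge0 // ltW.
exists (convA SA eps (fz z) s t), (convA SA eps us s t),
  (SB t (prim (pull SB (gz z)) t - prim (pull SB (gz z)) s)); split.
- exact: (convAP hSA eps0 gamma10 SAdecay (fz_continuous cz) st).
- apply: (eq_is_RSint _ (convAP hSA eps0 gamma10 SAdecay us_continuous st)) => r sr rt.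
  by rewrite (semigroupZ hSA gamma10 SAdecay) // divr_ge0 ?subr_ge0 // ltW.
- exact: (pull_int hSB (gz_continuous cz) t st).
- rewrite -(hz t) -(hz s) /=.
  have -> : convinf SA eps (forcing z) t =
      SA ((t - s) / eps) (convinf SA eps (forcing z) s) + convA SA eps (forcing z) s t.
    exact: (convinf_cocycle hSA eps0 gamma10 SAdecay lamA (forcing_continuous cz) (tail_forcing nz) st).
  have -> : convA SA eps (forcing z) s t =
      eps^-1 *: convA SA eps (fz z) s t + (Num.sqrt eps)^-1 *: convA SA eps us s t.
    rewrite -(convAZ hSA eps0 gamma10 SAdecay _ us_continuous st).
    apply: (convA_lin hSA eps0 gamma10 SAdecay _ (fz_continuous cz) _ st).
    by move=> r; apply: cvgZ; [exact: cvg_cst|exact: us_continuous].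
  by rewrite addrA.
- rewrite -(hz t) -(hz s) /= (group_compose hSB) subrK -(groupD hSB); congr (SB t _).
  have := tailB_diff SB (gdiff z) s t.
  have -> : prim (pull SB (gdiff z)) t = prim (pull SB (gz z)) t - prim (pull SB (gz Z)) t.
    exact: (pullB hSB t (gz_continuous cz) (gz_continuous cZ)).
  have -> : prim (pull SB (gdiff z)) s = prim (pull SB (gz z)) s - prim (pull SB (gz Z)) s.
    exact: (pullB hSB s (gz_continuous cz) (gz_continuous cZ)).
  move=> /eqP; rewrite subr_eq => /eqP ->.
  by lmod R H2.
Qed.

Let forward_Z1 t : 0 <= t -> (Z t).1 = SA (t / eps) zeta.1 + convA SA eps (forcing Z) 0 t.
Proof.
move=> t0; rewrite -(hZ t) /= (max_idPr t0) -addrA; congr (_ + _).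
rewrite -(convAZ hSA eps0 gamma10 SAdecay _ us_continuous t0); apply/esym.
apply: (convA_lin hSA eps0 gamma10 SAdecay _ (fz_continuous cZ) _ t0).
by move=> r; apply: cvgZ; [exact: cvg_cst|exact: us_continuous].
Qed.

Let Z_0 : Z 0 = zeta.
Proof.
rewrite -hZ /forward maxxx mul0r (semigroup_at0 hSA) !convA_refl !scaler0 !addr0.
by rewrite prim0 addr0 (group_at0 hSB) -surjective_pairing.
Qed.

Let normH_sub (x y : H1 * H2) : normH (x - y) = `|x.1 - y.1| + `|x.2 - y.2|.
Proof. by []. Qed.

Let normH_pair (x x' : H1) (y y' : H2) :
  normH ((x, y) - (x', y')) = `|x - x'| + `|y - y'|.
Proof. by []. Qed.

Lemma lyapunov_perron_contraction z z' c : continuous z -> near_Z z ->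
  continuous z' -> near_Z z' ->
  (forall t, expR (lam * t) * normH (z t - z' t) <= c) ->
  forall t, expR (lam * t) * normH (lyapunov_perron z t - lyapunov_perron z' t) <= kappa * c.
Proof.
move=> cz nz cz' nz' hc t.
have {}hc r : normH (z r - z' r) <= c * expR (- lam * r).
  by rewrite mulNr expRN ler_pdivlMr ?expR_gt0 // mulrC.
rewrite normH_pair; set X := _ - _; set Y := _ - _.
have -> : X = convinf SA eps (fun r => forcing z r - forcing z' r) t.
  exact: (convinfB hSA eps0 gamma10 SAdecay lamA t (forcing_continuous cz) (tail_forcing nz)
    (forcing_continuous cz') (tail_forcing nz')).
have -> : Y = - SB t (tailB SB (fun r => gdiff z r - gdiff z' r) t).
  rewrite /Y -(groupB hSB) -[RHS]scaleN1r -(groupZ hSB); congr (SB t _).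
  rewrite -(tailBB hSB SBdecay lamg t (gdiff_continuous cz) (decay_gdiff nz)
    (gdiff_continuous cz') (decay_gdiff nz')).
  by lmod R H2.
have ct : continuous (fun r => forcing z r - forcing z' r).
  by move=> r; apply: cvgB; exact: forcing_continuous.
have cg : continuous (fun r => gdiff z r - gdiff z' r).
  by move=> r; apply: cvgB; exact: gdiff_continuous.
have ei0 : 0 < eps^-1 by rewrite invr_gt0.
have h1 : `|convinf SA eps (fun r => forcing z r - forcing z' r) t| <=
    eps^-1 * (K * c) / (gamma1 / eps - lam) * expR (- lam * t).
  have hb r : `|forcing z r - forcing z' r| <= eps^-1 * (K * c) * expR (- lam * r).
    rewrite forcing_diff normrZ (gtr0_norm ei0) -mulrA ler_pM2l //.
    by rewrite (le_trans (hfK _ _)) // -mulrA ler_pM2l.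
  apply: (convinf_bound hSA eps0 gamma10 SAdecay lamA ct) => [T|r _]; last exact: hb.
  by exists (eps^-1 * (K * c)) => r _; exact: hb.
have h2 : `|SB t (tailB SB (fun r => gdiff z r - gdiff z' r) t)| <=
    K * c / (lam - gamma2) * expR (- lam * t).
  have hb r : `|gdiff z r - gdiff z' r| <= K * c * expR (- lam * r).
    have -> : gdiff z r - gdiff z' r = gz z r - gz z' r by rewrite /gdiff; lmod R H2.
    by rewrite (le_trans (hgK _ _)) // -mulrA ler_pM2l.
  apply: (tailB_bound hSB SBdecay lamg cg) => [|r _]; last exact: hb.
  by exists (K * c) => r; exact: hb.
rewrite normrN mulrC -ler_pdivlMr ?expR_gt0 // -expRN -mulNr.
apply: le_trans (lerD h1 h2) _; rewrite rateA /kappa.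
by rewrite le_eqVlt; apply/orP; left; apply/eqP; ring.
Qed.

(** For [t >= 0] the slow components agree, since [gdiff Z] vanishes, and the fast ones differ by a
    semigroup orbit, which decays at the rate [gamma1 / eps], faster than [lam]. For [t < 0] every
    term is separately O(e^{-lam t}). *)
Lemma lyapunov_perron_start : near_Z (lyapunov_perron Z).
Proof.
have nZ := near_ZZ; have [C hC] := tail_forcing nZ 0.
have cf := forcing_continuous cZ.
have gZ : gdiff Z = fun=> 0 by apply/funext => r; rewrite /gdiff subrr.
have tail0 t : SB t (tailB SB (gdiff Z) t) = 0.
  apply/normr0_eq0/le_anti; rewrite normr_ge0 andbT.
  have := @tailB_bound _ _ _ _ hSB SBdecay _ lamg (gdiff Z) 0 t (gdiff_continuous cZ)
    (decay_gdiff nZ).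
  by rewrite !mul0r; apply=> r _; rewrite gZ normr0 mul0r.
have LPE t : (lyapunov_perron Z t).2 = SB t (zeta.2 + prim (pull SB (gz Z)) t).
  by rewrite /= (groupB hSB) tail0 subr0.
pose a := `|convinf SA eps (forcing Z) 0 - zeta.1|.
pose C2 := `|g zeta|.
pose c := a + (C / (gamma1 / eps - lam) + (`|zeta.2| + C2 / (lam - gamma2)) + normH zeta).
have C0 : 0 <= C.
  by have := le_trans (normr_ge0 _) (hC 0 (lexx 0)); rewrite pmulr_lge0 ?expR_gt0.
have d1 : 0 < gamma1 / eps - lam by rewrite subr_gt0.
have d2 : 0 < lam - gamma2 by rewrite subr_gt0.
have a0 : 0 <= a by exact: normr_ge0.
have c1 : 0 <= C / (gamma1 / eps - lam) + (`|zeta.2| + C2 / (lam - gamma2)) + normH zeta.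
  have C20 : 0 <= C2 by exact: normr_ge0.
  by rewrite !addr_ge0 ?normH_ge0 // divr_ge0 ?normr_ge0 // ltW.
exists c => t; have [t0|t0] := leP 0 t.
  rewrite normH_sub LPE.
  have -> : (Z t).2 = SB t (zeta.2 + prim (pull SB (gz Z)) t).
    by rewrite -[in LHS](hZ t) /= (max_idPr t0).
  rewrite subrr normr0 addr0 forward_Z1 // -[(lyapunov_perron Z t).1]/(convinf _ _ _ _).
  have q0 : 0 <= t / eps by rewrite divr_ge0 // ltW.
  have -> : convinf SA eps (forcing Z) t =
      SA (t / eps) (convinf SA eps (forcing Z) 0) + convA SA eps (forcing Z) 0 t.
    have := convinf_cocycle hSA eps0 gamma10 SAdecay lamA cf (tail_forcing nZ) t0.
    by rewrite subr0.
  rewrite opprD addrACA subrr addr0 -(semigroupB hSA) //.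
  rewrite (le_trans (SAdecay _ q0)) // mulrC ler_pM ?expR_ge0 //; first by rewrite lerDl.
  rewrite ler_expR !mulNr lerN2 (_ : gamma1 * (t / eps) = gamma1 / eps * t).
    by rewrite ler_wpM2r // ltW.
  by rewrite mulrA mulrAC.
have Zneg r : r <= 0 -> Z r = zeta.
  by move=> r0; rewrite -hZ -forward_max0 hZ (max_idPl r0) Z_0.
have e1 r : r <= 0 -> 1 <= expR (- lam * r).
  by move=> r0; rewrite -expR0 ler_expR mulNr oppr_ge0 mulr_ge0_le0 // ltW.
have h1 : `|convinf SA eps (forcing Z) t| <= C / (gamma1 / eps - lam) * expR (- lam * t).
  apply: (convinf_bound hSA eps0 gamma10 SAdecay lamA cf (tail_forcing nZ)) => r rt.
  by apply: hC; rewrite (le_trans rt) // ltW.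
have h2 : `|SB t zeta.2| <= `|zeta.2| * expR (- lam * t).
  rewrite (le_trans (SBdecay _ (ltW t0))) // mulrC ler_wpM2l // ler_expR.
  by rewrite !mulNr lerN2 ler_wnM2r // ltW.
have h3 : `|SB t (prim (pull SB (gz Z)) t)| <= C2 / (lam - gamma2) * expR (- lam * t).
  have := @pull_bound _ _ _ _ hSB SBdecay _ lamg (gz Z) C2 t t 0 (gz_continuous cZ)
    (lexx t) (ltW t0).
  rewrite prim0 sub0r -[- prim _ _]scaleN1r (groupZ hSB) scaleN1r normrN -expRD.
  rewrite (_ : - gamma2 * t + - (lam - gamma2) * t = - lam * t); last by ring.
  by apply=> r _ r0; rewrite /gz Zneg // -[leLHS]mulr1 ler_wpM2l // e1.
have h4 : normH (Z t) <= normH zeta * expR (- lam * t).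
  by rewrite (Zneg _ (ltW t0)) -[leLHS]mulr1 ler_wpM2l ?normH_ge0 ?(e1 _ (ltW t0)).
rewrite (le_trans (normHD _ _)) // normHN.
have h5 : normH (lyapunov_perron Z t) <= C / (gamma1 / eps - lam) * expR (- lam * t) +
    (`|zeta.2| * expR (- lam * t) + C2 / (lam - gamma2) * expR (- lam * t)).
  rewrite /normH LPE (groupD hSB) lerD //.
  by rewrite (le_trans (ler_normD _ _)) // lerD.
have h6 : 0 <= a * expR (- lam * t) by rewrite mulr_ge0 ?expR_ge0.
by apply: le_trans (lerD h5 h4) _; rewrite /c !mulrDl -[leLHS]add0r lerD.
Qed.

Lemma lyapunov_perron_fixpoint :
  exists z, [/\ continuous z, near_Z z & forall t, lyapunov_perron z t = z t].
Proof.
have wtE (x y e : R) : (expR (lam * e) * x <= y) = (x <= y * expR (- lam * e)).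
  by rewrite mulNr expRN ler_pdivlMr ?expR_gt0 // mulrC.
have kappa0 : 0 <= kappa.
  rewrite addr_ge0 // divr_ge0 ?subr_ge0 //; try exact: ltW; move: K0 rhoK; lra.
have nearP z : (forall i : unit, exists c, forall t, [set: R] t ->
    expR (lam * t) * normH (z t - Z t) <= c) -> near_Z z.
  by move=> /(_ tt)[c hc]; exists c => t; rewrite -wtE hc.
have [] := @picard R H1 H2 unit (fun=> setT) (fun _ t => expR (lam * t))
  (fun=> kappa) lyapunov_perron Z.
- by move=> t; exists tt; exact: filterT.
- by move=> _ t; exact: expR_gt0.
- move=> _ t; apply: continuous_comp; last exact: continuous_expR.
  by apply: cvgM; [exact: cvg_cst|exact: cvg_id].
- by [].
- by [].
- exact: cZ.
- move=> z [cz /nearP nz]; apply: pair_continuous.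
    exact: (convinf_continuous hSA eps0 gamma10 SAdecay lamA (forcing_continuous cz)
      (tail_forcing nz)).
  apply: (group_continuous hSB) => r; first exact: cvg_id.
  apply: cvgB.
    apply: cvgD; first exact: cvg_cst.
    by apply: prim_continuous; exact: (pull_continuous hSB (gz_continuous cZ)).
  exact: (tailB_continuous hSB (gdiff_continuous cz)).
- move=> z z' _ c [cz /nearP nz] [cz' /nearP nz'] h t _.
  by apply: lyapunov_perron_contraction => // s; exact: h.
- by move=> _; have [c hc] := lyapunov_perron_start; exists c => t _; rewrite wtE.
move=> z [cz /nearP nz] hz; exists z; split => //.
Qed.

(** On [t >= 0] the difference of the fast components starts from the initial difference, while that
    of the slow ones is a pure integral from +oo. The weighted distance therefore satisfies [om <=
    normH (zeta - z 0) + kappa * sup om]. *)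
Lemma lyapunov_perron_tracking z : continuous z -> near_Z z ->
  (forall t, lyapunov_perron z t = z t) -> forall t, 0 <= t ->
  normH (Z t - z t) <= normH (zeta - z 0) / (1 - kappa) * expR (- lam * t).
Proof.
move=> cz nz hz t t0.
have kappa0 : 0 <= kappa.
  rewrite addr_ge0 // divr_ge0 ?subr_ge0 //; try exact: ltW; move: K0 rhoK; lra.
have wtE (x y e : R) : (expR (lam * e) * x <= y) = (x <= y * expR (- lam * e)).
  by rewrite mulNr expRN ler_pdivlMr ?expR_gt0 // mulrC.
rewrite -wtE.
apply: (@contraction_bound R R [set t | 0 <= t]
    (fun t => expR (lam * t) * normH (Z t - z t))) => //.
  by have [c hc] := nz; exists c => s _; rewrite normHB wtE.
move=> c hc s s0; rewrite wtE normHB normH_sub.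
have {}hc r : 0 <= r -> normH (z r - Z r) <= c * expR (- lam * r).
  by move=> r0; rewrite -wtE normHB; exact: hc.
have q0 : 0 <= s / eps by rewrite divr_ge0 // ltW.
have ei0 : 0 < eps^-1 by rewrite invr_gt0.
have c0 : 0 <= c.
  by have := le_trans (normH_ge0 _) (hc 0 (lexx 0)); rewrite pmulr_lge0 ?expR_gt0.
have cD : continuous (fun r => fz z r - fz Z r).
  by move=> r; apply: cvgB; exact: fz_continuous.
have -> : (z s).1 - (Z s).1 = SA (s / eps) ((z 0).1 - zeta.1) +
    eps^-1 *: convA SA eps (fun r => fz z r - fz Z r) 0 s.
  rewrite forward_Z1 // -[in LHS](hz s) -[in RHS](hz 0) /=.
  have -> : convinf SA eps (forcing z) s =
      SA (s / eps) (convinf SA eps (forcing z) 0) + convA SA eps (forcing z) 0 s.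
    have := convinf_cocycle hSA eps0 gamma10 SAdecay lamA (forcing_continuous cz)
      (tail_forcing nz) s0.
    by rewrite subr0.
  have -> : eps^-1 *: convA SA eps (fun r => fz z r - fz Z r) 0 s =
      convA SA eps (forcing z) 0 s - convA SA eps (forcing Z) 0 s.
    rewrite -(convAZ hSA eps0 gamma10 SAdecay _ cD s0).
    rewrite -(convAB hSA eps0 gamma10 SAdecay (forcing_continuous cz) (forcing_continuous cZ) s0).
    by congr (convA _ _ _ _ _); apply/funext => r; rewrite forcing_diff.
  by rewrite (semigroupB hSA) // opprD addrACA.
have -> : (z s).2 - (Z s).2 = - SB s (tailB SB (gdiff z) s).
  rewrite -[in LHS](hz s) -[in LHS](hZ s) /= (max_idPr s0) (groupB hSB).
  by rewrite addrAC subrr add0r.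
have h1 : `|convA SA eps (fun r => fz z r - fz Z r) 0 s| <=
    K * c / (gamma1 / eps - lam) * expR (- lam * s).
  apply: (convA_expbound hSA eps0 gamma10 SAdecay lamA cD s0) => r r0 rs.
  by rewrite (le_trans (hfK _ _)) // -mulrA ler_pM2l // hc.
have h2 : `|SB s (tailB SB (gdiff z) s)| <= K * c / (lam - gamma2) * expR (- lam * s).
  apply: (tailB_bound hSB SBdecay lamg (gdiff_continuous cz) (decay_gdiff nz)) => r rs.
  by rewrite (le_trans (hgK _ _)) // -mulrA ler_pM2l // hc // (le_trans s0).
have h3 : `|SA (s / eps) ((z 0).1 - zeta.1)| <= normH (zeta - z 0) * expR (- lam * s).
  rewrite (le_trans (SAdecay _ q0)) // mulrC ler_pM ?expR_ge0 //.
    by rewrite normHB /normH lerDl.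
  rewrite ler_expR !mulNr lerN2 (_ : gamma1 * (s / eps) = gamma1 / eps * s).
    by rewrite ler_wpM2r // ltW.
  by rewrite mulrA mulrAC.
rewrite normrN mulrDl (le_trans (lerD (ler_normD _ _) h2)) // normrZ (gtr0_norm ei0).
have h4 : eps^-1 * `|convA SA eps (fun r => fz z r - fz Z r) 0 s| <=
    K / (gamma1 - rho) * c * expR (- lam * s).
  by rewrite -rateA -mulrA -[leRHS]mulrA ler_pM2l // mulrA.
have -> : normH (zeta - z 0) * expR (- lam * s) + kappa * c * expR (- lam * s) =
    normH (zeta - z 0) * expR (- lam * s) + K / (gamma1 - rho) * c * expR (- lam * s) +
    K * c / (lam - gamma2) * expR (- lam * s).
  by rewrite /kappa; ring.
by rewrite lerD2r lerD.
Qed.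

End FullLine.

End SlowFast.

(** * The Ornstein-Uhlenbeck process *)

Section RealPrimitive.
Context {R : realType}.

Lemma prim_is_derive (phi : R -> R^o) (x : R) : continuous phi ->
  is_derive x (1 : R) (prim phi : R -> R) (phi x).
Proof.
move=> cphi.
have h : (fun h : R => h^-1 *: (prim phi (h *: 1 + x) - prim phi x)) @ 0^' --> (phi x : R^o).
  apply/cvgrPdist_le => e e0.
  have /continuous_epsdelta/(_ _ e0)[d d0 hd] := cphi x.
  exists d => //= k /=; rewrite sub0r normrN => kd k0.
  rewrite [k *: 1]mulr1 distrC -(ler_pM2l (x := `|k|)) ?normr_gt0 //.
  rewrite -normrM mulrBr mulrA mulfV // mul1r.
  move: kd; rewrite ltr_norml => /andP[kd1 kd2].
  have [k1|k1] := leP 0 k.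
    have xk : x <= k + x by rewrite lerDr.
    have := is_RSint_near_cst xk (primP cphi xk) (v := phi x) (e := e).
    rewrite addrK (ger0_norm k1); apply => s xs sk.
    by rewrite distrC ltW // hd // ltr_norml; apply/andP; split; lra.
  have xk : k + x <= x by rewrite gerDr ltW.
  have := is_RSint_near_cst xk (primP cphi xk) (v := phi x) (e := e).
  have -> : x - (k + x) = - k by ring.
  rewrite (ltr0_norm k1) -normrN => hk.
  rewrite [X in `|X| <= _](_ : _ =
      - (prim phi x - prim phi (k + x) - - k *: phi x)); last first.
    by rewrite /GRing.scale /=; ring.
  apply: hk => s xs sk.
  by rewrite distrC ltW // hd // ltr_norml; apply/andP; split; lra.
have dv : derivable (prim phi : R -> R^o) x 1 by apply/cvg_ex; exists (phi x).
by apply: DeriveDef => //; exact: (cvg_lim _ h).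
Qed.

End RealPrimitive.

Section OrnsteinUhlenbeck.
Context {R : realType} (mu : R) (mu0 : 0 < mu) (w : wpath R).

(** The scalar semigroup with decay rate 1; with [mu] in the place of [eps], the convolution theory
    above applies to the Ornstein-Uhlenbeck kernel. *)
Definition expS (t : R) (x : R^o) : R^o := expR (- t) * x.

Lemma expS_semigroup : C0_semigroup expS.
Proof.
split.
- move=> t _; split=> [k x y|x]; first by rewrite /expS /GRing.scale /=; ring.
  by apply: cvgM; [exact: cvg_cst|exact: cvg_id].
- by move=> x; rewrite /expS oppr0 expR0 mul1r.
- by move=> s t x _ _; rewrite /expS opprD expRD mulrA.
- move=> x; have h : expS t x @[t --> (0 : R)] --> expS 0 x.
    apply: cvgM; last exact: cvg_cst.
    apply: continuous_comp; last exact: continuous_expR.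
    by apply: cvgN; exact: cvg_id.
  apply: cvg_at_right_filter.
  by move: h; rewrite {2}/expS oppr0 expR0 mul1r.
Qed.

Lemma expS_decay t (x : R^o) : 0 <= t -> `|expS t x| <= expR (- 1 * t) * `|x|.
Proof. by move=> _; rewrite /expS normrM mulN1r ger0_norm ?expR_ge0. Qed.

(** Half of the decay rate [1 / mu] of the kernel: positive, and with a gap left. *)
Let lam := (2 * mu)^-1.
Let lam0 : 0 < lam. Proof. by rewrite invr_gt0 mulr_gt0. Qed.
Let lam_lt : lam < 1 / mu.
Proof. by rewrite /lam div1r ltf_pV2 ?posrE ?mulr_gt0 //; move: mu0; lra. Qed.

(** [mu^-1 * OUmean t] is the exponentially weighted average of the past of the path, and mu z^mu_t
    is the deviation of [w t] from it. *)
Definition OUmean (t : R) : R := convinf expS mu (w : R -> R^o) t.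

Hypothesis hw : forall T, exists C, forall r, r <= T -> `|w r| <= C * expR (- lam * r).

Let cw : continuous (w : R -> R^o) := @wpath_continuous _ w.
Let tw : tail_bounded lam (w : R -> R^o) := hw.

Lemma OUmean_continuous : continuous OUmean.
Proof.
exact: (convinf_continuous expS_semigroup mu0 ler01 expS_decay lam_lt cw tw).
Qed.

Lemma exp_RSint (h : R -> R^o) a t : continuous h -> a <= t ->
  is_RSint (fun s => expR (- (t - s) / mu) : R^o) h a t
    (h t - h a * expR (- (t - a) / mu) - mu^-1 * convA expS mu h a t).
Proof.
move=> ch at_; pose phi s : R^o := expR (- (t - s) / mu).
pose dphi s : R^o := phi s / mu.
have cphi : continuous phi.
  move=> s; apply: continuous_comp; last exact: continuous_expR.
  apply: cvgM; last exact: cvg_cst.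
  by apply: cvgN; apply: cvgB; [exact: cvg_cst|exact: cvg_id].
have cdphi : continuous dphi by move=> s; apply: cvgM; [exact: cphi|exact: cvg_cst].
have phiE s : phi s = expR (- (t / mu)) * expR (mu^-1 * s).
  by rewrite /phi -expRD; congr expR; ring.
have mi0 : mu^-1 != 0 by rewrite invr_eq0 gt_eqF.
have hphi s r : s <= r -> is_RSint dphi id s r (phi r - phi s).
  move=> sr; have := is_RSintZ (V := R^o) (expR (- (t / mu)) / mu) (expR_RSint sr mi0).
  rewrite (_ : _ *: _ = phi r - phi s).
    by apply: eq_is_RSint => x _ _; rewrite /dphi phiE /GRing.scale /=; ring.
  by rewrite !phiE /GRing.scale /=; field; rewrite gt_eqF.
have := @is_RSint_by_parts R R^o h phi dphi a t at_ ch cdphi (fun s r _ sr _ => hphi s r sr).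
congr is_RSint; rewrite /GRing.scale /= {1}/phi subrr oppr0 mul0r expR0 mulr1.
congr (_ - _).
have cwd : continuous (fun s => h s *: dphi s).
  by move=> s; apply: cvgZ; [exact: ch|exact: cdphi].
apply: (is_RSint_unique at_ (primP cwd at_)).
have := is_RSintZ mu^-1 (convAP expS_semigroup mu0 ler01 expS_decay ch at_).
apply: eq_is_RSint => s _ _; rewrite /expS /dphi /phi /GRing.scale /=.
by rewrite mulNr; ring.
Qed.

(** In the integration by parts, the boundary term at [a] vanishes because the kernel decays at rate
    [2 * lam] and [h] grows at rate at most [lam]. *)
Lemma exp_RSint_lim (h : R -> R^o) t : continuous h -> tail_bounded lam h ->
  lim (RSint (fun s => expR (- (t - s) / mu) : R^o) h a t @[a --> -oo]) =
  h t - mu^-1 * convinf expS mu h t.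
Proof.
move=> ch th; apply: cvg_lim => //.
have cv := convinf_cvg_noo expS_semigroup mu0 ler01 expS_decay lam_lt ch th (t := t).
have h0 : h a * expR (- (t - a) / mu) @[a --> -oo] --> (0 : R).
  have [C hC] := th t; pose D := `|C| * expR (- (t / mu)) + 1.
  have D0 : 0 < D by rewrite ltr_wpDl // mulr_ge0 ?expR_ge0.
  apply/cvgrPdist_le => e e0.
  exists (Num.min t (ln (e / D) / lam)); split; first exact: num_real.
  move=> a; rewrite lt_min => /andP[at_].
  rewrite ltr_pdivlMr // -ltr_expR lnK ?posrE ?divr_gt0 // ltr_pdivlMr // => hD.
  rewrite sub0r normrN normrM [X in _ * X]ger0_norm ?expR_ge0 //.
  apply: le_trans (ler_wpM2r (expR_ge0 _) (hC a (ltW at_))) _.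
  apply: le_trans (ltW hD).
  have -> : expR (- (t - a) / mu) = expR (- (t / mu)) * expR (2 * lam * a).
    by rewrite -expRD; congr expR; rewrite /lam; field; rewrite gt_eqF.
  have -> : C * expR (- lam * a) * (expR (- (t / mu)) * expR (2 * lam * a)) =
      expR (a * lam) * (C * expR (- (t / mu))).
    have -> : expR (a * lam) = expR (- lam * a) * expR (2 * lam * a).
      by rewrite -expRD; congr expR; ring.
    by ring.
  rewrite ler_pM2l ?expR_gt0 // /D (le_trans (y := `|C| * expR (- (t / mu)))) ?lerDl //.
  by rewrite ler_wpM2r ?expR_ge0 ?ler_norm.
apply: (@cvg_trans _ ((h t - h a * expR (- (t - a) / mu) - mu^-1 * convA expS mu h a t) @[a --> -oo])).
  apply: near_eq_cvg; exists t; split; first exact: num_real.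
  by move=> a /ltW at_; rewrite (RSint_eq at_ (exp_RSint ch at_)).
apply: cvgB; last by apply: cvgM; [exact: cvg_cst|exact: cv].
by rewrite -[X in _ --> X]subr0; apply: cvgB; [exact: cvg_cst|exact: h0].
Qed.

Lemma OU_eq t : OU mu w t = mu^-1 * (w t - mu^-1 * OUmean t).
Proof. by rewrite /OU exp_RSint_lim. Qed.

Lemma OU_continuous : continuous (OU mu w).
Proof.
rewrite (_ : OU mu w = fun t => mu^-1 * (w t - mu^-1 * OUmean t)); last first.
  by apply/funext => t; exact: OU_eq.
move=> t; apply: cvgM; first exact: cvg_cst.
apply: cvgB; first exact: cw.
by apply: cvgM; [exact: cvg_cst|exact: OUmean_continuous].
Qed.

(** Phi^mu in closed form: m = [OUmean] solves m' = w - m / mu, whose right-hand side is mu z^mu. *)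
Definition OUint (t : R) : R := mu^-1 * (OUmean t - OUmean 0).

Lemma OUint_continuous : continuous OUint.
Proof.
move=> t; apply: cvgM; first exact: cvg_cst.
by apply: cvgB; [exact: OUmean_continuous|exact: cvg_cst].
Qed.

Lemma OUint_RSint s t : 0 <= s -> s <= t ->
  is_RSint (OU mu w : R -> R^o) id s t (OUint t - OUint s).
Proof.
move=> s0 st.
pose G := prim (fun s => expR (s / mu) * w s : R^o).
have cG : continuous (fun s : R => expR (s / mu) * w s : R^o).
  move=> r; apply: cvgM; last exact: cw.
  apply: continuous_comp; last exact: continuous_expR.
  by apply: cvgM; [exact: cvg_id|exact: cvg_cst].
(* Variation of constants from time 0: differentiable on the whole line and equal to [OUmean] on
   [[0, oo[]. *)
pose Q t := expR (- mu^-1 * t) * (OUmean 0 + G t).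
have QE r : 0 <= r -> OUmean r = Q r.
  move=> r0.
  have -> : OUmean r = expS ((r - 0) / mu) (OUmean 0) + convA expS mu (w : R -> R^o) 0 r.
    exact: (convinf_cocycle expS_semigroup mu0 ler01 expS_decay lam_lt cw tw r0).
  rewrite /Q mulrDr subr0 /expS mulNr [mu^-1 * r]mulrC; congr (_ + _).
  apply: (RSint_eq r0).
  have hG := primP cG r0; rewrite prim0 subr0 in hG.
  apply: eq_is_RSint (is_RSintZ (V := R^o) (expR (- (r / mu))) hG) => x _ _; rewrite /GRing.scale /= mulrA -expRD.
  by congr (expR _ * _); ring.
have dQ x : is_derive x (1 : R) Q (w x - mu^-1 * Q x).
  have h1 : is_derive x (1 : R) (fun s : R => - mu^-1 * s) (- mu^-1).
    by apply: is_derive_eq; rewrite /GRing.scale /=; ring.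
  have h2 := is_derive1_comp (is_derive_expR (- mu^-1 * x)) h1.
  have h3 : is_derive x (1 : R) (G : R -> R) (expR (x / mu) * w x) := prim_is_derive x cG.
  have h4 : is_derive x (1 : R) (fun t : R => OUmean 0 + G t) (expR (x / mu) * w x).
    by apply: is_derive_eq (is_deriveD (is_derive_cst (OUmean 0) x 1) h3) _; rewrite add0r.
  have := is_deriveM h2 h4.
  have -> : (expR \o *%R (- mu^-1)) * (fun t : R => OUmean 0 + G t) = Q by [].
  move=> h; apply: is_derive_eq h _.
  rewrite /GRing.scale /= /Q mulrA -expRD (_ : _ + x / mu = 0) ?expR0; last by ring.
  by ring.
have cQ : continuous Q.
  by move=> x; apply: differentiable_continuous; apply/derivable1_diffP; case: (dQ x).
have := is_RSintZ (V := R^o) mu^-1 (derivative_RSint st dQ _).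
rewrite /OUint (QE 0) // (QE s) // (QE t) ?(le_trans s0) //.
rewrite (_ : mu^-1 *: _ = mu^-1 * (Q t - Q 0) - mu^-1 * (Q s - Q 0)); last first.
  by rewrite /GRing.scale /=; ring.
move=> h; apply: eq_is_RSint (h _).
  by move=> r sr rt; rewrite OU_eq QE // (le_trans s0).
move=> x; apply: cvgB; first exact: cw.
by apply: cvgM; [exact: cvg_cst|exact: cQ].
Qed.

(** The Langevin equation mu dz = dB - z dt, integrated from 0 to [t]. *)
Lemma OUint_diff t : w t - OUint t = mu * OU mu w t - mu * OU mu w 0.
Proof. by rewrite !OU_eq wpath0 /OUint; field; rewrite gt_eqF. Qed.

(** mu z^mu_t averages the increments [w t - w s] with the weight [expR (- (t - s) / mu) / mu]. With
    x = (t - s) / (2 mu) one has 1 + 2x <= 2 e^x, and the average of e^x is 2; hence the 4. *)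
Lemma OU_bound t C : 0 <= C ->
  (forall s, s <= t -> `|w t - w s| <= C * (1 + (t - s) / mu)) ->
  `|mu * OU mu w t| <= 4 * C.
Proof.
move=> C0 hC; pose h s : R^o := w s - w t.
have ch : continuous h by move=> s; apply: cvgB; [exact: cw|exact: cvg_cst].
have hb s : s <= t -> `|h s| <= 2 * C * expR (lam * t) * expR (- lam * s).
  move=> st; rewrite distrC (le_trans (hC s st)) // -mulrA -expRD [2 * C]mulrC -mulrA.
  rewrite ler_wpM2l // (_ : lam * t + - lam * s = lam * (t - s)); last by ring.
  have x0 : 0 <= lam * (t - s) by rewrite mulr_ge0 ?subr_ge0 // ltW.
  have -> : (t - s) / mu = 2 * (lam * (t - s)).
    by rewrite /lam; field; rewrite gt_eqF.
  have := expR_ge1Dx (lam * (t - s)); lra.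
have th : tail_bounded lam h.
  move=> T; have [C1 h1] := hw T; exists (C1 + `|w t| * expR (lam * T)) => r rT.
  rewrite (le_trans (ler_normB _ _)) // mulrDl lerD ?h1 // -mulrA -expRD.
  rewrite -[leLHS]mulr1 ler_wpM2l // -expR0 ler_expR mulNr -mulrBr mulr_ge0 ?subr_ge0 //.
  exact: ltW.
(* Stieltjes sums see only increments, so the path may be shifted by its value at [t]; then the term
   [h t] vanishes. *)
have hwE : (fun a => RSint (fun s => expR (- (t - s) / mu) : R^o) w a t) =
    (fun a => RSint (fun s => expR (- (t - s) / mu) : R^o) h a t).
  apply/funext => a; rewrite /RSint; congr xget.
  have e (p : nat -> R) i : h (p i.+1) - h (p i) = w (p i.+1) - w (p i) by rewrite /h; ring.
  apply/seteqP; split => I hI e0 e00; have [d d0 hd] := hI _ e00; exists d => // n p tag p0 pn hp.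
    under eq_bigr do rewrite e.
    exact: hd.
  have := hd n p tag p0 pn hp; under eq_bigr do rewrite e.
  by [].
have -> : OU mu w t = mu^-1 * (h t - mu^-1 * convinf expS mu h t).
  by rewrite /OU hwE exp_RSint_lim.
rewrite mulrA mulfV ?gt_eqF // mul1r {1}/h subrr sub0r normrN normrM gtr0_norm ?invr_gt0 //.
have := convinf_bound expS_semigroup mu0 ler01 expS_decay lam_lt ch th hb.
move=> hc; rewrite mulrC ler_pdivrMr //; apply: le_trans hc _.
rewrite mulNr expRN le_eqVlt; apply/orP; left; apply/eqP.
by rewrite /lam; field; rewrite !gt_eqF ?expR_gt0.
Qed.

End OrnsteinUhlenbeck.

(** * Noise in the domain of the generator *)

Section Noise.
Context {R : realType} {V : completeNormedModType R} (S : R -> V -> V) (eps gam : R).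
Hypotheses (hS : C0_semigroup S) (eps0 : 0 < eps) (gam0 : 0 <= gam).
Hypothesis Sdecay : forall t x, 0 <= t -> `|S t x| <= expR (- gam * t) * `|x|.
Variables (D : set V) (A : V -> V) (sigma : V).
Hypotheses (hA : is_generator 0^'+ D A S) (hsigma : D sigma).
Implicit Types h : R -> R.

Lemma generator_expansion e : 0 < e -> exists2 d, 0 < d & forall t, 0 <= t -> t < d ->
  `|S t sigma - sigma - t *: A sigma| <= e * t.
Proof.
move=> e0; have /cvgrPdist_le/(_ _ e0)[d /= d0 hd] := (hA sigma (A sigma)).1 (conj hsigma erefl).
exists d => // t; rewrite le_eqVlt => /predU1P[<- _|t0 td].
  by rewrite (semigroup_at0 hS) subrr scale0r subrr normr0 mulr0.
have := hd t; rewrite /= sub0r normrN gtr0_norm // => /(_ td t0).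
have -> : S t sigma - sigma - t *: A sigma = - (t *: (A sigma - t^-1 *: (S t sigma - sigma))).
  by rewrite scalerBr scalerA mulfV ?gt_eqF // scale1r opprB.
by rewrite normrN normrZ gtr0_norm // mulrC ler_pM2r.
Qed.

Let SE (t x : R) := semigroup_ext S ((t - x) / eps).

Let SE_E t x : x <= t -> SE t x = S ((t - x) / eps).
Proof.
by move=> xt; rewrite /SE /semigroup_ext (max_idPl _) // divr_ge0 ?subr_ge0 // ltW.
Qed.

Let affine_continuous (t : R) : continuous (fun x : R => (t - x) / eps).
Proof.
by move=> x; apply: cvgM; [apply: cvgB; [exact: cvg_cst|exact: cvg_id]|exact: cvg_cst].
Qed.

Let SE_continuous (t : R) (u : V) : continuous (fun x : R => SE t x u).
Proof.
apply: (semigroup_ext_continuous hS gam0 Sdecay (F := fun=> u)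
  (tau := fun x => (t - x) / eps)); last by move=> x; exact: cvg_cst.
exact: affine_continuous.
Qed.

(** Factoring out the semigroup at the right end of a cell moves the question to time 0. There the
    expansion of the orbit of [sigma] by the generator and the continuity of the orbit of [A sigma]
    give the cell estimate. *)
Lemma orbit_RSint s r t : s <= r -> r <= t ->
  is_RSint (fun x => - eps^-1 *: SE t x (A sigma)) id s r (SE t r sigma - SE t s sigma).
Proof.
move=> sr rt; apply: (cell_estimate_RSint (F := fun x => SE t x sigma)) => // e e0.
have e2 : 0 < e * eps / 2 by rewrite divr_gt0 ?mulr_gt0.
have [d1 d10 hd1] := generator_expansion e2.
have [d2 d20 hd2] := semigroup_near0 hS (A sigma) e2.
exists (Num.min d1 d2 * eps); first by rewrite mulr_gt0 // lt_min d10.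
move=> s' x t' ss' s'x xt' tr' ts'.
have t't := le_trans tr' rt; have xt := le_trans xt' t't; have s't := le_trans s'x xt.
rewrite !SE_E //; set q := (t - t') / eps; set k := (t' - x) / eps.
pose h := (t' - s') / eps.
have ltd y : s' <= y -> y <= t' -> [/\ 0 <= (t' - y) / eps, (t' - y) / eps < d1 & (t' - y) / eps < d2].
  move=> s'y yt'; split; first by rewrite divr_ge0 ?subr_ge0 // ltW.
    rewrite ltr_pdivrMr // (le_lt_trans (y := t' - s')) ?lerB //.
    by rewrite (lt_le_trans ts') // ler_pM2r // ge_min lexx.
  rewrite ltr_pdivrMr // (le_lt_trans (y := t' - s')) ?lerB //.
  by rewrite (lt_le_trans ts') // ler_pM2r // ge_min lexx orbT.
have [h0 h1 _] := ltd s' (lexx s') (le_trans s'x xt'); rewrite -/h in h0 h1.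
have [k0 _ k2] := ltd x s'x xt'; rewrite -/k in k0 k2.
have q0 : 0 <= q by rewrite divr_ge0 ?subr_ge0 // ltW.
have -> : (t - s') / eps = q + h by rewrite /q /h -mulrDl subrKA.
have -> : (t - x) / eps = q + k by rewrite /q /k -mulrDl subrKA.
rewrite !(semigroup_compose hS) //.
have -> : S q sigma - S q (S h sigma) - (t' - s') *: (- eps^-1 *: S q (S k (A sigma))) =
    S q (h *: (S k (A sigma) - A sigma) - (S h sigma - sigma - h *: A sigma)).
  rewrite !(semigroupB hS) // !(semigroupZ hS gam0 Sdecay) // !(semigroupB hS) //.
  by rewrite /h; lmod R V.
rewrite (le_trans (semigroup_contract gam0 Sdecay _ q0)) //.
rewrite (le_trans (ler_normB _ _)) // normrZ ger0_norm //.
have -> : e * (t' - s') = h * (e * eps / 2) + e * eps / 2 * h.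
  by rewrite /h; field; rewrite gt_eqF.
by rewrite lerD ?hd1 // ler_wpM2l // ltW // hd2.
Qed.

Lemma noise_by_parts h s t : continuous h -> s <= t ->
  is_RSint (fun r => S ((t - r) / eps) sigma) h s t
    (h t *: sigma - h s *: S ((t - s) / eps) sigma +
     eps^-1 *: convA S eps (fun r => h r *: A sigma) s t).
Proof.
move=> ch st.
have chA : continuous (fun r => h r *: A sigma) by move=> r; apply: cvgZr_tmp; exact: ch.
have cd : continuous (fun x => - eps^-1 *: SE t x (A sigma)).
  by move=> x; apply: cvgZ; [exact: cvg_cst|exact: SE_continuous].
have := is_RSint_by_parts st ch cd (fun s' r _ s'r rt => orbit_RSint s'r rt).
rewrite !SE_E // subrr mul0r (semigroup_at0 hS) => hI.
apply: (eq_is_RSint (phi := fun r => SE t r sigma)) => [r _ rt|]; first by rewrite SE_E.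
suff e : prim (fun x => h x *: (- eps^-1 *: SE t x (A sigma))) t -
         prim (fun x => h x *: (- eps^-1 *: SE t x (A sigma))) s =
         - eps^-1 *: convA S eps (fun r => h r *: A sigma) s t.
  by move: hI; rewrite e scaleNr opprK.
have chd : continuous (fun x => h x *: (- eps^-1 *: SE t x (A sigma))).
  by move=> x; apply: cvgZ; [exact: ch|exact: cd].
apply: (is_RSint_unique st (primP chd st)).
apply: eq_is_RSint (is_RSintZ (- eps^-1) (convAP hS eps0 gam0 Sdecay chA st)) => r sr rt.
rewrite SE_E // (semigroupZ hS gam0 Sdecay) ?divr_ge0 ?subr_ge0 // 1?ltW //.
by rewrite !scalerA mulrC.
Qed.

(** For a continuous path with [h 0 = 0], the integral over [[0, t]] of the semigroup applied to
    [sigma] against dh, after integration by parts. It depends on values of [h] and not on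
    increments, hence continuously in the sup norm. *)
Definition noise_conv h t := h t *: sigma + eps^-1 *: convA S eps (fun r => h r *: A sigma) 0 t.

Lemma noise_conv0 h : h 0 = 0 -> noise_conv h 0 = 0.
Proof. by move=> h0; rewrite /noise_conv h0 scale0r convA_refl scaler0 addr0. Qed.

Let hA_continuous h : continuous h -> continuous (fun r => h r *: A sigma).
Proof. by move=> ch r; apply: cvgZr_tmp; exact: ch. Qed.

Lemma noise_conv_continuous h : continuous h ->
  continuous (fun t : R => noise_conv h (Num.max 0 t)).
Proof.
move=> ch t; apply: cvgD.
  apply: cvgZr_tmp; apply: continuous_comp; first exact: max0_continuous.
  exact: ch.
apply: cvgZ; first exact: cvg_cst.
exact: (convA_continuous hS eps0 gam0 Sdecay (hA_continuous ch) (a := 0)).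
Qed.

Lemma noise_conv_RSint h s t : continuous h -> 0 <= s -> s <= t ->
  is_RSint (fun r => S ((t - r) / eps) sigma) h s t
    (noise_conv h t - S ((t - s) / eps) (noise_conv h s)).
Proof.
move=> ch s0 st; have q0 : 0 <= (t - s) / eps by rewrite divr_ge0 ?subr_ge0 // ltW.
have := noise_by_parts ch st; congr is_RSint.
rewrite /noise_conv (semigroupD hS) // !(semigroupZ hS gam0 Sdecay) //.
have -> : convA S eps (fun r => h r *: A sigma) 0 t =
    S ((t - s) / eps) (convA S eps (fun r => h r *: A sigma) 0 s) +
    convA S eps (fun r => h r *: A sigma) s t.
  exact: (convA_chasles hS eps0 gam0 Sdecay (hA_continuous ch) s0 st).
set X := S ((t - s) / eps) sigma.
by lmod R V.
Qed.

(** Brings the Wong-Zakai noise, given by its density, into the same form as the Brownian noise, so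
    that the two can be compared path against path. *)
Lemma noise_conv_density W om t : continuous W -> continuous om -> W 0 = 0 ->
  (forall s t, 0 <= s -> s <= t -> is_RSint (om : R -> R^o) id s t (W t - W s)) ->
  0 <= t -> convA S eps (fun r => om r *: sigma) 0 t = noise_conv W t.
Proof.
move=> cW co W0 hW t0; apply: (RSint_eq t0).
have := noise_conv_RSint cW (lexx 0) t0.
have q0 : 0 <= t / eps by rewrite divr_ge0 // ltW.
rewrite noise_conv0 // subr0 (semigroup0 gam0 Sdecay q0) subr0 => hI.
apply: (@eq_is_RSint _ _ (fun r => om r *: SE t r sigma)) => [r r0 rt|].
  by rewrite SE_E // (semigroupZ hS gam0 Sdecay) // divr_ge0 ?subr_ge0 // ltW.
have hI' : is_RSint (fun r => SE t r sigma) W 0 t (noise_conv W t).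
  by apply: eq_is_RSint hI => r r0 rt; rewrite SE_E.
exact: (is_RSint_density t0 co (@SE_continuous t sigma) (fun s r s0 sr _ => hW s r s0 sr) hI').
Qed.

Lemma noise_conv_dist h h' a T t : continuous h -> continuous h' -> 0 <= t -> t <= T ->
  (forall s, 0 <= s -> s <= T -> `|h s - h' s| <= a) ->
  `|noise_conv h t - noise_conv h' t| <= (`|sigma| + eps^-1 * (T * `|A sigma|)) * a.
Proof.
move=> ch ch' t0 tT ha; have ei0 : 0 < eps^-1 by rewrite invr_gt0.
have -> : noise_conv h t - noise_conv h' t = (h t - h' t) *: sigma +
    eps^-1 *: convA S eps (fun r => h r *: A sigma - h' r *: A sigma) 0 t.
  have -> : convA S eps (fun r => h r *: A sigma - h' r *: A sigma) 0 t =
     convA S eps (fun r => h r *: A sigma) 0 t - convA S eps (fun r => h' r *: A sigma) 0 t.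
    exact: (convAB hS eps0 gam0 Sdecay (hA_continuous ch) (hA_continuous ch') t0).
  by rewrite /noise_conv; lmod R V.
have hc : `|convA S eps (fun r => h r *: A sigma - h' r *: A sigma) 0 t| <=
    (t - 0) * (a * `|A sigma|).
  apply: (convA_bound hS eps0 gam0 Sdecay _ t0) => [|r r0 rt].
    by move=> r; apply: cvgB; exact: hA_continuous.
  by rewrite -scalerBl normrZ ler_wpM2r // ha // (le_trans rt).
rewrite (le_trans (ler_normD _ _)) // mulrDl lerD //.
  by rewrite normrZ mulrC ler_wpM2l // ha.
rewrite normrZ gtr0_norm // -mulrA ler_pM2l // (le_trans hc) // subr0.
rewrite -mulrA [a * _]mulrC ler_wpM2r // mulr_ge0 //.
by rewrite (le_trans _ (ha t t0 tT)).
Qed.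

End Noise.

(** * Hoelder continuity of Brownian paths *)

Lemma powR_exprn {R : realType} (a b : R) n : 0 <= a -> (a ^+ n) `^ b = (a `^ b) ^+ n.
Proof.
by move=> a0; elim: n => [|n IH]; rewrite ?expr0 ?powR1 // !exprS powRM ?IH // exprn_ge0.
Qed.

(** * Dyadic chaining: from grid increments to a modulus of continuity *)

Section Chaining.
Context {R : realType} (u : R -> R) (M r : R).
Hypotheses (cu : continuous u) (r0 : 0 < r) (r1 : r < 1).

Definition dyadic (M : R) (n k : nat) : R := - M + k%:R / 2 ^+ n.

Let pow2_gt0 n : 0 < 2 ^+ n :> R. Proof. by rewrite exprn_gt0. Qed.

Let ix (n : nat) (t : R) := Num.truncn (2 ^+ n * (t + M)).
Let approx n t := dyadic M n (ix n t).

Let ix_itv n t : - M <= t ->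
  (ix n t)%:R <= 2 ^+ n * (t + M) /\ 2 ^+ n * (t + M) < (ix n t).+1%:R.
Proof.
move=> Mt; apply/andP; apply: truncn_itv.
by rewrite mulr_ge0 ?(ltW (pow2_gt0 n)) //; lra.
Qed.

Let approx_near n t : - M <= t -> 0 <= t - approx n t /\ t - approx n t < (2 ^+ n)^-1.
Proof.
move=> Mt; have [h1 h2] := ix_itv n Mt; have p0 := pow2_gt0 n.
rewrite /approx /dyadic; set k := ix n t in h1 h2 *.
have -> : t - (- M + k%:R / 2 ^+ n) = (2 ^+ n * (t + M) - k%:R) / 2 ^+ n.
  by field; rewrite gt_eqF.
split; first by rewrite divr_ge0 ?subr_ge0 // ltW.
rewrite ltr_pdivrMr // mulVf ?gt_eqF //.
by move: h2; rewrite -natr1; lra.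
Qed.

Lemma truncn_half_step (x y : R) : 0 <= x -> x <= y -> y < x + 1 ->
  Num.truncn y = Num.truncn x \/ Num.truncn y = (Num.truncn x).+1.
Proof.
move=> x0 xy yx; have /andP[a1 a2] := truncn_itv x0.
have /andP[b1 b2] := truncn_itv (le_trans x0 xy).
have h1 : (Num.truncn x < (Num.truncn y).+1)%N.
  by rewrite -(ltr_nat R) (le_lt_trans a1) // (le_lt_trans xy).
have h2 : (Num.truncn y < (Num.truncn x).+2)%N.
  rewrite -(ltr_nat R) (le_lt_trans b1) // (lt_trans yx) // -[in ltRHS]natr1.
  by rewrite ltrD2r.
rewrite ltnS leq_eqVlt in h1; case/predU1P: h1 => [->|h1]; first by left.
by right; apply/eqP; rewrite eqn_leq h1 -ltnS h2.
Qed.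

Variable n0 : nat.
Hypothesis hu : forall n k, (n0 <= n)%N -> dyadic M n k.+1 <= M ->
  `|u (dyadic M n k.+1) - u (dyadic M n k)| <= r ^+ n.

Let dyadic_double n k : dyadic M n.+1 (2 * k) = dyadic M n k.
Proof. by rewrite /dyadic natrM exprS; congr (_ + _); field; rewrite gt_eqF. Qed.

Let approx_step n t : (n0 <= n.+1)%N -> - M <= t -> t <= M ->
  `|u (approx n.+1 t) - u (approx n t)| <= r ^+ n.+1.
Proof.
move=> nn Mt tM; have [h1 h2] := ix_itv n Mt; have [h3 h4] := ix_itv n.+1 Mt.
have nM := (approx_near n.+1 Mt).1.
have [e|e] : ix n.+1 t = (2 * ix n t)%N \/ ix n.+1 t = (2 * ix n t).+1.
  have h5 : (2 * ix n t < (ix n.+1 t).+1)%N.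
    rewrite -(ltr_nat R) natrM (le_lt_trans _ h4) // exprS -mulrA ler_wpM2l //.
  have h6 : (ix n.+1 t < (2 * ix n t).+2)%N.
    rewrite -(ltr_nat R) (le_lt_trans h3) // exprS -mulrA.
    rewrite (_ : (2 * ix n t).+2 = (2 * (ix n t).+1)%N); last by rewrite mulnS.
    by rewrite natrM ltr_pM2l.
  rewrite ltnS leq_eqVlt in h5; case/predU1P: h5 => [->|h5]; first by left.
  by right; apply/eqP; rewrite eqn_leq h5 -ltnS h6.
  by rewrite /approx e dyadic_double subrr normr0 exprn_ge0 // ltW.
rewrite /approx e -(dyadic_double n) hu // -e -/(approx n.+1 t).
by rewrite -subr_ge0 (le_trans nM) // lerB.
Qed.

(** Refining the grid once moves the approximation of [t] by at most one cell. The increments form a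
    geometric series, and continuity of [u] closes the gap to [t]. *)
Lemma chaining n t : (n0 <= n)%N -> - M <= t -> t <= M ->
  `|u t - u (approx n t)| <= r ^+ n / (1 - r).
Proof.
move=> nn Mt tM; have r1' : 0 < 1 - r by rewrite subr_gt0.
have hm m : `|u (approx (n + m)%N t) - u (approx n t)| <= (r ^+ n - r ^+ (n + m)) / (1 - r).
  elim: m => [|m IH]; first by rewrite addn0 !subrr normr0 mul0r.
  rewrite addnS -(subrKA (u (approx (n + m)%N t))) (le_trans (ler_normD _ _)) //.
  have := approx_step (n := (n + m)%N) (t := t) (leq_trans nn (leq_trans (leq_addr m n) (leqnSn _))) Mt tM.
  move=> h; apply: le_trans (lerD h IH) _.
  rewrite exprS.
  have -> : (r ^+ n - r * r ^+ (n + m)) / (1 - r) =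
     r ^+ (n + m) + (r ^+ n - r ^+ (n + m)) / (1 - r) by field; rewrite gt_eqF.
  by rewrite lerD2r ler_piMl ?exprn_ge0 // ltW.
apply/ler_addgt0Pr => e e0.
have /continuous_epsdelta/(_ _ e0)[d d0 hd] := cu (x := t).
have [N hN] : exists N, forall m, (N <= m)%N -> (2^-1 : R) ^+ m * 1 < d.
  by apply: geometric_small => //; rewrite invf_lt1 // ltr1n.
pose m := maxn n N; have hd' : `|t - approx m t| < d.
  have [h1 h2] := approx_near m Mt; rewrite ger0_norm // (lt_trans h2) //.
  by have := hN m (leq_maxr n N); rewrite mulr1 exprVn.
rewrite -(subrKA (u (approx m t))) (le_trans (ler_normD _ _)) // addrC lerD ?(ltW (hd _ hd')) //.
have := hm (m - n)%N; rewrite subnKC ?leq_maxl // => /le_trans; apply.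
have ri0 : 0 <= (1 - r)^-1 by rewrite invr_ge0 ltW.
by rewrite ler_wpM2r // gerBl exprn_ge0 // ltW.
Qed.

(** Points at distance below the mesh have equal or adjacent approximations at level [n]: one grid
    increment plus two chains. *)
Lemma chaining_modulus n s t : (n0 <= n)%N -> - M <= s -> s <= t -> t <= M ->
  t - s < (2 ^+ n)^-1 -> `|u t - u s| <= (1 + 2 / (1 - r)) * r ^+ n.
Proof.
move=> nn Ms st tM ts; have Mt := le_trans Ms st; have sM := le_trans st tM.
have r1' : 0 < 1 - r by rewrite subr_gt0.
have p0 := pow2_gt0 n.
have rn0 : 0 <= r ^+ n by rewrite exprn_ge0 // ltW.
have h : `|u (approx n t) - u (approx n s)| <= r ^+ n.
  have sM0 : 0 <= s + M by lra.
  have [e|e] : ix n t = ix n s \/ ix n t = (ix n s).+1.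
  - apply: truncn_half_step; first by rewrite mulr_ge0 // ltW.
      by rewrite ler_wpM2l ?(ltW p0) // lerD2r.
    have -> : 2 ^+ n * (t + M) = 2 ^+ n * (s + M) + 2 ^+ n * (t - s) by ring.
    by rewrite ltrD2l -ltr_pdivlMl // mulr1.
  - by rewrite /approx e subrr normr0.
  rewrite /approx e hu // -e -/(approx n t).
  by rewrite -subr_ge0 (le_trans (approx_near n Mt).1) // lerB.
have -> : u t - u s = (u t - u (approx n t)) + (u (approx n t) - u (approx n s)) -
    (u s - u (approx n s)) by ring.
have ht := chaining nn Mt tM; have hs := chaining nn Ms sM.
rewrite (le_trans (ler_normB _ _)) // (le_trans (lerD (ler_normD _ _) (lexx _))) //.
apply: le_trans (lerD (lerD ht h) hs) _.
by rewrite le_eqVlt; apply/orP; left; apply/eqP; field; rewrite gt_eqF.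
Qed.

(** The linear term takes care of distances of at least [(2 ^+ n0)^-1], where the grid bound says
    nothing and boundedness of [u] suffices. *)
Lemma chaining_holder (beta : R) : 0 < beta -> r = 2 `^ (- beta) ->
  exists2 C, 0 <= C & forall s t, - M <= s -> s <= t -> t <= M ->
    `|u t - u s| <= C * ((t - s) `^ beta + (t - s)).
Proof.
move=> b0 rE; have r1' : 0 < 1 - r by rewrite subr_gt0.
have [B B0 hB] := bounded_segment (- M) M (V := R^o) cu.
pose C1 := (1 + 2 / (1 - r)) / r; pose C2 := 2 * B * 2 ^+ n0.
have C10 : 0 <= C1 by rewrite divr_ge0 ?addr_ge0 ?divr_ge0 // ltW.
have C20 : 0 <= C2 by rewrite !mulr_ge0 // ?ltW.
exists (C1 + C2); first exact: addr_ge0.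
move=> s t Ms st tM; have ts0 : 0 <= t - s by rewrite subr_ge0.
have [ts|ts] := ltP (t - s) (2 ^+ n0)^-1; last first.
  apply: (@le_trans _ _ (C2 * (t - s))).
    rewrite (le_trans (ler_normB _ _)) // (le_trans (lerD (hB _ _ _) (hB _ _ _))) //.
    - by rewrite (le_trans Ms).
    - by rewrite (le_trans st).
    have B20 : 0 <= 2 * B by rewrite mulr_ge0 // ltW.
    rewrite /C2 -mulrA (_ : B + B = 2 * B * 1); last by ring.
    by rewrite ler_wpM2l // -ler_pdivrMl // mulr1.
  by rewrite ler_pM // ?lerDr ?lerDl ?powR_ge0.
have [ts'|ts'] := eqVneq (t - s) 0.
  have -> : t = s by apply/eqP; rewrite -subr_eq0 ts'.
  by rewrite !subrr normr0 mulr_ge0 ?(addr_ge0 C10 C20) // addr0 powR_ge0.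
have {}ts0 : 0 < t - s by rewrite lt_neqAle eq_sym ts'.
have [N0 hN0] : exists N, forall m, (N <= m)%N -> (2^-1 : R) ^+ m * 1 < t - s.
  by apply: geometric_small => //; rewrite invf_lt1 // ltr1n.
have ex : exists N, (2^-1 : R) ^+ N <= t - s.
  by exists N0; have := hN0 _ (leqnn N0); rewrite mulr1 => /ltW.
(* By minimality [t - s] lies between the meshes of levels [N] and [N.-1]: the modulus is used at
   level [N.-1], and the loss of one level is the division by [r] in [C1]. *)
have [N hN minN] := ex_minnP ex.
have n0N : (n0 < N)%N.
  rewrite ltnNge; apply/negP => Nn.
  have : (2 ^+ n0)^-1 <= t - s.
    rewrite (le_trans _ hN) // -exprVn ler_wiXn2l // invf_le1 // ler1n //.
  by rewrite leNgt ts.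
have hN' : t - s < (2 ^+ N.-1)^-1.
  rewrite ltNge; apply/negP; rewrite -exprVn => /minN.
  by rewrite leqNgt ltn_predL (leq_ltn_trans (leq0n _) n0N).
have Ngt0 : (0 < N)%N by exact: leq_ltn_trans n0N.
have nN : (n0 <= N.-1)%N by rewrite -ltnS (prednK Ngt0).
apply: le_trans (chaining_modulus nN Ms st tM hN') _.
have e1 : r ^+ N.-1 = r ^+ N / r.
  by rewrite -[in RHS](prednK Ngt0) exprSr mulfK // gt_eqF.
have e2 : r ^+ N <= (t - s) `^ beta.
  have half : (2^-1 : R) `^ beta = r by rewrite -[2^-1]powR_inv1 // -powRrM mulN1r rE.
  have := @ge0_ler_powR _ beta (ltW b0) ((2^-1) ^+ N) (t - s).
  rewrite !nnegrE exprn_ge0 // (ltW ts0) => /(_ isT isT hN).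
  by rewrite powR_exprn // half.
have -> : (1 + 2 / (1 - r)) * r ^+ N.-1 = C1 * r ^+ N.
  by rewrite e1 /C1; set x := 1 + _; ring.
apply: (@le_trans _ _ (C1 * (t - s) `^ beta)); first by rewrite ler_wpM2l.
by rewrite ler_pM ?powR_ge0 // ?lerDl // ltW.
Qed.

End Chaining.

(** * Tails of the normal law *)

Section GaussianTail.
Context {R : realType}.

Lemma norm_gt_measurable (a : R) : measurable [set x : R | a < `|x|].
Proof.
rewrite (_ : [set x : R | a < `|x|] = `]a, +oo[%classic `|` `]-oo, - a[%classic); last first.
  apply/seteqP; split => x /=; rewrite !in_itv /= andbT lter_normr [a < - x]ltrNr.
    by move=> /orP[|]; [left|right].
  by move=> [->|->] //; rewrite orbT.
by apply: measurableU; exact: measurable_itv.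
Qed.

(** For [|x| > a] the density is at most the stated constant times the normal density of doubled
    variance, whose total mass is 1. The [Num.sqrt 2] is the ratio of the two peaks. *)
Lemma normal_prob_tail (s a : R) : 0 < s -> 0 <= a ->
  (normal_prob 0 s [set x : R | (a < `|x|)%R] <=
   (Num.sqrt 2 * expR (- (a ^+ 2 / (4 * s ^+ 2))))%:E)%E.
Proof.
move=> s0 a0; pose c : R := Num.sqrt 2 * expR (- (a ^+ 2 / (4 * s ^+ 2))).
rewrite -[X in (_ <= X%:E)%E]/c.
have c0 : 0 <= c by rewrite mulr_ge0 ?sqrtr_ge0 ?expR_ge0.
have mA : measurable [set x : R | a < `|x|] by exact: norm_gt_measurable.
pose s' := Num.sqrt 2 * s.
have s'0 : 0 < s' by rewrite mulr_gt0 // sqrtr_gt0.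
have s2 : s' ^+ 2 = 2 * s ^+ 2 by rewrite exprMn sqr_sqrtr.
have ms (r : R) : measurable_fun [set: R] (EFin \o normal_pdf 0 r).
  by apply/measurable_EFinP; exact: measurable_normal_pdf.
have bound x : a < `|x| -> normal_pdf 0 s x <= c * normal_pdf 0 s' x.
  move=> ax; rewrite /normal_pdf !gt_eqF // /normal_peak /normal_fun !subr0 s2.
  set p := Num.sqrt (s ^+ 2 * pi *+ 2).
  have p0 : 0 < p by rewrite sqrtr_gt0 pmulrn_lgt0 // mulr_gt0 ?exprn_gt0 ?pi_gt0.
  have -> : Num.sqrt (2 * s ^+ 2 * pi *+ 2) = Num.sqrt 2 * p.
    by rewrite /p -sqrtrM //; congr Num.sqrt; ring.
  have q0 : 0 < Num.sqrt 2 :> R by rewrite sqrtr_gt0.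
  rewrite /c (_ : _ * _ * (_ * _) = p^-1 * (expR (- (a ^+ 2 / (4 * s ^+ 2))) *
    expR (- x ^+ 2 / ((2 * s ^+ 2) *+ 2)))); last by field; rewrite !gt_eqF.
  rewrite ler_pM2l ?invr_gt0 // -expRD ler_expR -subr_ge0.
  have -> : - (a ^+ 2 / (4 * s ^+ 2)) + - x ^+ 2 / (2 * s ^+ 2 *+ 2) - - x ^+ 2 / (s ^+ 2 *+ 2) =
      (x ^+ 2 - a ^+ 2) / (4 * s ^+ 2) by field; rewrite gt_eqF.
  rewrite divr_ge0 ?mulr_ge0 ?exprn_ge0 ?(ltW s0) // subr_ge0 -[x ^+ 2]real_normK ?num_real //.
  by rewrite ler_sqr ?nnegrE // ltW.
rewrite /normal_prob; set m := lebesgue_measure; set A := [set x | _].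
apply: (@le_trans _ _ (\int[m]_(x in A) (c%:E * (normal_pdf 0 s' x)%:E))%E).
  apply: ge0_le_integral => //.
  - by move=> x _; rewrite lee_fin normal_pdf_ge0.
  - by apply: measurable_funTS; exact: ms.
  - by apply: measurable_funTS; apply: measurable_funeM; exact: ms.
apply: (@le_trans _ _ (\int[m]_x (c%:E * (normal_pdf 0 s' x)%:E))%E).
  apply: ge0_subset_integral => //.
    by apply: measurable_funeM; exact: ms.
  by move=> x _; rewrite -EFinM lee_fin mulr_ge0 // normal_pdf_ge0.
rewrite ge0_integralZl //; last by move=> x _; rewrite lee_fin normal_pdf_ge0.
  by rewrite integral_normal_pdf mule1.
by apply/measurable_EFinP; exact: measurable_normal_pdf.
Qed.

End GaussianTail.

(** * Almost sure bound on dyadic Brownian increments *)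

Section Wiener.
Context {R : realType}.

(** Singletons are compact, so the compact-open topology controls the values at [s] and [t]. *)
Lemma increment_open (s t a : R) :
  open [set g : {compact-open, R -> R} | a < `|g t - g s|].
Proof.
rewrite openE => g /= ag; set e := (`|g t - g s| - a) / 2.
have e0 : 0 < e by rewrite divr_gt0 // subr_gt0.
pose N x := [set h : {compact-open, R -> R} | h @` [set x] `<=` ball (g x) e].
have Nx x : nbhs (g : {compact-open, R -> R}) (N x).
  apply: open_nbhs_nbhs; split.
    by apply: compact_open_open; [exact: compact_set1|exact: ball_open].
  by move=> _ [_ -> <-]; exact: ballxx.
apply: filterS (filterI (Nx s) (Nx t)) => h [hs ht] /=.
have := hs (h s) (ex_intro2 _ _ s erefl erefl).
have := ht (h t) (ex_intro2 _ _ t erefl erefl).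
rewrite -!ball_normE /= => h1 h2.
have : `|g t - g s| <= `|g t - h t| + `|g s - h s| + `|h t - h s|.
  have -> : g t - g s = (g t - h t) - (g s - h s) + (h t - h s) by ring.
  by rewrite (le_trans (ler_normD _ _)) // lerD // ler_normB.
by move: h1 h2; rewrite /e; lra.
Qed.

Lemma increment_measurable (s t a : R) :
  measurable ([set w : wpath R | a < `|w t - w s|] : set (wiener_space R)).
Proof.
apply: sub_sigma_algebra; exists [set g : {compact-open, R -> R} | a < `|g t - g s|] => //.
exact: increment_open.
Qed.

Lemma increment_tail (P : probability (wiener_space R) R) (s t a : R) :
  is_wiener_measure P -> s < t -> 0 <= a ->
  (P [set w : wpath R | (a < `|w t - w s|)%R] <=
   (Num.sqrt 2 * expR (- (a ^+ 2 / (4 * (t - s)))))%:E)%E.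
Proof.
move=> hP st a0.
have ts0 : 0 < t - s by rewrite subr_gt0.
have mA := @norm_gt_measurable R a.
have := hP 1%N (fun i => if i is 0%N then s else t) (fun=> [set x : R | a < `|x|]).
rewrite big_ord1 /= => h.
have -> : [set w : wpath R | a < `|w t - w s|] =
  [set w : wpath R | forall i, (i < 1)%N -> [set x : R | a < `|x|]
    (w (if i.+1 is 0%N then s else t) - w (if i is 0%N then s else t))].
  apply/seteqP; split => w /=; first by move=> aw [|//].
  by move=> /(_ 0%N isT).
rewrite h //; last by case.
have := @normal_prob_tail R (Num.sqrt (t - s)) a _ a0.
by rewrite sqrtr_gt0 sqr_sqrtr ?(ltW ts0) //; apply.
Qed.

(** Raise [y / m <= expR (y / m)] to the power [m] and invert. *)
Lemma expR_pow_bound (y : R) m : 0 < y -> (0 < m)%N -> expR (- y) <= (m%:R / y) ^+ m.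
Proof.
move=> y0 m0; have m0' : 0 < m%:R :> R by rewrite ltr0n.
have -> : - y = m%:R * - (y / m%:R) by field; rewrite gt_eqF.
rewrite expRM_natl lerXn2r ?nnegrE ?expR_ge0 ?divr_ge0 // ?(ltW y0) //.
rewrite expRN -[leRHS]invf_div lef_pV2 ?posrE ?expR_gt0 ?divr_gt0 //.
by have := expR_ge1Dx (y / m%:R); lra.
Qed.

(** Fix [m] with [4 <= q ^+ m]: the polynomial bound of degree [m] on the exponential then decays
    like 4^{-n}, enough to beat the 2^n intervals and still leave a summable 2^{-n}. *)
Lemma dyadic_tail_bound (q : R) : 1 < q ->
  exists2 C, 0 <= C & forall n, 2 ^+ n * expR (- (q ^+ n / 4)) <= C / 2 ^+ n.
Proof.
move=> q1; have q0 : 0 < q by rewrite (lt_trans ltr01).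
have [m hm] : exists m, forall n, (m <= n)%N -> q^-1 ^+ n * 1 < 1 / 4.
  by apply: geometric_small; rewrite ?invr_ge0 ?invf_lt1 ?divr_gt0 // ltW.
have {hm} : 4 <= q ^+ m.+1.
  have := hm m.+1 (leqnSn m); rewrite mulr1 exprVn div1r => /ltW.
  by rewrite lef_pV2 ?posrE ?exprn_gt0.
move: {m} m.+1 (ltn0Sn m) => m m0 qm.
exists ((4 * m%:R) ^+ m); first by rewrite exprn_ge0 // mulr_ge0.
move=> n; have qn0 : 0 < q ^+ n by rewrite exprn_gt0.
have p0 : 0 < 2 ^+ n :> R by rewrite exprn_gt0.
rewrite mulrC -ler_pdivlMr // (le_trans (expR_pow_bound (m := m) _ m0)) ?divr_gt0 //.
have -> : (m%:R / (q ^+ n / 4)) ^+ m = (4 * m%:R) ^+ m / (q ^+ m) ^+ n.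
  rewrite -exprM mulnC exprM -expr_div_n; congr (_ ^+ _).
  by field; rewrite gt_eqF.
rewrite -mulrA ler_wpM2l ?exprn_ge0 ?mulr_ge0 // -invfM -exprMn.
have qm0 : 0 < q ^+ m by rewrite exprn_gt0.
rewrite lef_pV2 ?posrE ?exprn_gt0 ?mulr_gt0 //.
rewrite lerXn2r ?nnegrE ?mulr_ge0 ?(ltW qm0) //.
by rewrite (le_trans _ qm) //; lra.
Qed.

Variables (P : probability (wiener_space R) R) (r : R).
Hypotheses (hP : is_wiener_measure P) (r0 : 0 < r) (r2 : 1 < 2 * r ^+ 2).

Let big_increment (N n k : nat) : set (wiener_space R) :=
  [set w : wpath R | r ^+ n < `|w (dyadic N%:R n k.+1) - w (dyadic N%:R n k)|].

Let bad (N n : nat) : set (wiener_space R) :=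
  \big[setU/set0]_(k < 2 * N * 2 ^ n) big_increment N n k.

Let bad_measurable N n : measurable (bad N n).
Proof. by apply: bigsetU_measurable => k _; exact: increment_measurable. Qed.

(** An increment over 2^{-n} exceeds r^n with the Gaussian exponent (2 r^2)^n / 4, which grows
    geometrically by [r2]. *)
Let bad_tail N : (\sum_(n <oo) P (bad N n) < +oo)%E.
Proof.
have [C C0 hC] := dyadic_tail_bound r2.
(* There are 2 N 2^n cells, each with probability at most sqrt 2 times the exponential; by [hC]
   level [n] costs at most c / 2^{n+1}, and these bounds sum to [c]. *)
pose c : R := 4 * N%:R * Num.sqrt 2 * C.
have c0 : 0 <= c by rewrite !mulr_ge0 ?sqrtr_ge0.
apply: (@le_lt_trans _ _ c%:E); last exact: ltry.
apply: le_trans (epsilon_trick0 xpredT c0).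
apply: lee_nneseries => [n _ _|n _]; first exact: measure_ge0.
apply: (@le_trans _ _ (\sum_(k < 2 * N * 2 ^ n) P (big_increment N n k))%E).
  by apply: Boole_inequality => k _; exact: increment_measurable.
pose x : R := Num.sqrt 2 * expR (- ((2 * r ^+ 2) ^+ n / 4)).
apply: (@le_trans _ _ (\sum_(k < 2 * N * 2 ^ n) x%:E)%E).
  apply: lee_sum => k _.
  have p0 : 0 < 2 ^+ n :> R by rewrite exprn_gt0.
  have d : dyadic N%:R n k.+1 - dyadic N%:R n k = (2 ^+ n)^-1 :> R.
    by rewrite /dyadic -natr1; field; rewrite gt_eqF.
  have lt_d : dyadic N%:R n k < dyadic N%:R n k.+1 :> R by rewrite -subr_gt0 d invr_gt0.
  have := increment_tail hP lt_d (exprn_ge0 n (ltW r0)).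
  rewrite d (_ : (r ^+ n) ^+ 2 / (4 / 2 ^+ n) = (2 * r ^+ 2) ^+ n / 4) //.
  by rewrite exprMn -!exprM mulnC; field; rewrite gt_eqF.
rewrite sumEFin lee_fin sumr_const card_ord -[x *+ _]mulr_natl !natrM natrX /x /c.
have := hC n; have s0 : 0 <= 2 * N%:R * Num.sqrt 2 :> R by rewrite !mulr_ge0 ?sqrtr_ge0.
move=> /(ler_wpM2l s0); rewrite natrX (exprS 2 n) invfM.
set e := expR _; set p := 2 ^+ n; set ip := p^-1 => h.
rewrite [leLHS](_ : _ = 2 * N%:R * Num.sqrt 2 * (p * e)); last by ring.
by rewrite (le_trans h) // le_eqVlt; apply/orP; left; apply/eqP; field.
Qed.

(** Borel-Cantelli for each [N]; the countable union of the null sets leaves a single one that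
    serves every horizon. *)
Lemma wiener_dyadic_modulus :
  {ae P, forall w : wiener_space R, forall N : nat, exists n0, forall n k, (n0 <= n)%N ->
    dyadic (N%:R : R) n k.+1 <= N%:R ->
    `|(w : wpath R) (dyadic (N%:R : R) n k.+1) - (w : wpath R) (dyadic (N%:R : R) n k)| <= r ^+ n}.
Proof.
have h N : P.-negligible (lim_sup_set (bad N)).
  exists (lim_sup_set (bad N)); split => //.
    by apply: bigcap_measurable => // n _; apply: bigcup_measurable => k _; exact: bad_measurable.
  by apply: lim_sup_set_cvg0; [exact: bad_measurable|exact: bad_tail].
apply: negligibleS (negligible_bigcup h) => w /= /existsNP[N hN].
exists N => // n _; apply: contrapT => hn; apply: hN; exists n => m k nm km.
rewrite leNgt; apply/negP => hlt; apply: hn; exists m => //.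
rewrite /bad -bigcup_mkord; exists k => //=.
have p0 : 0 < 2 ^+ m :> R by rewrite exprn_gt0.
rewrite -(ltr_nat R) !natrM natrX.
move: km; rewrite /dyadic -lerBrDl opprK ler_pdivrMr // -natr1.
by rewrite -mulr2n -mulr_natl; lra.
Qed.

End Wiener.

(** * Comparison of the two noises and conclusion *)

Section PathEstimates.
Context {R : realType}.

Lemma sublinear_bound (h : R -> R) : h t / t @[t --> -oo] --> (0 : R) ->
  exists2 A, A < 0 & forall t, t <= A -> `|h t| <= - t.
Proof.
move=> /cvgrPdist_le/(_ 1 ltr01)[A [_ hA]].
exists (Num.min A 0 - 1); first by rewrite subr_lt0 gt_min ltr01 orbT.
move=> t tA; have [tA' t0] : t < A /\ t < 0.
  by move: tA; case: (leP A 0) => ? ?; split; lra.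
have := hA t tA'; rewrite sub0r normrN normrM normfV (ltr0_norm t0).
by rewrite ler_pdivrMr ?oppr_gt0 // mul1r.
Qed.

Lemma sublinear_tail (h : R -> R) lam : continuous h -> 0 < lam ->
  h t / t @[t --> -oo] --> (0 : R) ->
  forall T, exists C, forall r, r <= T -> `|h r| <= C * expR (- lam * r).
Proof.
move=> ch lam0 /sublinear_bound[A A0 hA] T.
have [M M0 hM] := bounded_segment A T (V := R^o) ch.
exists (lam^-1 + M * expR (lam * T)) => r rT; have E0 := expR_ge0 (- lam * r).
have li0 : 0 <= lam^-1 by rewrite invr_ge0 ltW.
have [rA|Ar] := leP r A.
  rewrite (le_trans (hA r rA)) // (@le_trans _ _ (lam^-1 * expR (- lam * r))) //.
    rewrite mulrC ler_pdivlMr //; have := expR_ge1Dx (- lam * r); lra.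
  by rewrite ler_wpM2r // lerDl mulr_ge0 ?expR_ge0 // ltW.
rewrite (le_trans (hM r (ltW Ar) rT)) // mulrDl -[leLHS]add0r lerD ?mulr_ge0 //.
rewrite -mulrA -expRD -[leLHS]mulr1 ler_wpM2l ?(ltW M0) // -expR0 ler_expR.
by rewrite mulNr -mulrBr mulr_ge0 ?subr_ge0 // ltW.
Qed.

(** There is no lower limit on [s], because the Ornstein-Uhlenbeck process sees the whole past. The
    recent past is covered by chaining, the remote one by sublinear growth, which the linear term
    accommodates. *)
Lemma wiener_holder (w : wpath R) (beta r : R) : 0 < beta -> r = 2 `^ (- beta) ->
  w t / t @[t --> -oo] --> (0 : R) ->
  (forall N : nat, exists n0, forall n k, (n0 <= n)%N ->
    dyadic (N%:R : R) n k.+1 <= N%:R ->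
    `|w (dyadic (N%:R : R) n k.+1) - w (dyadic (N%:R : R) n k)| <= r ^+ n) ->
  forall T, exists2 C, 0 <= C & forall s t, 0 <= t -> t <= T -> s <= t ->
    `|w t - w s| <= C * ((t - s) `^ beta + (t - s)).
Proof.
move=> b0 rE /sublinear_bound[A A0 hA] hw T.
have r0 : 0 < r by rewrite rE powR_gt0.
have r1 : r < 1.
  rewrite rE powRN invf_lt1 ?powR_gt0 //.
  have := @gt0_ltr_powR _ beta b0 1 2; rewrite !nnegrE powR1; apply=> //; exact: ltr1n.
(* Large enough that [s < - N] implies both [s <= A] and [1 <= t - s], while [T <= N]. *)
pose N := (Num.truncn (`|T| + `|A|)).+1.
have hN : `|T| + `|A| < N%:R by exact: truncnS_gt.
have N1 : 1 <= N%:R :> R by rewrite ler1n.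
have [n0 hn0] := hw N.
have [C C0 hC] := chaining_holder (@wpath_continuous _ w) r0 r1 hn0 b0 rE.
have [B B0 hB] := bounded_segment 0 T (V := R^o) (@wpath_continuous _ w).
exists (C + (B + 1)); first by rewrite !addr_ge0 // ltW.
move=> s t t0 tT st; have p0 := powR_ge0 (t - s) beta.
have ts0 : 0 <= t - s by rewrite subr_ge0.
have TN : T <= N%:R by have := ler_norm T; have := normr_ge0 A; lra.
have [sN|sN] := leP (- N%:R) s.
  have CB : C <= C + (B + 1) by rewrite lerDl addr_ge0 // ltW.
  by apply: le_trans (hC s t sN st (le_trans tT TN)) _; rewrite ler_wpM2r // addr_ge0.
have sA : s <= A by have := ler_norm (- A); rewrite normrN; have := normr_ge0 T; lra.
rewrite (le_trans (ler_normB _ _)) // (le_trans (lerD (hB t t0 tT) (hA s sA))) //.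
rewrite (@le_trans _ _ ((B + 1) * (t - s))) //.
  rewrite mulrDl mul1r lerD //; last by lra.
  by rewrite -[leLHS]mulr1 ler_wpM2l ?(ltW B0) //; lra.
have B1 : 0 <= B + 1 by rewrite addr_ge0 // ltW.
by rewrite ler_pM // ?lerDr.
Qed.

(** In the time scale y = (x - s) / mu, both (mu y)^beta and mu y are at most mu^beta (1 + y) when
    mu <= 1, which is the hypothesis of [OU_bound]. The 16 is 2 for these two terms, 4 from
    [OU_bound], and 2 for the times [t] and 0. *)
Lemma OUint_dist (w : wpath R) (beta : R) T : 0 < beta -> beta <= 1 ->
  w t / t @[t --> -oo] --> (0 : R) ->
  (exists2 C, 0 <= C & forall s t, 0 <= t -> t <= T -> s <= t ->
    `|w t - w s| <= C * ((t - s) `^ beta + (t - s))) ->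
  exists2 C, 0 <= C & forall mu t, 0 < mu -> mu <= 1 -> 0 <= t -> t <= T ->
    `|w t - OUint mu w t| <= C * mu `^ beta.
Proof.
move=> b0 b1 hw [C C0 hC]; exists (16 * C); first by rewrite mulr_ge0.
move=> mu t mu0 mu1 t0 tT.
have lam0 : 0 < (2 * mu)^-1 by rewrite invr_gt0 mulr_gt0.
have tw := sublinear_tail (@wpath_continuous _ w) lam0 hw.
rewrite (OUint_diff mu0 tw).
have m0 := powR_ge0 mu beta.
have C20 : 0 <= 2 * C * mu `^ beta by rewrite !mulr_ge0.
have bound x : 0 <= x -> x <= T -> `|mu * OU mu w x| <= 4 * (2 * C * mu `^ beta).
  move=> x0 xT; apply: (OU_bound mu0 tw C20) => s sx.
  rewrite (le_trans (hC s x x0 xT sx)) // [2 * C]mulrC -!mulrA ler_wpM2l //.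
  set y := (x - s) / mu; have y0 : 0 <= y by rewrite divr_ge0 ?subr_ge0 // ltW.
  have -> : x - s = mu * y by rewrite /y mulrC divfK // gt_eqF.
  have h1 : (mu * y) `^ beta <= mu `^ beta * (1 + y).
    rewrite powRM ?(ltW mu0) // ler_wpM2l //.
    have [y1|y1] := leP y 1; last first.
      by rewrite (le_trans (ler1_powR (ltW y1) b1)) // lerDr.
    have := @ge0_ler_powR _ beta (ltW b0) y 1; rewrite !nnegrE powR1 => /(_ y0 ler01 y1).
    by move=> /le_trans; apply; rewrite lerDl.
  have h2 : mu * y <= mu `^ beta * (1 + y).
    by rewrite ler_pM ?(ltW mu0) // ?lerDr // ger1_powR // mu0.
  by have := lerD h1 h2; lra.
rewrite (le_trans (ler_normB _ _)) //.
have T0 := le_trans t0 tT.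
by apply: le_trans (lerD (bound t t0 tT) (bound 0 (lexx 0) T0)) _; lra.
Qed.

End PathEstimates.

(** * Tracking for a noise with continuous density *)

Section Assembly.
Context {R : realType} {H1 H2 : completeNormedModType R}.
Variables (SA : R -> H1 -> H1) (SB : R -> H2 -> H2) (gamma1 gamma2 : R).
Hypotheses (hSA : C0_semigroup SA) (hSB : C0_group SB).
Hypotheses (gamma10 : 0 <= gamma1).
Hypothesis SAdecay : forall t x, 0 <= t -> `|SA t x| <= expR (- gamma1 * t) * `|x|.
Hypothesis SBdecay : forall t y, t <= 0 -> `|SB t y| <= expR (- gamma2 * t) * `|y|.
Variables (f : H1 * H2 -> H1) (g : H1 * H2 -> H2).
Hypotheses (hfc : continuous f) (hgc : continuous g).
Variables (K eps : R) (K0 : 0 < K) (eps0 : 0 < eps).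
Hypothesis hfK : forall z z', `|f z - f z'| <= K * normH (z - z').
Hypothesis hgK : forall z z', `|g z - g z'| <= K * normH (z - z').

Section RegularNoise.
Variables (sigma : H1) (u : R -> R).
Hypothesis cu : continuous u.

Let us r := u r *: sigma.

Let us_continuous : continuous us.
Proof. by move=> r; apply: cvgZr_tmp; exact: cu. Qed.

Let noise (s t : R) (N : H1) :=
  is_RSint (fun r => u r *: SA ((t - r) / eps) sigma) id s t N.

Let noise_unique s t N N' : 0 <= s -> s <= t -> noise s t N -> noise s t N' -> N = N'.
Proof. by move=> _; exact: is_RSint_unique. Qed.

Let eta := convA SA eps us 0.

Let eta0 : eta 0 = 0. Proof. exact: convA_refl. Qed.

Let eta_continuous : continuous (fun t : R => eta (Num.max 0 t)).
Proof. exact: (convA_continuous hSA eps0 gamma10 SAdecay us_continuous (a := 0)). Qed.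

Let noise_eta s t : 0 <= s -> s <= t -> noise s t (eta t - SA ((t - s) / eps) (eta s)).
Proof.
move=> s0 st.
have -> : eta t - SA ((t - s) / eps) (eta s) = convA SA eps us s t.
  rewrite /eta (convA_chasles hSA eps0 gamma10 SAdecay us_continuous s0 st).
  by rewrite addrAC subrr add0r.
apply: (eq_is_RSint _ (convAP hSA eps0 gamma10 SAdecay us_continuous st)) => r sr rt.
by rewrite (semigroupZ hSA gamma10 SAdecay) // divr_ge0 ?subr_ge0 // ltW.
Qed.

(** For [u := OU mu w] this is [WZ_sol] up to conversion. *)
Definition regular_sol zeta := xget (cst 0)
  [set z | mild_solution SA SB f g eps noise `[0, +oo[ z /\ z 0 = zeta].

Lemma regular_sol_forward zeta : exists z, [/\ continuous z,
  forall t, forward SA SB f g eps eta zeta z t = z t &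
  forall t, 0 <= t -> regular_sol zeta t = z t].
Proof.
have [z cz hz] := forward_fixpoint hSA hSB gamma10 SAdecay hfc hgc K0 eps0 hfK hgK
  zeta eta_continuous.
exists z; split => // t t0.
exact: (mild_unique hSA hSB gamma10 SAdecay hfc hgc K0 eps0 hfK hgK eta0
  noise_unique noise_eta cz hz t0).
Qed.

Lemma regular_sol_mild zeta z : mild_solution SA SB f g eps noise `[0, +oo[ z -> z 0 = zeta ->
  forall t, 0 <= t -> regular_sol zeta t = z t.
Proof.
move=> mz z0 t t0.
have [cz hz] := mild_forward hSA hSB gamma10 SAdecay hfc hgc eps0 eta0 noise_unique noise_eta mz z0.
rewrite -[in RHS](max_idPr t0).
exact: (mild_unique hSA hSB gamma10 SAdecay hfc hgc K0 eps0 hfK hgK eta0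
  noise_unique noise_eta cz hz t0).
Qed.

Variable rho : R.
Hypotheses (rho0 : 0 < rho) (rhoK : K < gamma1 - rho) (lamg : gamma2 < rho / eps).
Hypothesis kappa1 : K / (gamma1 - rho) + K / (rho / eps - gamma2) < 1.
Hypothesis hu : forall T, exists C, forall r, r <= T -> `|u r| <= C * expR (- (rho / eps) * r).

Lemma regular_tracking zeta : exists zetabar,
  (exists z, [/\ mild_solution SA SB f g eps noise `]-oo, 0] z, z 0 = zetabar &
     Cminus eps rho z]) /\
  forall t, 0 <= t -> normH (regular_sol zeta t - regular_sol zetabar t) <=
    normH (zeta - zetabar) / (1 - (K / (gamma1 - rho) + K / (rho / eps - gamma2))) *
    expR (- (rho / eps) * t).
Proof.
have [Z [cZ hZ solZ]] := regular_sol_forward zeta.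
have [z [cz nz hz]] := lyapunov_perron_fixpoint hSA hSB gamma10 SAdecay SBdecay hfc hgc
  K0 eps0 hfK hgK rho0 rhoK lamg kappa1 cu hu cZ hZ.
have mild J := lyapunov_perron_mild hSA hSB gamma10 SAdecay hfc hgc
  K0 eps0 hfK rho0 rhoK cu hu cZ hZ J cz nz hz.
exists (z 0); split; last first.
  move=> t t0; rewrite solZ // (regular_sol_mild (mild _) erefl t0).
  exact: (lyapunov_perron_tracking hSA hSB gamma10 SAdecay SBdecay hfc hgc
    K0 eps0 hfK hgK rho0 rhoK lamg kappa1 cu hu cZ hZ cz nz hz t0).
exists z; split; [exact: mild|by []|split; first exact: continuous_subspaceT].
have [c hc] := nz; pose lam := rho / eps.
have lam0 : 0 < lam by rewrite divr_gt0.
(* For [t <= 0] the reference [Z] is constant, so closeness to [Z] in the weighted sense is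
   membership of the backward space. *)
have bound t : t <= 0 -> expR (lam * t) * normH (z t) <= c + normH (Z 0).
  move=> t0; have Zt : Z t = Z 0 by rewrite -hZ -forward_max0 hZ (max_idPl t0).
  have -> : z t = (z t - Z t) + Z t by rewrite subrK.
  apply: le_trans (ler_wpM2l (expR_ge0 _) (normHD _ _)) _; rewrite mulrDr Zt lerD //.
    have := ler_wpM2l (expR_ge0 (lam * t)) (hc t); rewrite Zt => /le_trans; apply.
    by rewrite mulrCA -expRD -/lam mulNr addrN expR0 mulr1.
  rewrite -[leRHS]mul1r ler_wpM2r ?normH_ge0 // -expR0 ler_expR.
  by rewrite pmulr_rle0.
rewrite /Cminus_norm; apply: (@le_lt_trans _ _ ((c + normH (Z 0))%:E + (c + normH (Z 0))%:E)%E).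
  apply: leeD; apply: ge_ereal_sup => _ [t /= + <-]; rewrite in_itv /= => t0;
    rewrite lee_fin; apply: le_trans (bound t t0); rewrite ler_wpM2l ?expR_ge0 //.
    by rewrite /normH lerDl.
  by rewrite /normH lerDr.
by rewrite -EFinD ltry.
Qed.

End RegularNoise.

End Assembly.

(** With D = 1/K - 1/(gamma1 - rho), the bound on [eps] reads 1/D < rho/eps - gamma2; inverting and
    multiplying by [K] gives K / (rho/eps - gamma2) < K D = 1 - K / (gamma1 - rho). *)
Lemma gap_condition {R : realType} (K gamma1 gamma2 rho eps : R) :
  0 < K -> 0 < gamma2 -> K < gamma1 - rho -> 0 < eps ->
  eps < rho / (gamma2 + 1 / (1 / K - 1 / (gamma1 - rho))) ->
  gamma2 < rho / eps /\ K / (gamma1 - rho) + K / (rho / eps - gamma2) < 1.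
Proof.
move=> K0 g20 rK e0 he; have gr0 : 0 < gamma1 - rho by exact: lt_trans rK.
set D := 1 / K - 1 / (gamma1 - rho) in he.
have D0 : 0 < D by rewrite subr_gt0 !div1r ltf_pV2 ?posrE.
have Di0 : 0 < 1 / D by rewrite div1r invr_gt0.
have h : gamma2 + 1 / D < rho / eps.
  by rewrite ltr_pdivlMr // mulrC -ltr_pdivlMr ?addr_gt0.
have lg : 1 / D < rho / eps - gamma2 by rewrite ltrBrDl.
split; first by rewrite -subr_gt0 (lt_trans Di0).
have x0 : 0 < rho / eps - gamma2 by exact: lt_trans lg.
have h2 : (rho / eps - gamma2)^-1 < D.
  by rewrite -[D]invrK ltf_pV2 ?posrE ?invr_gt0 // -div1r.
have : K * (rho / eps - gamma2)^-1 < K * D by rewrite ltr_pM2l.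
have -> : K * D = 1 - K / (gamma1 - rho).
  by rewrite /D; field; rewrite !gt_eqF.
lra.
Qed.

Theorem theorem2p9 (R : realType) (H1 H2 : completeNormedModType R)
  (hH1 : separable_hilbert H1) (hH2 : separable_hilbert H2)
  (DA : set H1) (A : H1 -> H1) (SA : R -> H1 -> H1)
  (DB : set H2) (B : H2 -> H2) (SB : R -> H2 -> H2)
  (gamma1 gamma2 : R) (hgamma1 : 0 < gamma1) (hgamma2 : 0 < gamma2)
  (hA : generates_C0_semigroup DA A SA)
  (hSA : forall t x, 0 <= t -> `|SA t x| <= expR (- gamma1 * t) * `|x|)
  (hB : generates_C0_group DB B SB)
  (hSB : forall t y, t <= 0 -> `|SB t y| <= expR (- gamma2 * t) * `|y|)
  (f : H1 * H2 -> H1) (g : H1 * H2 -> H2)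
  (hfc : continuous f) (hgc : continuous g)
  (hf0 : f (0, 0) = 0) (hg0 : g (0, 0) = 0)
  (K : R) (hK : 0 < K)
  (hfK : forall x1 y1 x2 y2,
     `|f (x1, y1) - f (x2, y2)| <= K * (`|x1 - x2| + `|y1 - y2|))
  (hgK : forall x1 y1 x2 y2,
     `|g (x1, y1) - g (x2, y2)| <= K * (`|x1 - x2| + `|y1 - y2|))
  (hKgamma1 : K < gamma1)
  (sigma : H1) (hsigma : DA sigma)
  (P : probability (wiener_space R) R) (hP : is_wiener_measure P)
  (Om : set (wiener_space R)) (hOm : admissible_paths P Om)
  (rho : R) (hrho : 0 < rho) (hrhoK : K < gamma1 - rho)
  (eps : R) (heps0 : 0 < eps)
  (heps : eps < rho / (gamma2 + 1 / (1 / K - 1 / (gamma1 - rho))))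
  (hkappa : kappa_star K gamma1 gamma2 rho eps < 1) :
  forall zeta : H1 * H2,
  exists zetabar : wiener_space R -> R -> H1 * H2,
    (forall w mu, Om w -> 0 < mu ->
       WZ_slow_manifold SA SB f g sigma eps rho mu w (zetabar w mu)) /\
    (forall alpha : R, 0 < alpha -> alpha < 1 / 2 ->
       {ae P, forall w : wiener_space R, forall t, 0 <= t ->
         exists r : R -> R^o,
           r =o_ (0^'+) (fun mu => mu `^ alpha : R^o) /\
           (forall mu, 0 < mu ->
              normH (original_sol SA SB f g sigma eps w zeta t
                     - WZ_sol SA SB f g sigma eps mu w (zetabar w mu) t)
              <= tracking_C1 K gamma1 gamma2 rho eps
                 * expR (- tracking_C2 rho eps * t)
                 * normH (zeta - zetabar w mu)
                 + r mu)}).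
Proof.
move=> zeta.
have [hSAs hgen] := hA; have [hSBg _] := hB.
have g10 := ltW hgamma1.
have hfK' z z' : `|f z - f z'| <= K * normH (z - z') by case: z => x1 y1; case: z' => x2 y2; exact: hfK.
have hgK' z z' : `|g z - g z'| <= K * normH (z - z') by case: z => x1 y1; case: z' => x2 y2; exact: hgK.
pose lam := rho / eps.
have lam0 : 0 < lam by rewrite divr_gt0.
have gr0 : 0 < gamma1 - rho by exact: lt_trans hrhoK.
have [lamg kappa1] := gap_condition hK hgamma2 hrhoK heps0 heps.
(* The two forms differ by eps / (rho - eps gamma2) = 1 / (rho/eps - gamma2). *)
have C1E : tracking_C1 K gamma1 gamma2 rho eps =
    (1 - (K / (gamma1 - rho) + K / (lam - gamma2)))^-1.
  rewrite /tracking_C1 div1r /lam; congr (_^-1); congr (1 - _).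
  have hne : rho + - gamma2 * eps != 0.
    by rewrite mulNr gt_eqF // subr_gt0 -ltr_pdivlMr.
  by field; rewrite hne !gt_eqF.
have [mOm POm shOm wOm ouOm] := hOm.
have tw (w : wpath R) l : Om w -> 0 < l ->
    forall T, exists C, forall r, r <= T -> `|w r| <= C * expR (- l * r).
  by move=> Ow l0; apply: sublinear_tail => //; [exact: wpath_continuous|exact: (wOm w Ow).2].
have cOU (w : wpath R) mu : Om w -> 0 < mu -> continuous (OU mu w).
  by move=> Ow mu0; apply: OU_continuous => //; apply: tw => //; rewrite invr_gt0 mulr_gt0.
have tOU (w : wpath R) mu : Om w -> 0 < mu ->
    forall T, exists C, forall r, r <= T -> `|OU mu w r| <= C * expR (- lam * r).
  move=> Ow mu0; apply: sublinear_tail => //; first exact: cOU.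
  exact: (ouOm w mu Ow mu0).2.
(* The conditions stand after the existential, so that a choice function is defined for all [w] and
   [mu]; outside the conditions the value is 0. *)
have track (w : wiener_space R) mu : exists zb, Om w -> 0 < mu ->
    WZ_slow_manifold SA SB f g sigma eps rho mu w zb /\
    forall t, 0 <= t -> normH (WZ_sol SA SB f g sigma eps mu w zeta t -
        WZ_sol SA SB f g sigma eps mu w zb t) <=
      normH (zeta - zb) / (1 - (K / (gamma1 - rho) + K / (lam - gamma2))) * expR (- lam * t).
  have [[Ow mu0]|nO] := pselect (Om w /\ 0 < mu); last by exists 0 => Ow mu0; case: nO.
  have [zb hzb] := regular_tracking hSAs hSBg g10 hSA hSB hfc hgc hK heps0 hfK' hgK' sigma
    (cOU w mu Ow mu0) hrho hrhoK lamg kappa1 (tOU w mu Ow mu0) zeta.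
  by exists zb.
pose zb w mu := projT1 (cid (track w mu)).
have hzb w mu := projT2 (cid (track w mu)).
exists zb; split; first by move=> w mu Ow mu0; exact: (hzb w mu Ow mu0).1.
(* The midpoint of alpha and 1/2; the margin [beta - alpha] turns O(mu^beta) into o(mu^alpha). *)
move=> alpha al0 al1; pose beta := (alpha + 1 / 2) / 2.
have [b0 b1 ab] : [/\ 0 < beta, beta < 1 / 2 & alpha < beta] by rewrite /beta; split; lra.
pose r : R := 2 `^ (- beta).
have r0 : 0 < r by exact: powR_gt0.
(* 2 r^2 = 2^{1 - 2 beta}, so this is [beta < 1 / 2]. *)
have r2 : 1 < 2 * r ^+ 2.
  have -> : 2 * r ^+ 2 = 2 `^ (1 + (- beta + - beta)).
    by rewrite !powRD ?powRr1 ?expr2 //; apply/implyP => _; rewrite pnatr_eq0.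
  have e0 : 0 < 1 + (- beta + - beta) by lra.
  have := gt0_ltr_powR e0 (x := 1) (y := 2); rewrite !nnegrE powR1.
  by apply => //; rewrite ltr1n.
have aeOm : {ae P, forall w : wiener_space R, Om w}.
  exists (~` Om); split; [exact: measurableC| |by []].
  by rewrite probability_setC // POm subee.
have aew := wiener_dyadic_modulus hP r0 r2.
apply: filterS2 aeOm aew => w Ow hw t t0.
(* The remainder is the whole distance between the two systems started at zeta; the tracking
   estimate accounts for the passage from zeta to zetabar. *)
pose rr mu : R^o := normH (original_sol SA SB f g sigma eps w zeta t -
  WZ_sol SA SB f g sigma eps mu w zeta t).
exists rr; split; last first.
  move=> mu mu0; have [_ htr] := hzb w mu Ow mu0.
  have := htr t t0; set X := original_sol _ _ _ _ _ _ _ _ _ in rr *.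
  rewrite C1E /tracking_C2 -/lam => h.
  have -> : X - WZ_sol SA SB f g sigma eps mu w (zb w mu) t =
    (X - WZ_sol SA SB f g sigma eps mu w zeta t) +
    (WZ_sol SA SB f g sigma eps mu w zeta t - WZ_sol SA SB f g sigma eps mu w (zb w mu) t).
    by rewrite subrKA.
  rewrite (le_trans (normHD _ _)) // addrC lerD //.
  by apply: le_trans h _; rewrite -mulrA mulrC.
have hwoo := (wOm w Ow).2.
have hol := wiener_holder b0 erefl hwoo hw t.
have b1' : beta <= 1 by lra.
have [C C0 hC] := OUint_dist b0 b1' hwoo hol.
have cw : continuous (w : wpath R) := @wpath_continuous _ w.
have [Bc Bc0 hB'] := forward_compare hSAs hSBg g10 hSA hfc hgc hK heps0 hfK' hgK' t.
(* The original system in [forward] form, the Brownian noise being represented by its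
   integrated-by-parts expression. *)
have [U cU hU] := forward_fixpoint hSAs hSBg g10 hSA hfc hgc hK heps0 hfK' hgK' zeta
  (noise_conv_continuous hSAs heps0 g10 hSA (A := A) (sigma := sigma) cw).
have UE : original_sol SA SB f g sigma eps w zeta t = U t.
  exact: (mild_unique hSAs hSBg g10 hSA hfc hgc hK heps0 hfK' hgK'
    (noise_conv0 SA eps A sigma (wpath0 w)) (fun s t N N' _ st => @is_RSint_unique _ _ _ _ _ _ _ _ st)
    (fun s t s0 st => noise_conv_RSint hSAs heps0 g10 hSA hgen hsigma cw s0 st) cU hU t0).
pose D := Bc * ((`|sigma| + eps^-1 * (t * `|A sigma|)) * C).
have D0 : 0 <= D.
  by rewrite !mulr_ge0 // addr_ge0 // mulr_ge0 ?invr_ge0 ?(ltW heps0) // mulr_ge0.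
have bound mu : 0 < mu -> mu <= 1 -> rr mu <= D * mu `^ beta.
  move=> mu0 mu1; have cu := cOU w mu Ow mu0.
  have [Z [cZ hZ ZE]] := regular_sol_forward hSAs hSBg g10 hSA hfc hgc hK heps0 hfK' hgK' sigma cu zeta.
  rewrite /rr UE (_ : WZ_sol _ _ _ _ _ _ _ _ _ _ = Z t); last exact: ZE.
  have -> : D * mu `^ beta = Bc * ((`|sigma| + eps^-1 * (t * `|A sigma|)) * (C * mu `^ beta)).
    by rewrite /D; ring.
  apply: (hB' _ _ _ _ _ _ cU cZ hU hZ _ t t0 (lexx t)) => s s0 st.
  have -> : convA SA eps (fun r => OU mu w r *: sigma) 0 s =
      noise_conv SA eps A sigma (OUint mu w) s.
    have l0 : 0 < (2 * mu)^-1 by rewrite invr_gt0 mulr_gt0.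
    apply: (noise_conv_density hSAs heps0 g10 hSA hgen hsigma _ cu _ _ s0).
    - exact: (OUint_continuous mu0 (tw w _ Ow l0)).
    - by rewrite /OUint subrr mulr0.
    - move=> x y x0 xy; exact: (OUint_RSint mu0 (tw w _ Ow l0) x0 xy).
  have l0 : 0 < (2 * mu)^-1 by rewrite invr_gt0 mulr_gt0.
  apply: (noise_conv_dist hSAs heps0 g10 hSA A sigma cw (OUint_continuous mu0 (tw w _ Ow l0)) s0 st).
  by move=> x x0 xt; exact: hC.
(* [mu ^ beta] is [mu ^ (beta - alpha)] times [mu ^ alpha], and the first factor tends to 0; [D + 1]
   guards against [D = 0]. *)
apply/eqoP => e e0.
have D1 : 0 < D + 1 by rewrite ltr_wpDl.
have ba : 0 < beta - alpha by rewrite subr_gt0.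
have /cvgrPdist_le/(_ _ (divr_gt0 e0 D1)) := powR_cvg0 ba.
move=> hsmall; near=> mu.
have mu0 : 0 < mu by near: mu; exact: nbhs_right_gt.
have mu1 : mu <= 1 by near: mu; exact: nbhs_right_le.
have : `|0 - mu `^ (beta - alpha)| <= e / (D + 1) by near: mu.
rewrite sub0r normrN ger0_norm ?powR_ge0 // ler_pdivlMr // => hmu.
rewrite ger0_norm ?normH_ge0 // (le_trans (bound mu mu0 mu1)) //.
rewrite [X in _ <= e * X]ger0_norm ?powR_ge0 //.
have -> : mu `^ beta = mu `^ (beta - alpha) * mu `^ alpha.
  by rewrite -powRD ?subrK //; apply/implyP => _; rewrite gt_eqF.
rewrite mulrA ler_wpM2r ?powR_ge0 // (le_trans _ hmu) // mulrC.
by rewrite ler_wpM2l ?powR_ge0 // lerDl.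
Unshelve. all: by end_near. Qed.
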